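(* Let $\mathcal{G}(\mathcal{V},\mathcal{E},\bm{A},\bm{\tau})$ be a delay-embedded graph with delay-embedded signed Laplacian $\widehat{\bm{L}}_\tau$. If the extended effective resistance satisfies $r^{\mathrm{eff}}(\widehat{\bm{L}}_\tau,\mathcal{V}_a,\mathcal{V}_b)>0$ (in particular, is well defined) for any two non-empty disjoint sets $\mathcal{V}_a,\mathcal{V}_b\subset\mathcal{V}$, then the system $$\dot{x}_i(t)=\sum_{j=1}^n a_{ij}\bigl(x_j(t-\tau_{ij})-x_i(t-\tau_{ij})\bigr),\qquad i=1,\dots,n,$$ reaches an average consensus.
   Context: Delay-embedded graph: $\mathcal{G}(\mathcal{V},\mathcal{E},\bm{A},\bm{\tau})$ is a connected weighted undirected graph with node set $\mathcal{V}=\{1,\dots,n\}$ and edge set $\mathcal{E}$ (unordered pairs $(i,j)$, $i\ne j$). $\bm{A}=[a_{ij}]\in\mathbb{R}^{n\times n}$ is the weighted adjacency matrix: $a_{ii}=0$; $a_{ij}=a_{ji}$ is the weight (positive or negative) of the edge $(i,j)\in\mathcal{E}$; $a_{ij}=0$ if $(i,j)\notin\mathcal{E}$. $\bm{\tau}=[\tau_{ij}]\in\mathbb{R}^{n\times n}$ is the delay matrix: $\tau_{ii}=0$; $\tau_{ij}=\tau_{ji}\ge 0$ is the delay of the edge $(i,j)\in\mathcal{E}$ (arbitrarily large values allowed); $\tau_{ij}=0$ if $(i,j)\notin\mathcal{E}$. Laplacian of edge values $w_{ij}=w_{ji}$ (with $w_{ij}=0$ if $(i,j)\notin\mathcal{E}$):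 the real symmetric matrix with diagonal entries $\sum_{j\ne i}w_{ij}$ and off-diagonal entries $-w_{ij}$. $\bm{L}_0$ is the Laplacian with $w_{ij}=a_{ij}$; $\bm{L}_0^{\mathrm{abs}}$ is the Laplacian with $w_{ij}=|a_{ij}|$; $\overline{\lambda}=\lambda_{\max}(\bm{L}_0^{\mathrm{abs}})$ is its largest eigenvalue. Standing assumption: $\bm{L}_0$ is positive semi-definite with a simple zero eigenvalue. Delay-embedded signed Laplacian: $\widehat{\bm{L}}_\tau\in\mathbb{R}^{n\times n}$ is the Laplacian with edge values, for $(i,j)\in\mathcal{E}$, - $w_{ij}=a_{ij}$ if $a_{ij}>0$, $\tau_{ij}=0$; - $w_{ij}=a_{ij}e^{-\tau_{ij}\overline{\lambda}}\cos(\tau_{ij}\overline{\lambda})$ if $a_{ij}>0$, $0<\tau_{ij}\overline{\lambda}<\frac{\pi}{2}$; - $w_{ij}=a_{ij}\cos(\tau_{ij}\overline{\lambda})$ if $a_{ij}>0$, $\frac{\pi}{2}\le\tau_{ij}\overline{\lambda}<\pi$; - $w_{ij}=-a_{ij}$ if $a_{ij}>0$, $\tau_{ij}\overline{\lambda}\ge\pi$; - $w_{ij}=a_{ij}$ if $a_{ij}<0$. Extended effective resistance: let $\bm{L}$ be a Laplacian over the graph, $\mathcal{V}_a,\mathcal{V}_b\subset\mathcal{V}$ non-empty and disjoint, $\mathcal{V}_c=\mathcal{V}\setminus(\mathcal{V}_a\cup\mathcal{V}_b)$, $a=|\mathcal{V}_a|$, $b=|\mathcal{V}_b|$, and partition $\bm{L}$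 into blocks $\bm{L}_{aa},\bm{L}_{ab},\bm{L}_{ac},\bm{L}_{bb},\bm{L}_{bc},\bm{L}_{cc}$ accordingly. Then $$r^{\mathrm{eff}}(\bm{L},\mathcal{V}_a,\mathcal{V}_b)=\bigl[\bm{e}_{\mathcal{V}_a}^T(\bm{L}/\bm{L}_{cc})\bm{e}_{\mathcal{V}_a}\bigr]^{-1},\qquad \bm{L}/\bm{L}_{cc}=\begin{bmatrix}\bm{L}_{aa}&\bm{L}_{ab}\\ \bm{L}_{ab}^T&\bm{L}_{bb}\end{bmatrix}-\begin{bmatrix}\bm{L}_{ac}\\ \bm{L}_{bc}\end{bmatrix}\bm{L}_{cc}^{-1}\begin{bmatrix}\bm{L}_{ac}^T&\bm{L}_{bc}^T\end{bmatrix},$$ where $\bm{e}_{\mathcal{V}_a}\in\mathbb{R}^{a+b}$ has entries one at the indices in $\mathcal{V}_a$ and zero elsewhere. If $\mathcal{V}_c=\emptyset$, then $\bm{L}/\bm{L}_{cc}$ is $\bm{L}$ itself. The quantity is well defined when $\bm{L}_{cc}$ is nonsingular and the bracketed scalar is nonzero. Solutions: $\bm{x}(t)=[x_i(t)]\in\mathbb{R}^n$ is continuous on $[0,\infty)$ with arbitrary initial value $\bm{x}(0)$, satisfies the equation for almost every $t\ge0$, with $x_i(t)=0$ for $t<0$ (so that its Laplace transform $\bm{X}(s)$ satisfies $sX_i(s)-x_i(0)=\sum_j a_{ij}e^{-\tau_{ij}s}(X_j(s)-X_i(s))$). The system reaches an average consensus if, for every $\bm{x}(0)$, $\lim_{t\to\infty}\bm{x}(t)=c\bm{1}_n$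 with $c=\frac1n\bm{1}_n^T\bm{x}(0)$, where $\bm{1}_n$ is the all-ones vector. *)

(* Defs.v *)
From mathcomp Require Import all_boot all_order all_algebra.
From mathcomp Require Import all_classical all_reals all_analysis.
Set Implicit Arguments.
Unset Strict Implicit.
Unset Printing Implicit Defensive.
Import Order.TTheory GRing.Theory Num.Theory numFieldNormedType.Exports.
Local Open Scope classical_set_scope.
Local Open Scope ring_scope.

Record delay_graph (R : realType) (n : nat) := DelayGraph {
  edge : rel 'I_n;
  adj : 'M[R]_n;
  delay : 'M[R]_n;
  edge_irr : irreflexive edge;
  edge_sym : symmetric edge;
  edge_connected : forall i j, connect edge i j;
  adj_sym : forall i j, adj i j = adj j i;
  adj_edge : forall i j, (adj i j != 0) = edge i j;
  delay_sym : forall i j, delay i j = delay j i;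
  delay_ge0 : forall i j, 0 <= delay i j;
  delay_nonedge : forall i j, ~~ edge i j -> delay i j = 0 }.

Definition laplacian (R : realType) (n : nat) (w : 'M[R]_n) : 'M[R]_n :=
  \matrix_(i, j) if i == j then \sum_(k | k != i) w i k else - w i j.

Definition possemidef (R : realType) (n : nat) (L : 'M[R]_n) : Prop :=
  forall v : 'cV[R]_n, 0 <= (v^T *m L *m v) ord0 ord0.

(* Algebraic multiplicity one. *)
Definition simple_zero_eigenvalue (R : realType) (n : nat) (L : 'M[R]_n) : Prop :=
  mup 0 (char_poly L) = 1%N.

(* Largest real eigenvalue: the set is finite, and it is non-empty when L is
   symmetric and n > 0, so the supremum is then a maximum. *)
Definition lambda_max (R : realType) (n : nat) (L : 'M[R]_n) : R :=
  sup [set l : R | eigenvalue L l].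

Definition L0 (R : realType) (n : nat) (G : delay_graph R n) : 'M[R]_n :=
  laplacian (adj G).

Definition L0abs (R : realType) (n : nat) (G : delay_graph R n) : 'M[R]_n :=
  laplacian (\matrix_(i, j) `|adj G i j|).

Definition lambda_bar (R : realType) (n : nat) (G : delay_graph R n) : R :=
  lambda_max (L0abs G).

Definition delay_weight (R : realType) (lam a tau : R) : R :=
  if 0 < a then
    if tau == 0 then a
    else if tau * lam < pi / 2 then a * expR (- (tau * lam)) * cos (tau * lam)
    else if tau * lam < pi then a * cos (tau * lam)
    else - a
  else a.

Definition Lhat (R : realType) (n : nat) (G : delay_graph R n) : 'M[R]_n :=
  laplacian (\matrix_(i, j)
    if edge G i j then delay_weight (lambda_bar G) (adj G i j) (delay G i j)
    else 0).

Definition block (R : realType) (n : nat) (L : 'M[R]_n) (U V : {set 'I_n}) :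
    'M[R]_(#|U|, #|V|) :=
  \matrix_(i, j) L (enum_val i) (enum_val j).

Definition rest (n : nat) (Va Vb : {set 'I_n}) : {set 'I_n} := ~: (Va :|: Vb).

(* When rest Va Vb is empty, the Lcc block has size 0, hence is invertible, and
   the subtracted product vanishes. *)
Definition schur (R : realType) (n : nat) (L : 'M[R]_n) (Va Vb : {set 'I_n}) :
    'M[R]_(#|Va| + #|Vb|) :=
  let Vc := rest Va Vb in
  block_mx (block L Va Va) (block L Va Vb) (block L Va Vb)^T (block L Vb Vb)
  - col_mx (block L Va Vc) (block L Vb Vc) *m invmx (block L Vc Vc)
    *m row_mx (block L Va Vc)^T (block L Vb Vc)^T.

Definition indic_vec (R : realType) (n : nat) (Va Vb : {set 'I_n}) :
    'cV[R]_(#|Va| + #|Vb|) :=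
  col_mx (const_mx 1) 0.

Definition reff_bracket (R : realType) (n : nat) (L : 'M[R]_n)
    (Va Vb : {set 'I_n}) : R :=
  ((indic_vec R Va Vb)^T *m schur L Va Vb *m indic_vec R Va Vb) ord0 ord0.

(* invmx and the field inverse are total; reff is meaningful under this
   condition only. *)
Definition reff_defined (R : realType) (n : nat) (L : 'M[R]_n)
    (Va Vb : {set 'I_n}) : Prop :=
  block L (rest Va Vb) (rest Va Vb) \in unitmx /\ reff_bracket L Va Vb != 0.

Definition reff (R : realType) (n : nat) (L : 'M[R]_n) (Va Vb : {set 'I_n}) : R :=
  (reff_bracket L Va Vb)^-1.

(* The epsilon-delta definition on [a, b], over finite families of
   non-overlapping subintervals [p.1, p.2]. *)
Definition abs_continuous (R : realType) (a b : R) (f : R -> R) : Prop :=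
  forall e : R, 0 < e -> exists2 d : R, 0 < d &
    forall s : seq (R * R),
      all (fun p => (a <= p.1) && (p.1 <= p.2) && (p.2 <= b)) s ->
      pairwise (fun p q => (p.2 <= q.1) || (q.2 <= p.1)) s ->
      \sum_(p <- s) (p.2 - p.1) < d ->
      \sum_(p <- s) `|f p.2 - f p.1| < e.

(* Solutions are in the Caratheodory sense.  Local absolute continuity cannot be
   dropped: for functions that are merely continuous, the equation almost
   everywhere does not determine the increments (a Cantor function has zero
   derivative almost everywhere), nor the Laplace transform. *)
Record is_solution (R : realType) (n : nat) (G : delay_graph R n)
    (x0 : 'cV[R]_n) (x : R -> 'cV[R]_n) : Prop := IsSolution {
  sol_init : x 0 = x0;
  sol_past : forall t, t < 0 -> x t = 0;
  sol_cont : {within `[0, +oo[, continuous x};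
  sol_ac : forall i (T : R), 0 <= T ->
    abs_continuous 0 T (fun t => x t i ord0);
  sol_ode : {ae @lebesgue_measure R, forall t : R, 0 <= t -> forall i,
    is_derive t (1 : R) (fun u => x u i ord0)
      (\sum_j adj G i j *
         (x (t - delay G i j) j ord0 - x (t - delay G i j) i ord0))} }.

Definition average_consensus (R : realType) (n : nat) (G : delay_graph R n) :
    Prop :=
  forall (x0 : 'cV[R]_n) (x : R -> 'cV[R]_n), is_solution G x0 x ->
    x t @[t --> +oo] --> (const_mx (n%:R^-1 * \sum_i x0 i ord0) : 'cV[R]_n).

(* Main.v *)
(* Pair [(s + i w) Z_i + sum_j a_ij exp (- (s + i w) tau_ij) (Z_i - Z_j) = F_i], s >= 0, with the
   conjugate of [Z].  If [s] or [|w|] exceeds [lambda_bar], the modulus of the sum is too small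
   to cancel the first term; otherwise the real part dominates the quadratic form of [Lhat].
   Positivity of all extended effective resistances makes that form positive definite on the
   vectors of sum zero (Schur complements, one node at a time).  Hence [|Z| <= C |F|], with one
   constant for the whole closed right half-plane.

   Parseval's identity turns this into an energy estimate for the deviation from the average,
   weighted by [exp (- s t)] and cut off at time [T]; the cutoff only costs the energy of a window
   of fixed length around [T].  So for every [s >= 0] the weighted energy on [0, T] is either
   bounded, or grows exponentially at a rate independent of [s].  It is bounded for large [s]
   because solutions grow at most exponentially, and the dichotomy allows [s] to be lowered by
   fixed steps down to 0.  The deviation and its derivative are thus square integrable, and the
   deviation tends to 0.  No root of the characteristic equation and no inversion of the Laplace
   transform is involved. *)

Require Import Defs.
From mathcomp Require Import all_boot all_order all_algebra.
From mathcomp Require Import all_classical all_reals all_analysis.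
From mathcomp Require Import ring lra.
Import Order.TTheory GRing.Theory Num.Theory numFieldNormedType.Exports.
Local Open Scope ring_scope.

Set Implicit Arguments.
Unset Strict Implicit.
Unset Printing Implicit Defensive.

(** * Integrals of continuous functions through antiderivatives *)

(** Three obstacles shape the proof. The first is uniformity: just outside the box
    [0 <= s <= lambda_bar], [|w| <= lambda_bar] the gain [s - lambda_bar] or [|w| - lambda_bar] can
    be arbitrarily small. The box is therefore enlarged by a small [d]: inside, the real parts of
    the delayed weights stay close enough to the weights of [Lhat] to keep half of the coercivity;
    outside, the gain is at least [d]. The weights of [Lhat] are the minima of
    [a_ij exp (- s tau_ij) cos (w tau_ij)] over the box, whence the thresholds [pi / 2] and [pi].
    The second is Parseval's identity. Signals of bounded support are placed in a period so long
    that delays act as exact shifts, and Fejer means of the squared Fourier coefficients give the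
    two inequalities required, up to an error that disappears as the number of harmonics grows. The
    third is regularity: the equation holds almost everywhere only, and [x] may jump at time 0.
    Absolute continuity makes [x] a classical solution once all delays have elapsed; a smooth
    switch-on after that time replaces the past by a forcing of bounded support. *)

Section ContinuousOps.
Local Open Scope classical_set_scope.
Local Open Scope ring_scope.
Context {R : realType} {T : topologicalType}.
Implicit Types (f g : T -> R) (c : R).

Lemma continuous_mulf f g : continuous f -> continuous g ->
  continuous (fun t => f t * g t).
Proof. by move=> cf cg x; apply: continuousM; [exact: cf|exact: cg]. Qed.

Lemma continuous_addf f g : continuous f -> continuous g ->
  continuous (fun t => f t + g t).
Proof. by move=> cf cg x; apply: continuousD; [exact: cf|exact: cg]. Qed.

Lemma continuous_subf f g : continuous f -> continuous g ->
  continuous (fun t => f t - g t).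
Proof. by move=> cf cg x; apply: continuousB; [exact: cf|exact: cg]. Qed.

Lemma continuous_constf c : continuous (fun _ : T => c).
Proof. by move=> x; exact: cvg_cst. Qed.

Lemma continuous_sumf I (r : seq I) (P : pred I) (f : I -> T -> R) :
  (forall i, continuous (f i)) -> continuous (fun t => \sum_(i <- r | P i) f i t).
Proof.
move=> cf; elim: r => [|i r IH].
  by under eq_fun do rewrite big_nil; exact: continuous_constf.
under eq_fun do rewrite big_cons; case: (P i) => //.
exact: continuous_addf.
Qed.

Lemma continuous_sqrf f : continuous f -> continuous (fun t => f t ^+ 2).
Proof.
by move=> cf; under eq_fun do rewrite expr2; exact: continuous_mulf.
Qed.

End ContinuousOps.

Section Calculus.
Local Open Scope classical_set_scope.
Local Open Scope ring_scope.
Context {R : realType}.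
Implicit Types (f g F G : R -> R) (a b c x t : R).

Lemma is_derive_addf f g x a b : is_derive x 1 f a -> is_derive x 1 g b ->
  is_derive x 1 (fun t => f t + g t) (a + b).
Proof. exact: is_deriveD. Qed.

Lemma is_derive_oppf f x a : is_derive x 1 f a ->
  is_derive x 1 (fun t => - f t) (- a).
Proof. exact: is_deriveN. Qed.

Lemma is_derive_subf f g x a b : is_derive x 1 f a -> is_derive x 1 g b ->
  is_derive x 1 (fun t => f t - g t) (a - b).
Proof. exact: is_deriveB. Qed.

Lemma is_derive_mulf f g x a b : is_derive x 1 f a -> is_derive x 1 g b ->
  is_derive x 1 (fun t => f t * g t) (f x * b + g x * a).
Proof. exact: is_deriveM. Qed.

Lemma is_derive_scalef f c x a : is_derive x 1 f a ->
  is_derive x 1 (fun t => c * f t) (c * a).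
Proof. exact: is_deriveZ. Qed.

Lemma is_derive_constf c x : is_derive x 1 (fun _ : R => c) 0.
Proof. exact: is_derive_cst. Qed.

Lemma is_derive_idf x : is_derive x 1 (fun t : R => t) 1.
Proof. exact: is_derive_id. Qed.

Lemma is_derive_compf f g x a b : is_derive (g x) 1 f a -> is_derive x 1 g b ->
  is_derive x 1 (fun t => f (g t)) (a * b).
Proof. exact: is_derive1_comp. Qed.

Lemma is_derive_arg_scale f c x a : is_derive (c * x) 1 f a ->
  is_derive x 1 (fun t => f (c * t)) (c * a).
Proof.
move=> df; rewrite [c * a]mulrC; apply: (@is_derive_compf f (fun t => c * t)) => //.
by rewrite -[X in is_derive _ _ _ X]mulr1; apply: is_derive_scalef.
Qed.

Lemma is_derive_arg_shift f c x a : is_derive (x - c) 1 f a ->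
  is_derive x 1 (fun t => f (t - c)) a.
Proof.
move=> df; rewrite -[a]mulr1; apply: (@is_derive_compf f (fun t => t - c)) => //.
rewrite -[X in is_derive _ _ _ X]subr0.
by apply: is_derive_subf.
Qed.

Lemma is_derive_arg_reflect f c x a : is_derive (c - x) 1 f a ->
  is_derive x 1 (fun t => f (c - t)) (- a).
Proof.
move=> df; rewrite -mulrN1; apply: (@is_derive_compf f (fun t => c - t)) => //.
rewrite -[X in is_derive _ _ _ X]add0r.
by apply: is_derive_subf.
Qed.

Lemma is_derive_sumf n (f : 'I_n -> R -> R) (d : 'I_n -> R) x :
  (forall i, is_derive x 1 (f i) (d i)) ->
  is_derive x 1 (fun t => \sum_i f i t) (\sum_i d i).
Proof.
move=> h; have := @is_derive_sum _ _ _ n f x 1 d h.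
by congr is_derive; apply/funext => t; rewrite fct_sumE.
Qed.

Lemma is_derive_cont f x a : is_derive x 1 f a -> {for x, continuous f}.
Proof.
by move=> df; apply/differentiable_continuous/derivable1_diffP/ex_derive.
Qed.

Lemma mono_of_derive f (df : R -> R) a b : a <= b ->
  (forall x, a <= x <= b -> is_derive x 1 f (df x)) ->
  (forall x, a <= x <= b -> 0 <= df x) -> f a <= f b.
Proof.
move=> ab d p.
have [||c] := @MVT_segment R f df a b ab.
- by move=> x xab; apply: d; rewrite !ltW ?(itvP xab).
- apply: continuous_in_subspaceT => x; rewrite inE /= in_itv /= => xab.
  exact: is_derive_cont (d x xab).
rewrite in_itv /= => cab E.
by rewrite -subr_ge0 E mulr_ge0 ?subr_ge0 ?p.
Qed.

Lemma const_of_derive f a b : a <= b ->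
  (forall x, a <= x <= b -> is_derive x 1 f 0) -> f b = f a.
Proof.
move=> ab d; apply/eqP; rewrite eq_le; apply/andP; split; last first.
  by apply: (mono_of_derive ab d).
rewrite -lerN2; apply: (@mono_of_derive (fun t => - f t) (fun=> 0)) => // x xab.
by rewrite -[0]oppr0; apply: is_derive_oppf; apply: d.
Qed.

Lemma eq_of_derive f g (d : R -> R) a b : a <= b ->
  (forall x, a <= x <= b -> is_derive x 1 f (d x)) ->
  (forall x, a <= x <= b -> is_derive x 1 g (d x)) -> f b - f a = g b - g a.
Proof.
move=> ab df dg.
have := @const_of_derive (fun t => f t - g t) a b ab => /(_ _) E.
suff: f b - g b = f a - g a by lra.
by apply: E => x xab; rewrite -(subrr (d x)); apply: is_derive_subf; auto.
Qed.

Let mu := @lebesgue_measure R.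

Let local_prim f A x : R :=
  \int[mu]_(t in `[- A, x]) f t - \int[mu]_(t in `[- A, 0]) f t.

Let local_prim_derive f A x : continuous f -> - A < x -> is_derive x 1 (local_prim f A) (f x).
Proof.
move=> cf Ax.
have fi : mu.-integrable `[- A, x + 1] (EFin \o f).
  apply: continuous_compact_integrable; first exact: segment_compact.
  exact: continuous_subspaceT.
have xx1 : x < x + 1 by lra.
have [d1 d2] := continuous_FTC1_closed xx1 fi Ax (cf x).
pose F (y : R) : R := \int[mu]_(t in `[- A, y]) f t.
have dF : is_derive x 1 F (f x).
  by split; [exact: d1|rewrite -derive1E; exact: d2].
rewrite -[f x]subr0; exact: (is_derive_subf dF (is_derive_constf _ _)).
Qed.

(* The lower bound depends on [x] so that the antiderivative exists on the whole line;
   subtracting the value at 0 makes the pieces agree. *)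
Let glued_prim f x : R := local_prim f (`|x| + 1) x.

Let glued_prim_derive f x : continuous f -> is_derive x 1 (glued_prim f) (f x).
Proof.
move=> cf; have Ax : - (`|x| + 1) < x.
  by have := ler_norm (- x); rewrite normrN; lra.
apply: (@near_eq_is_derive R R R (local_prim f (`|x| + 1))); last exact: local_prim_derive.
near=> y; have yx : `|y| < `|x| + 1.
  near: y; have : continuous (fun y : R => `|y|) by exact: norm_continuous.
  move=> /(_ x) /(_ [set u | u < `|x| + 1]); apply.
  by apply: lt_nbhsl => /=; lra.
have pos A : local_prim f A 0 = 0 by rewrite /local_prim subrr.
rewrite /glued_prim; move: (`|x| + 1) (`|y| + 1) yx (ltrDl `|y| 1) => A B yA.
rewrite ltr01 => yB.
have E C z : `|y| < C -> - `|y| <= z -> is_derive z 1 (local_prim f C) (f z).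
  by move=> yC yz; apply: local_prim_derive => //; lra.
have y1 : - `|y| <= y by rewrite lerNl; have := ler_norm (- y); rewrite normrN.
have y0 : - `|y| <= 0 by rewrite oppr_le0.
have [yn|yp] := leP y 0.
  have := @eq_of_derive (local_prim f A) (local_prim f B) f y 0 yn.
  rewrite !pos // !sub0r => h; apply: oppr_inj; apply: h => z /andP[z1 _];
    by apply: E => //; exact: le_trans z1.
have := @eq_of_derive (local_prim f A) (local_prim f B) f 0 y (ltW yp).
rewrite !pos // !subr0 => h; apply: h => z /andP[z1 _];
  by apply: E => //; exact: le_trans z1.
Unshelve. all: by end_near. Qed.

Fact antideriv_subproof f :
  {F : R -> R | continuous f -> forall x, is_derive x 1 F (f x)}.
Proof. by exists (glued_prim f) => cf x; exact: glued_prim_derive. Qed.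

Definition antideriv f : R -> R := sval (antideriv_subproof f).

Lemma antideriv_derive f x : continuous f -> is_derive x 1 (antideriv f) (f x).
Proof. by move=> cf; exact: svalP (antideriv_subproof f) cf x. Qed.

(** A difference of values of one global antiderivative: additivity over intervals holds by
    cancellation, whatever the function and the order of the limits. *)
Definition cintegral f a b : R := antideriv f b - antideriv f a.

Lemma cintegralE f F a b : continuous f -> a <= b ->
  (forall x, a <= x <= b -> is_derive x 1 F (f x)) -> cintegral f a b = F b - F a.
Proof.
by move=> cf ab dF; apply: (@eq_of_derive _ _ f) => // x _; exact: antideriv_derive.
Qed.

Lemma cintegral_derive f a x : continuous f -> is_derive x 1 (cintegral f a) (f x).
Proof.
move=> cf; rewrite -[f x]subr0; by apply: is_derive_subf; exact: antideriv_derive.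
Qed.

Lemma cintegral_cat f a b c : cintegral f a b + cintegral f b c = cintegral f a c.
Proof. by rewrite /cintegral; lra. Qed.

Lemma cintegral_xx f a : cintegral f a a = 0. Proof. by rewrite /cintegral subrr. Qed.

Lemma eq_cintegral f g a b : continuous f -> continuous g -> a <= b ->
  (forall x, a <= x <= b -> f x = g x) -> cintegral f a b = cintegral g a b.
Proof.
move=> cf cg ab fg; apply: cintegralE => // x xab; rewrite fg //; exact: antideriv_derive.
Qed.

Lemma le_cintegral f g a b : continuous f -> continuous g -> a <= b ->
  (forall x, a <= x <= b -> f x <= g x) -> cintegral f a b <= cintegral g a b.
Proof.
move=> cf cg ab fg.
have := @mono_of_derive (fun t => antideriv g t - antideriv f t) (fun t => g t - f t) a b ab.
rewrite /cintegral => h; suff : antideriv g a - antideriv f a <= antideriv g b - antideriv f b by lra.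
by apply: h => x xab; [apply: is_derive_subf; exact: antideriv_derive
  | rewrite subr_ge0 fg].
Qed.

Lemma continuous_compf f g : continuous f -> continuous g ->
  continuous (fun t => f (g t)).
Proof. by move=> cf cg x; apply: continuous_comp; [exact: cg|exact: cf]. Qed.

Lemma continuous_arg_shift f c : continuous f -> continuous (fun t => f (t - c)).
Proof.
move=> cf; apply: (@continuous_compf f (fun t => t - c)) => //.
by apply: continuous_subf; [move=> x; exact: cvg_id|exact: continuous_constf].
Qed.

Lemma continuous_arg_scale f c : continuous f -> continuous (fun t => f (c * t)).
Proof.
move=> cf; apply: (@continuous_compf f (fun t => c * t)) => //.
by apply: continuous_mulf; [exact: continuous_constf|move=> x; exact: cvg_id].
Qed.

Lemma continuous_arg_reflect f c : continuous f -> continuous (fun t => f (c - t)).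
Proof.
move=> cf; apply: (@continuous_compf f (fun t => c - t)) => //.
by apply: continuous_subf; [exact: continuous_constf|move=> x; exact: cvg_id].
Qed.

Lemma cintegralD f g a b : continuous f -> continuous g -> a <= b ->
  cintegral (fun t => f t + g t) a b = cintegral f a b + cintegral g a b.
Proof.
move=> cf cg ab; apply: (etrans (@cintegralE _ (fun t => antideriv f t + antideriv g t) _ _ _ ab _)).
- exact: continuous_addf.
- by move=> x _; apply: is_derive_addf; exact: antideriv_derive.
- by rewrite /cintegral; lra.
Qed.

Lemma cintegralZ c f a b : continuous f -> a <= b ->
  cintegral (fun t => c * f t) a b = c * cintegral f a b.
Proof.
move=> cf ab; apply: (etrans (@cintegralE _ (fun t => c * antideriv f t) _ _ _ ab _)).
- by apply: continuous_mulf => //; exact: continuous_constf.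
- by move=> x _; apply: is_derive_scalef; exact: antideriv_derive.
- by rewrite /cintegral; lra.
Qed.

Lemma cintegralB f g a b : continuous f -> continuous g -> a <= b ->
  cintegral (fun t => f t - g t) a b = cintegral f a b - cintegral g a b.
Proof.
move=> cf cg ab; apply: (etrans (@cintegralE _ (fun t => antideriv f t - antideriv g t) _ _ _ ab _)).
- exact: continuous_subf.
- by move=> x _; apply: is_derive_subf; exact: antideriv_derive.
- by rewrite /cintegral; lra.
Qed.

Lemma cintegral_const c a b : a <= b -> cintegral (fun=> c) a b = c * (b - a).
Proof.
move=> ab; apply: (etrans (@cintegralE _ (fun t => c * t) _ _ _ ab _)); last lra.
- exact: continuous_constf.
- move=> x _; rewrite -[X in is_derive _ _ _ X]mulr1.
  by apply: is_derive_scalef.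
Qed.

Lemma cintegral_sum I (r : seq I) (P : pred I) (f : I -> R -> R) a b :
  (forall i, continuous (f i)) -> a <= b ->
  cintegral (fun t => \sum_(i <- r | P i) f i t) a b = \sum_(i <- r | P i) cintegral (f i) a b.
Proof.
move=> cf ab; elim: r => [|i r IH].
  rewrite big_nil; under [X in cintegral X]eq_fun do rewrite big_nil.
  by rewrite cintegral_const // mul0r.
rewrite big_cons; under [X in cintegral X]eq_fun do rewrite big_cons.
case: (P i) => //; rewrite cintegralD // ?IH //; exact: continuous_sumf.
Qed.

Lemma cintegral_ge0 f a b : continuous f -> a <= b -> (forall x, a <= x <= b -> 0 <= f x) ->
  0 <= cintegral f a b.
Proof.
move=> cf ab f0; rewrite -(@mul0r R (b - a)) -cintegral_const //; apply: le_cintegral => //.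
exact: continuous_constf.
Qed.

Lemma cintegral_eq0 f a b : continuous f -> a <= b -> (forall x, a <= x <= b -> f x = 0) ->
  cintegral f a b = 0.
Proof.
move=> cf ab f0; rewrite -(@mul0r R (b - a)) -cintegral_const //; apply: eq_cintegral => //.
exact: continuous_constf.
Qed.

Lemma cintegral_arg_shift f c a b : continuous f -> a <= b ->
  cintegral (fun t => f (t - c)) a b = cintegral f (a - c) (b - c).
Proof.
move=> cf ab; apply: (etrans (@cintegralE _ (fun t => antideriv f (t - c)) _ _ _ ab _)).
- exact: continuous_arg_shift.
- by move=> x _; apply: is_derive_arg_shift; exact: antideriv_derive.
- by [].
Qed.

Lemma cintegral_itv_le f a b c d : continuous f -> (forall x, 0 <= f x) ->
  c <= a -> a <= b -> b <= d -> cintegral f a b <= cintegral f c d.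
Proof.
move=> cf f0 ca ab bd.
rewrite -(cintegral_cat f c a d) -(cintegral_cat f a b d).
have := @cintegral_ge0 f c a cf ca (fun x _ => f0 x).
have := @cintegral_ge0 f b d cf bd (fun x _ => f0 x); lra.
Qed.

Lemma cintegral_parts f g (df dg : R -> R) a b : a <= b -> continuous df -> continuous dg ->
  (forall x, is_derive x 1 f (df x)) -> (forall x, is_derive x 1 g (dg x)) ->
  f a = 0 -> f b = 0 ->
  cintegral (fun t => df t * g t) a b = - cintegral (fun t => f t * dg t) a b.
Proof.
move=> ab cdf cdg hf hg fa fb.
have cf : continuous f by move=> x; apply: is_derive_cont.
have cg : continuous g by move=> x; apply: is_derive_cont.
have c1 := continuous_mulf cdf cg; have c2 := continuous_mulf cf cdg.
apply/eqP; rewrite -addr_eq0; apply/eqP; rewrite -cintegralD //.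
apply: (etrans (@cintegralE _ (fun t => f t * g t) _ _ _ ab _)); last by rewrite fa fb !mul0r subrr.
- exact: continuous_addf.
- by move=> x _; rewrite addrC [df x * g x]mulrC; apply: is_derive_mulf.
Qed.

End Calculus.

(** * Absolute continuity *)

Section AC.
Local Open Scope classical_set_scope.
Local Open Scope ring_scope.
Context {R : realType}.
Implicit Types (f : R -> R) (a b t : R).
Notation mu := (@lebesgue_measure R).

(* [G u v] stands for: [u, v] has a tagged partition subordinate to the gauge [d]. *)
Lemma cousin (G : R -> R -> Prop) a b : a <= b ->
  (forall u v w, a <= u <= v -> v <= w <= b -> G u v -> G v w -> G u w) ->
  (forall t, a <= t <= b -> exists2 d, 0 < d & forall u v,
     a <= u -> t - d < u -> u <= t <= v -> v < t + d -> v <= b -> G u v) ->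
  G a b.
Proof.
move=> ab tr loc.
pose S := [set x | a <= x <= b /\ G a x].
have Sa : S a.
  split; first by rewrite lexx.
  by have [d d0] := loc a (introT andP (conj (lexx a) ab)); apply; rewrite ?lexx //; lra.
have ubS : ubound S b by move=> x [/andP[]].
have supS : has_sup S by split; [exists a|exists b].
have leS x : S x -> x <= sup S by move=> Sx; apply: ub_le_sup => //; exists b.
have ac : a <= sup S by move: (leS a Sa).
have cb : sup S <= b by apply: ge_sup => //; exists a.
have [d d0 Gd] := loc (sup S) (introT andP (conj ac cb)).
have [x [/andP[ax xb] Gx] xd] := sup_adherent d0 supS.
have Sx : S x by split => //; rewrite ax.
have xc : x <= sup S := leS x Sx.
(* A cell tagged at [sup S] reaches from some [x] in [S] to [y], so [y] is in [S] and cannot exceed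
   [sup S]; this forces [y = b]. *)
pose y := Num.min b (sup S + d / 2).
have cy : sup S <= y by rewrite le_min cb; lra.
have yb : y <= b by rewrite ge_min lexx.
have yd : y < sup S + d by rewrite gt_min; apply/orP; right; lra.
have Gy : G a y.
  apply: (tr _ x) => //; [by rewrite lexx|by rewrite (le_trans xc)|].
  by apply: Gd => //; rewrite xc.
have Sy : S y by split => //; rewrite yb (le_trans ac).
have := leS y Sy; rewrite ge_min => /orP[h|]; last by lra.
suff <- : y = b by [].
by apply/eqP; rewrite eq_le yb /= (le_trans h).
Qed.

(** Cells may share endpoints, so the open intervals are measured: they are pairwise disjoint and
    have the same lengths. *)
Lemma sum_length_le_measure (s : seq (R * R)) (U : set R) :
  measurable U ->
  all (fun p => p.1 <= p.2) s ->
  pairwise (fun p q => (p.2 <= q.1) || (q.2 <= p.1)) s ->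
  (forall p, p \in s -> `]p.1, p.2[ `<=` U) ->
  ((\sum_(p <- s) (p.2 - p.1))%:E <= mu U)%E.
Proof.
move=> mU s1 s2 sU.
pose V s := \big[setU/set0]_(p <- s) `]p.1, p.2[%classic : set R.
have mV s' : measurable (V s') by apply: bigsetU_measurable => p _; exact: measurable_itv.
apply: (@le_trans _ _ (mu (V s))); last first.
  apply: le_measure; [by apply/mem_set; exact: mV|exact/mem_set|].
  rewrite /V; elim: s {s1 s2} sU => [|p s IH] sU; first by rewrite big_nil.
  rewrite big_cons; rewrite subUset; split; first by apply: sU; rewrite mem_head.
  by apply: IH => q qs; apply: sU; rewrite in_cons qs orbT.
move: s1 s2; clear sU; elim: s => [|p s IH] /=.
  by rewrite /V !big_nil measure0.
move=> /andP[p12 s1] /andP[ps s2]; rewrite /V !big_cons measureU.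
- rewrite EFinD; apply: leeD; last exact: IH.
  rewrite [X in (_ <= X)%E]lebesgue_measure_itv /= lte_fin.
  by have [|] := ltP p.1 p.2 => // h; rewrite EFinB lee_fin subr_le0.
- exact: measurable_itv.
- exact: mV.
rewrite -bigcup_seq setI_bigcupr; apply: bigcup0 => q /= qs.
have /allP /(_ _ qs) pq := ps.
apply/seteqP; split => // x /=; rewrite !in_itv /= => -[/andP[x1 x2] /andP[x3 x4]].
case/orP: pq => h.
  by have := lt_le_trans x2 (le_trans h (ltW x3)); rewrite ltxx.
by have := lt_le_trans x4 (le_trans h (ltW x1)); rewrite ltxx.
Qed.

(** The exceptional null set is covered by an open set of measure below the [d] of absolute
    continuity. In a partition subordinate to a suitable gauge, cells tagged in the null set lie in
    that open set and together contribute less than [e]; at any other tag the derivative is zero,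
    and the cell contributes at most [e] times its length. *)
Lemma abs_continuous_const f a b : a <= b -> abs_continuous a b f ->
  {ae mu, forall t, a <= t <= b -> is_derive t 1 f 0} -> f b = f a.
Proof.
move=> ab acf [M [mM M0 subM]].
suff key e : 0 < e -> `|f b - f a| <= e * (b - a) + e.
  apply/eqP; rewrite -subr_eq0 -normr_eq0 eq_le normr_ge0 andbT.
  apply/ler_addgt0Pr => e e0; rewrite add0r.
  have p : 0 < b - a + 1 by lra.
  have := key (e / (b - a + 1)) (divr_gt0 e0 p).
  have -> // : e / (b - a + 1) * (b - a) + e / (b - a + 1) = e.
  by field; rewrite gt_eqF.
move=> e0; have [d d0 acd] := acf e e0.
have [|U [oU MU muU]] := @lebesgue_regularity_outer R M d mM _ d0.
  by rewrite [X in (X < _)%E]M0 ltry.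
have mU : measurable U by exact: measurable_realfun.open_measurable.
have muUd : (mu U < d%:E)%E.
  rewrite -(setDUK MU) measureU //; last 2 first.
  - exact: measurableD.
  - by rewrite setDIK.
  by rewrite [X in (X + _)%E]M0 add0e.
(* [s] collects the cells tagged in the exceptional set, the only ones not controlled by their
   length. *)
pose G u v := exists s : seq (R * R), [/\
  all (fun p => (u <= p.1) && (p.1 <= p.2) && (p.2 <= v)) s,
  pairwise (fun p q => (p.2 <= q.1) || (q.2 <= p.1)) s,
  (forall p, p \in s -> `]p.1, p.2[ `<=` U) &
  `|f v - f u| <= e * (v - u) + \sum_(p <- s) `|f p.2 - f p.1| ].
have [] : G a b; last first.
  move=> s [s1 s2 s3 s4]; apply: le_trans s4 _; rewrite lerD2l ltW //; apply: acd => //.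
  rewrite -lte_fin; apply: le_lt_trans muUd; apply: sum_length_le_measure => //.
  by apply: sub_all s1 => p /andP[/andP[]].
apply: cousin => //.
  move=> u v w /andP[au uv] /andP[vw wb] [s [s1 s2 s3 s4]] [r [r1 r2 r3 r4]].
  exists (s ++ r); split.
  - rewrite all_cat; apply/andP; split.
      by apply: sub_all s1 => p /andP[/andP[-> ->]] /= h; exact: le_trans vw.
    by apply: sub_all r1 => p /andP[/andP[h -> ->]]; rewrite (le_trans uv).
  - rewrite pairwise_cat s2 r2 !andbT; apply/allrelP => p q ps qr.
    have /allP /(_ _ ps) /andP[_ h1] := s1.
    by have /allP /(_ _ qr) /andP[/andP[h2 _] _] := r1; rewrite (le_trans h1 h2).
  - by move=> p; rewrite mem_cat => /orP[/s3|/r3].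
  - rewrite big_cat /=; have := ler_normD (f w - f v) (f v - f u).
    have -> : f w - f v + (f v - f u) = f w - f u by lra.
    move=> h; apply: (le_trans h); move: s4 r4; set A := \sum_(_ <- _) _; set B := \sum_(_ <- _) _.
    lra.
move=> t /andP[ta tb]; have [tM|tM] := pselect (M t).
  have /= := open_nbhs_nbhs (conj oU (MU _ tM)).
  move=> /nbhs_ballP[r r0 rU]; exists r => // u v _ u1 /andP[u2 u3] u4 _.
  exists [:: (u, v)]; split => //=.
  - by rewrite !lexx (le_trans u2 u3).
  - move=> p; rewrite inE => /eqP -> x /=; rewrite in_itv /= => /andP[x1 x2].
    by apply: rU => /=; rewrite /ball /= ltr_distl; lra.
  - rewrite big_seq1 /= lerDr mulr_ge0 //; lra.
have dt : is_derive t 1 f 0.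
  apply: contrapT => h; apply: tM; apply: subM => /= h'; apply: h; apply: h'.
  by rewrite ta.
have [df dv] := dt.
have : (fun h => h^-1 *: (f (h *: (1 : R) + t) - f t)) x @[x --> 0^'] --> ('D_1 f t : R).
  exact: df.
rewrite dv => /cvgrPdist_le /(_ e e0) /nbhs_ballP[r r0 rP].
have {}rP v : `|v - t| < r -> `|f v - f t| <= e * `|v - t|.
  move=> vr; have [->|vt] := eqVneq v t; first by rewrite !subrr normr0 mulr0.
  have := rP (v - t); rewrite /ball /= sub0r normrN => /(_ vr).
  have vt0 : v - t != 0 by rewrite subr_eq0.
  move=> /(_ vt0); rewrite sub0r normrN /GRing.scale /= mulr1 subrK normrM normfV mulrC.
  by rewrite ler_pdivrMr // normr_gt0.
exists r => // u v _ u1 /andP[u2 u3] u4 _; exists [::]; split => //.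
rewrite big_nil addr0.
have h1 : `|f t - f u| <= e * (t - u).
  have E : `|u - t| = t - u by rewrite distrC ger0_norm // subr_ge0.
  by rewrite distrC -E; apply: rP; rewrite E; lra.
have h2 : `|f v - f t| <= e * (v - t).
  have E : `|v - t| = v - t by rewrite ger0_norm // subr_ge0.
  by rewrite -E; apply: rP; rewrite E; lra.
have := ler_normD (f v - f t) (f t - f u).
have -> : f v - f t + (f t - f u) = f v - f u by lra.
move: h1 h2; move: `|_| `|_| `|_| => A B C; lra.
Qed.

End AC.

(** * Extended effective resistance and coercivity *)

Section LinAlg.
Context {R : realType} {n : nat}.
Implicit Types (L w : 'M[R]_n) (v x y : 'I_n -> R).

Definition bform L x y : R := \sum_i x i * \sum_j L i j * y j.

(** The Dirichlet form of the weights; the double sum meets each edge twice, hence the half. *)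
Definition energy (w : 'I_n -> 'I_n -> R) v : R :=
  2^-1 * \sum_i \sum_j w i j * (v i - v j) ^+ 2.

Lemma sum_antisym (F : 'I_n -> 'I_n -> R) :
  (forall i j, F i j = - F j i) -> \sum_i \sum_j F i j = 0.
Proof.
move=> H; set S := LHS; suff : S = - S by lra.
rewrite {1}/S exchange_big /= -sumrN; apply: eq_bigr => i _.
by rewrite -sumrN; apply: eq_bigr => j _.
Qed.

(** Summation by parts on a graph: [y i] is half of [(y i - y j) + (y i + y j)], and the second part
    gives an antisymmetric summand. *)
Lemma sum_mul_diff (w : 'I_n -> 'I_n -> R) (x y : 'I_n -> R) :
  (forall i j, w i j = w j i) ->
  \sum_i (\sum_j w i j * (x i - x j)) * y i =
  2^-1 * \sum_i \sum_j w i j * ((x i - x j) * (y i - y j)).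
Proof.
move=> ws; apply/eqP; rewrite -subr_eq0 mulr_sumr -sumrB; apply/eqP.
rewrite -[RHS](@sum_antisym
  (fun i j => 2^-1 * (w i j * ((x i - x j) * (y i + y j))))); last first.
  by move=> i j; rewrite (ws j i); lra.
apply: eq_bigr => i _; rewrite mulr_suml mulr_sumr -sumrB.
by apply: eq_bigr => j _; lra.
Qed.

Lemma laplacian_mul w v i :
  \sum_j laplacian w i j * v j = \sum_j w i j * (v i - v j).
Proof.
rewrite (bigD1 i) //= mxE eqxx [RHS](bigD1 i) //= subrr mulr0 add0r.
rewrite mulr_suml -big_split /=; apply: eq_bigr => j ji.
by rewrite mxE eq_sym (negPf ji); lra.
Qed.

Lemma bform_laplacian w v : (forall i j, w i j = w j i) ->
  bform (laplacian w) v v = energy w v.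
Proof.
move=> ws; rewrite /energy /bform.
under eq_bigr do rewrite laplacian_mul mulrC.
rewrite sum_mul_diff //; congr (_ * _).
Qed.

Lemma bformDl L x x' y : bform L (fun i => x i + x' i) y = bform L x y + bform L x' y.
Proof. by rewrite /bform -big_split; apply: eq_bigr => i _; rewrite mulrDl. Qed.

Lemma bformDr L x y y' : bform L x (fun i => y i + y' i) = bform L x y + bform L x y'.
Proof.
rewrite /bform -big_split; apply: eq_bigr => i _ /=; rewrite -mulrDr -big_split.
by congr (_ * _); apply: eq_bigr => j _; rewrite mulrDr.
Qed.

Lemma bformZl L c x y : bform L (fun i => c * x i) y = c * bform L x y.
Proof. by rewrite /bform mulr_sumr; apply: eq_bigr => i _; rewrite mulrA. Qed.

Lemma bformZr L c x y : bform L x (fun i => c * y i) = c * bform L x y.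
Proof.
rewrite /bform mulr_sumr; apply: eq_bigr => i _; rewrite mulrCA; congr (_ * _).
by rewrite mulr_sumr; apply: eq_bigr => j _; rewrite mulrCA.
Qed.

Lemma bformC L x y : (forall i j, L i j = L j i) -> bform L x y = bform L y x.
Proof.
move=> Ls; rewrite /bform; under eq_bigr do rewrite mulr_sumr.
rewrite exchange_big; apply: eq_bigr => i _ /=; rewrite mulr_sumr.
by apply: eq_bigr => j _; rewrite (Ls j i); lra.
Qed.

(** An explicit constant, rather than mere positivity, is passed from one set of nodes to the next
    and ends up as the coercivity constant. *)
Definition pos_on L (c : {set 'I_n}) : Prop := exists2 m, 0 < m &
  forall v, (forall i, i \notin c -> v i = 0) -> m * \sum_i v i ^+ 2 <= bform L v v.

(* With [g := e_k - m], [L g] vanishes on [c] and the Schur complement of [k] is [g^T L g];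
   every vector supported on [k |: c] is [t g + h] with [h] supported on [c], and [h^T L g = 0]. *)
Lemma pos_on_step L k (c : {set 'I_n}) (m : 'I_n -> R) : (forall i j, L i j = L j i) ->
  k \notin c ->
  (forall i, i \notin c -> m i = 0) ->
  (forall i, i \in c -> \sum_j L i j * m j = L i k) ->
  0 < L k k - \sum_j L k j * m j ->
  pos_on L c -> pos_on L (k |: c).
Proof.
move=> Ls kc mc mL; set b := (X in 0 < X) => b0 [m0 m00 H].
pose S := \sum_i m i ^+ 2.
have S0 : 0 <= S by apply: sumr_ge0 => i _; exact: sqr_ge0.
(* With [v = t g + h] the form is [t^2 b] plus the form of [h], while
   [|v|^2 <= t^2 (1 + 2 S) + 2 |h|^2]; each entry of the minimum pays for one of the two terms. *)
exists (Num.min (b / (1 + 2 * S)) (m0 / 2)).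
  by rewrite lt_min !divr_gt0 //; lra.
move=> v vc; set t := v k.
pose g i : R := (i == k)%:R - m i.
pose h i : R := v i - t * g i.
have hc i : i \notin c -> h i = 0.
  move=> ic; rewrite /h /g (mc _ ic) subr0; have [->|ik] := eqVneq i k.
    by rewrite mulr1 subrr.
  by rewrite mulr0 subr0 vc // !inE negb_or ik.
have Lg i : \sum_j L i j * g j = L i k - \sum_j L i j * m j.
  rewrite -[L i k](_ : \sum_j L i j * (j == k)%:R = _); last first.
    rewrite (bigD1 k) //= eqxx mulr1 big1 ?addr0 // => j jk.
    by rewrite (negPf jk) mulr0.
  by rewrite -sumrB; apply: eq_bigr => j _; rewrite mulrBr.
have hLg : bform L h g = 0.
  rewrite /bform big1 // => i _; rewrite Lg; have [ic|ic] := boolP (i \in c).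
    by rewrite mL // subrr mulr0.
  by rewrite hc // mul0r.
have gLg : bform L g g = b.
  rewrite /bform (bigD1 k) //= [X in _ + X]big1 ?addr0.
    by rewrite Lg /g eqxx (mc _ kc) subr0 mul1r.
  move=> i ik; rewrite Lg; have [ic|ic] := boolP (i \in c).
    by rewrite mL // subrr mulr0.
  by rewrite /g (negPf ik) mc // subrr mul0r.
have vE : v = (fun i => t * g i + h i) by apply/funext => i; rewrite /h; lra.
have vLv : bform L v v = t ^+ 2 * b + bform L h h.
  rewrite vE (bformDl L (fun i => t * g i) h) !(bformDr L _ (fun i => t * g i) h).
  rewrite !(bformZl L t g) !(bformZr L t _ g) gLg (@bformC L g h) // hLg.
  by rewrite !mulr0 addr0 add0r mulrA expr2.
have v2 : \sum_i v i ^+ 2 <= t ^+ 2 * (1 + 2 * S) + 2 * \sum_i h i ^+ 2.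
  rewrite (bigD1 k) //= mulrDr mulr1 -addrA lerD2l.
  rewrite /S mulrA !mulr_sumr -big_split /=.
  rewrite [leRHS](bigD1 k) //= -[leLHS]add0r lerD //.
    by rewrite addr_ge0 // mulr_ge0 ?sqr_ge0 // mulr_ge0 ?sqr_ge0.
  apply: ler_sum => i ik; rewrite vE /g (negPf ik).
  have := sqr_ge0 (t * m i + h i); rewrite /=; nra.
rewrite vLv; set mm := Num.min _ _.
have mm1 : mm * (1 + 2 * S) <= b.
  by rewrite -ler_pdivlMr ?ge_min ?lexx //; lra.
have mm2 : mm * 2 <= m0 by rewrite -ler_pdivlMr ?ge_min ?lexx ?orbT.
have mm0 : 0 <= mm by rewrite le_min !divr_ge0 //; lra.
have := H h hc.
have h0 : 0 <= \sum_i h i ^+ 2 by apply: sumr_ge0 => i _; exact: sqr_ge0.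
move: h0 v2; set A := \sum_i h i ^+ 2; set B := \sum_i _ => A0 v2 HH.
apply: le_trans (ler_wpM2l mm0 v2) _.
rewrite mulrDr; apply: lerD.
  by rewrite mulrCA ler_wpM2l // sqr_ge0.
by apply: le_trans HH; rewrite mulrA ler_wpM2r.
Qed.

(** For a single node [k] the bracket is the scalar [L_kk - L_kc L_cc^-1 L_ck]; [m] is
    [L_cc^-1 L_ck] extended by zero, which moves the block computation back to indices in ['I_n]. *)
Lemma reff_schur L (k : 'I_n) (Vb : {set 'I_n}) : (forall i j, L i j = L j i) ->
  let c := rest [set k] Vb in
  block L c c \in unitmx -> 0 < reff_bracket L [set k] Vb ->
  exists m : 'I_n -> R, [/\ (forall i, i \notin c -> m i = 0),
   (forall i, i \in c -> \sum_j L i j * m j = L i k) &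
   0 < L k k - \sum_j L k j * m j].
Proof.
move=> Ls c Mu; rewrite /reff_bracket /schur /indic_vec -/c.
set M := block L c c in Mu *; set Bac := block L _ c; set Bbc := block L Vb c.
set u : 'cV[R]_(#|[set k]|) := const_mx 1.
rewrite tr_col_mx trmx0 mulmxBr mulmxBl.
rewrite mul_row_block !mul0mx !addr0 mul_row_col mulmx0 addr0.
rewrite !mulmxA mul_row_col mul0mx addr0 -!mulmxA mul_row_col mulmx0 addr0.
have uk (i : 'I_#|[set k]|) : enum_val i = k.
  by have := enum_valP i; rewrite inE => /eqP.
pose l : 'cV[R]_#|c| := \col_i L (enum_val i) k.
have sumk (F : 'I_#|[set k]| -> R) i0 : \sum_i F i = F i0.
  rewrite (bigD1 i0) //= big1 ?addr0 // => i ii0.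
  by case/eqP: ii0; apply: enum_val_inj; rewrite !uk.
pose i0 : 'I_#|[set k]| := enum_rank_in (set11 k) k.
have lE : Bac^T *m u = l.
  apply/matrixP => i j; rewrite !mxE (sumk _ i0) !mxE mulr1 uk; exact: Ls.
have lE' : u^T *m Bac = l^T by rewrite -lE trmx_mul trmxK.
rewrite lE !mulmxA lE' => b0.
pose z := invmx M *m l.
(* For [i] in [c] the sum has exactly one term; inverting [enum_val] directly would ask for a
   witness that [c] is non-empty. *)
pose m (i : 'I_n) : R := if insub i : {? i | i \in c} is Some _ then
   \sum_(j | enum_val j == i) z j ord0 else 0.
have mE j : m (enum_val j) = z j ord0.
  rewrite /m; case: insubP => [s _ sE|]; last by rewrite enum_valP.
  rewrite (bigD1 j) //= big1 ?addr0 // => i /andP[/eqP /enum_val_inj ->].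
  by rewrite eqxx.
have mc i : i \notin c -> m i = 0.
  by move=> ic; rewrite /m; case: insubP => // s; rewrite (negPf ic).
have sumE (F : 'I_n -> R) : \sum_j F j * m j = \sum_j F (enum_val j) * z j ord0.
  rewrite (bigID (mem c)) /= [X in _ + X]big1 ?addr0; last first.
    by move=> i /mc ->; rewrite mulr0.
  rewrite big_enum_val /=; apply: eq_bigr => i _; by rewrite mE.
exists m; split => //.
- move=> i ic; rewrite sumE.
  have : (M *m z) (enum_rank_in ic i) ord0 = l (enum_rank_in ic i) ord0.
    by rewrite /z mulmxA mulmxV // mul1mx.
  rewrite !mxE enum_rankK_in // => <-; apply: eq_bigr => j _.
  by rewrite !mxE enum_rankK_in.
- move: b0; set e := (X in 0 < X -> _).
  suff -> : e = L k k - \sum_j L k j * m j by [].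
  rewrite /e mxE sumE; congr (_ + _).
    by rewrite !mxE (sumk _ i0) !mxE (sumk _ i0) !mxE mul1r mulr1 !uk.
  rewrite mxE -mulmxA -/z !mxE; congr (- _); apply: eq_bigr => j _.
  by rewrite !mxE Ls.
Qed.

(* Nodes are added one at a time: [c] grows by [k] by using [Va = {k}] and [Vb] the
   complement of [k |: c], for which [Vc = c]. *)
Lemma pos_on_proper L : (forall i j, L i j = L j i) ->
  (forall Va Vb : {set 'I_n},
    Va != finset.set0 -> Vb != finset.set0 -> [disjoint Va & Vb] ->
    reff_defined L Va Vb /\ 0 < reff L Va Vb) ->
  forall c : {set 'I_n}, c != [set: 'I_n]%SET -> pos_on L c.
Proof.
move=> Ls H c; have [N cN] := ubnP #|c|; elim: N c cN => // N IH c cN cT.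
have [->|[k kc]] := set_0Vmem c.
  exists 1 => // v v0; rewrite /bform !big1 ?mulr0 // => i _.
    by rewrite v0 ?inE // mul0r.
  by rewrite v0 ?inE // expr0n.
have := H [set k]%SET (~: c).
have k0 : [set k]%SET != finset.set0 by apply/set0Pn; exists k; rewrite inE.
have c0 : ~: c != finset.set0.
  by apply: contra cT => /eqP E; rewrite -(finset.setCK c) E finset.setC0.
have dis : [disjoint [set k]%SET & ~: c] by rewrite disjoints1 inE kc.
move=> /(_ k0 c0 dis) [[d1 d2]]; rewrite /reff invr_gt0 => b0.
have [m [m1 m2 m3]] := @reff_schur L k (~: c) Ls d1 b0.
have cE : rest [set k] (~: c) = c :\ k.
  by apply/setP => i; rewrite !inE negb_or negbK.
rewrite cE in m1 m2; rewrite -(finset.setD1K kc); apply: (pos_on_step Ls _ m1 m2 m3).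
  by rewrite !inE eqxx.
apply: IH; first by move: cN; rewrite (cardsD1 k c) kc.
by apply: contra_neq cT => E; apply/setP => i; have /setP/(_ k) := E; rewrite !inE eqxx.
Qed.

(** Grounding: the energy only sees differences, so [v] may be shifted to vanish at one node, and
    the remaining nodes form a proper subset. When [v] sums to zero the shift can only increase the
    sum of squares. *)
Lemma energy_coercive w : (0 < n)%N -> (forall i j, w i j = w j i) ->
  (forall Va Vb : {set 'I_n},
    Va != finset.set0 -> Vb != finset.set0 -> [disjoint Va & Vb] ->
    reff_defined (laplacian w) Va Vb /\ 0 < reff (laplacian w) Va Vb) ->
  exists2 m, 0 < m & forall v, \sum_i v i = 0 -> m * \sum_i v i ^+ 2 <= energy w v.
Proof.
move=> n0 ws H; pose j0 := Ordinal n0.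
have Ls i j : laplacian w i j = laplacian w j i.
  by rewrite !mxE eq_sym; case: eqP => [->//|_]; rewrite ws.
have cT : ~: [set j0]%SET != [set: 'I_n]%SET.
  by apply/eqP => /setP/(_ j0); rewrite !inE eqxx.
have [m m0 P] := pos_on_proper Ls H cT.
exists m => // v v0; pose d i : R := v i - v j0.
have -> : energy w v = energy w d.
  congr (_ * _); apply: eq_bigr => i _; apply: eq_bigr => j _.
  by congr (_ * _ ^+ 2); rewrite /d; lra.
rewrite -bform_laplacian //; apply: le_trans (P d _); last first.
  by move=> i; rewrite !inE negbK => /eqP ->; rewrite /d subrr.
apply: ler_wpM2l; first exact: ltW.
have -> : \sum_i d i ^+ 2 = \sum_i v i ^+ 2 - 2 * v j0 * (\sum_i v i) + \sum_(i < n) v j0 ^+ 2.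
  rewrite mulr_sumr -sumrB -big_split; apply: eq_bigr => i _ /=; rewrite /d; lra.
rewrite v0 mulr0 subr0. rewrite lerDl; apply: sumr_ge0 => i _; exact: sqr_ge0.
Qed.

End LinAlg.

(** * The largest eigenvalue *)

Section Rayleigh.
Local Open Scope classical_set_scope.
Local Open Scope ring_scope.
Context {R : realType} {n : nat}.
Implicit Types (L : 'M[R]_n) (v x y : 'I_n -> R).

(** A quadratic polynomial in [t] that is nonnegative and vanishes at 0 has slope zero there; this
    serves as first-order condition at a maximum. *)
Lemma sqr_form_ge0_eq0 (a b : R) : (forall t, 0 <= t * (2 * a) + t ^+ 2 * b) -> a = 0.
Proof.
move=> H; have [b0|b0] := ltP 0 b.
  have := H (- (a / b)).
  have -> : - (a / b) * (2 * a) + (- (a / b)) ^+ 2 * b = - (a ^+ 2 / b).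
    by field; rewrite gt_eqF.
  rewrite oppr_ge0 pmulr_lle0 ?invr_gt0 // => h.
  by apply/eqP; rewrite -sqrf_eq0 eq_le h sqr_ge0.
have := H (- a); have := mulr_ge0_le0 (sqr_ge0 a) b0; rewrite sqrrN => h1 h2.
apply/eqP; rewrite -sqrf_eq0 eq_le sqr_ge0 andbT; nra.
Qed.

(** The quadratic form attains its maximum [r] on the unit sphere at [c]; the first variation makes
    [c] an eigenvector for [r], so [r] belongs to the set whose supremum is [lambda_max]. *)
Lemma bform_le_lambda_max L v : (0 < n)%N -> (forall i j, L i j = L j i) ->
  bform L v v <= lambda_max L * \sum_i v i ^+ 2.
Proof.
move=> n0 Ls.
pose nrm (u : 'I_n -> R) := \sum_i u i ^+ 2.
have nrm0 u : 0 <= nrm u by apply: sumr_ge0 => i _; exact: sqr_ge0.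
pose f (u : 'rV[R]_n) : R := bform L (u ord0) (u ord0).
pose A := [set u : 'rV[R]_n | nrm (u ord0) = 1].
have cc i : continuous (fun u : 'rV[R]_n => u ord0 i) by exact: coord_continuous.
have cf : continuous f.
  apply: continuous_sumf => i; apply: continuous_mulf => //.
  by apply: continuous_sumf => j; apply: continuous_mulf => //; exact: continuous_constf.
have cn : continuous (fun u : 'rV[R]_n => nrm (u ord0)).
  by apply: continuous_sumf => i; exact: continuous_sqrf.
have A0 : A !=set0.
  exists (\row_j (j == Ordinal n0)%:R); rewrite /A /= /nrm (bigD1 (Ordinal n0)) //=.
  rewrite mxE eqxx expr1n big1 ?addr0 // => i i0; by rewrite mxE (negPf i0) expr0n.
have cA : compact A.
  apply: bounded_closed_compact.
    exists 1; split => // M M1 u Au; apply: le_trans (ltW M1).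
    rewrite [leLHS]/Num.norm /= mx_normrE; apply/bigmax_leP; split => // -[i j] _ /=.
    rewrite ord1 -(@expr_le1 _ 2) // -normrX ger0_norm ?sqr_ge0 //.
    have <- : nrm (u ord0) = 1 by [].
    rewrite /nrm (bigD1 j) //= lerDl; apply: sumr_ge0 => k _; exact: sqr_ge0.
  exact: (closed_comp (fun u _ => cn u) (@closed_eq _ 1)).
have [c cA1 cmax] := EVT_max_rV A0 cA (continuous_subspaceT cf).
set r := f c in cmax.
have bZ a u : bform L (fun i => a * u i) (fun i => a * u i) = a ^+ 2 * bform L u u.
  by rewrite bformZl bformZr mulrA expr2.
have nZ a u : nrm (fun i => a * u i) = a ^+ 2 * nrm u.
  by rewrite /nrm mulr_sumr; apply: eq_bigr => i _; rewrite exprMn.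
have le_r u : bform L u u <= r * nrm u.
  have [u0|u0] := eqVneq (nrm u) 0.
    rewrite u0 mulr0 /bform big1 // => i _.
    have /eqP := u0; rewrite psumr_eq0; last by move=> j _; exact: sqr_ge0.
    by move=> /allP /(_ i); rewrite mem_index_enum sqrf_eq0 => /(_ isT) /eqP ->; rewrite mul0r.
  have up : 0 < nrm u by rewrite lt_def u0 nrm0.
  pose a := (Num.sqrt (nrm u))^-1.
  have a2 : a ^+ 2 = (nrm u)^-1 by rewrite /a exprVn sqr_sqrtr.
  pose u' : 'rV[R]_n := \row_i (a * u i).
  have u'E : u' ord0 = (fun i => a * u i) by apply/funext => i; rewrite mxE.
  have := cmax u'; rewrite inE /A /= u'E nZ a2 mulVf // => /(_ erefl).
  by rewrite /f u'E bZ a2 ler_pdivrMl // mulrC.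
pose cv := c ord0.
have c1 : nrm cv = 1 by move: cA1; rewrite inE.
(* First variation in the direction [y] of [r |u|^2 - u^T L u], which is nonnegative and vanishes at
   [c]. *)
have crit y : \sum_i (r * cv i - \sum_j L i j * cv j) * y i = 0.
  apply: (@sqr_form_ge0_eq0 _ (r * nrm y - bform L y y)) => t.
  have := le_r (fun i => cv i + t * y i).
  rewrite (bformDl L cv (fun i => t * y i)) !(bformDr L _ cv (fun i => t * y i)).
  rewrite !(bformZl L t y) !(bformZr L t _ y) (@bformC _ _ L cv y) //.
  have -> : nrm (fun i => cv i + t * y i) =
     nrm cv + t * (2 * \sum_i cv i * y i) + t ^+ 2 * nrm y.
    rewrite /nrm !mulr_sumr -!big_split; apply: eq_bigr => i _ /=; lra.
  have -> : \sum_i (r * cv i - \sum_j L i j * cv j) * y i =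
     r * (\sum_i cv i * y i) - bform L y cv.
    rewrite mulr_sumr -sumrB; apply: eq_bigr => i _; lra.
  rewrite c1 -[bform L cv cv]/r; move: (bform _ _ _) (bform _ _ _) (nrm y) (\sum_i _) => B1 B2 N S.
  nra.
have ev : eigenvalue L r.
  apply/eigenvalueP; exists c.
    apply/rowP => i; rewrite !mxE.
    have := crit (fun j => (j == i)%:R); rewrite (bigD1 i) //= eqxx mulr1 [X in _ + X]big1 ?addr0.
      move=> /eqP; rewrite subr_eq0 => /eqP ->; apply: eq_bigr => j _.
      by rewrite Ls mulrC.
    by move=> j ji; rewrite (negPf ji) mulr0.
  apply/eqP => c0; move: c1; rewrite /nrm big1; first by move/eqP; rewrite eq_sym oner_eq0.
  by move=> i _; rewrite /cv c0 mxE expr0n.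
(* For a set without upper bound, [sup] would be a default value and might not dominate [r]. *)
have ub : ubound [set l | eigenvalue L l] r.
  move=> l /= /eigenvalueP [u uL u0].
  have up : 0 < nrm (u ord0).
    rewrite lt_def nrm0 andbT; apply: contra u0 => /eqP H.
    apply/eqP/rowP => i; rewrite mxE.
    have /eqP := H; rewrite psumr_eq0; last by move=> j _; exact: sqr_ge0.
    by move=> /allP /(_ i); rewrite mem_index_enum sqrf_eq0 => /(_ isT) /eqP.
  rewrite -(ler_pM2r up); apply: le_trans (le_r _).
  rewrite /nrm mulr_sumr; apply: ler_sum => i _.
  have /rowP/(_ i) := uL; rewrite !mxE => E.
  rewrite expr2 mulrA -E mulrC.
  by under eq_bigr do rewrite Ls mulrC.
apply: le_trans (le_r v) _; rewrite ler_wpM2r //.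
by apply: ub_le_sup => //; exists r.
Qed.

End Rayleigh.

(** * The symbol on the closed right half-plane *)

Section Weights.
Local Open Scope classical_set_scope.
Local Open Scope ring_scope.
Context {R : realType}.
Implicit Types (a tau s w lam x y : R).

Lemma cos_lipschitz x y : `|cos x - cos y| <= `|x - y|.
Proof.
wlog yx : x y / y <= x.
  move=> H; have [yx|xy] := leP y x; first exact: H.
  by rewrite distrC (distrC x); apply/H/ltW.
rewrite (@ger0_norm _ (x - y)) ?subr_ge0 // ler_norml; apply/andP; split.
  have := @mono_of_derive R (fun t => t + cos t) (fun t => 1 - sin t) y x yx.
  move=> H; suff : y + cos y <= x + cos x by lra.
  apply: (H (fun t _ => is_derive_addf (is_derive_idf t) (is_derive_cos t))) => t _.
  by rewrite subr_ge0 sin_le1.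
have := @mono_of_derive R (fun t => t - cos t) (fun t => 1 + sin t) y x yx.
move=> H; suff : y - cos y <= x - cos x by lra.
have d (t : R) : is_derive t 1 (fun t : R => t - cos t) (1 + sin t).
  by have := is_derive_subf (is_derive_idf t) (is_derive_cos t); rewrite opprK.
by apply: (H (fun t _ => d t)) => t _; have := sin_geN1 t; lra.
Qed.

Lemma expRN_lipschitz x y : 0 <= x -> 0 <= y ->
  `|expR (- x) - expR (- y)| <= `|x - y|.
Proof.
wlog yx : x y / y <= x.
  move=> H x0 y0; have [yx|xy] := leP y x; first exact: H.
  by rewrite distrC (distrC x); apply: H => //; exact/ltW.
move=> x0 y0; rewrite distrC !ger0_norm ?subr_ge0 // ?ler_expR ?lerN2 //.
have -> : - x = - y + - (x - y) by lra.
rewrite expRD; have := expR_ge1Dx (- (x - y)).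
have : expR (- y) <= 1 by rewrite -expR0 ler_expR oppr_le0.
by have := expR_gt0 (- y); nra.
Qed.

(** For a positive edge, the smallest cosine over the box is [cos (tau * lam)] as long as
    [tau * lam < pi], and [-1] afterwards; the worst exponential is the smallest one ([s = lam]) if
    that cosine is positive and the largest one ([s = 0]) if it is negative. For [a <= 0] the factor
    of [a] is at most 1. These are the cases of [delay_weight]. *)
Lemma delay_weight_le lam a tau s w : 0 <= lam -> 0 <= tau -> 0 <= s <= lam ->
  `|w| <= lam ->
  delay_weight lam a tau <= a * expR (- (tau * s)) * cos (tau * w).
Proof.
move=> lam0 tau0 /andP[s0 sl] wl; rewrite /delay_weight.
have e0 : 0 < expR (- (tau * s)) := expR_gt0 _.
have e1 : expR (- (tau * s)) <= 1 by rewrite -expR0 ler_expR oppr_le0 mulr_ge0.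
have c1 := cos_le1 (tau * w); have c2 := cos_geN1 (tau * w).
have cosw : tau * lam <= pi -> cos (tau * lam) <= cos (tau * w).
  move=> tl; rewrite -(cos_norm (tau * w)) normrM (ger0_norm tau0).
  have h : tau * `|w| <= tau * lam by rewrite ler_wpM2l.
  rewrite leNgt ltr_cos ?in_itv /= ?mulr_ge0 // -?leNgt //.
  by rewrite (le_trans h).
case: ifPn => [a0|]; last first.
  rewrite -leNgt => a0; rewrite -mulrA.
  have : expR (- (tau * s)) * cos (tau * w) <= 1 by nra.
  by move: (expR _ * cos _) => z z1; nra.
rewrite -![a * _ * _]mulrA; case: ifPn => [/eqP ->|t0].
  by rewrite !mul0r oppr0 expR0 cos0 !mulr1.
case: ifPn => [tl|].
  rewrite ler_pM2l //; apply: ler_pM.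
  - exact: expR_ge0.
  - apply: cos_ge0_pihalf; rewrite (ltW tl) andbT.
    by apply: (@le_trans _ _ 0); [rewrite oppr_le0 divr_ge0 // pi_ge0|rewrite mulr_ge0].
  - by rewrite ler_expR lerN2 ler_wpM2l.
  - by apply: cosw; have := pi_ge0 R; lra.
rewrite -leNgt => th; case: ifPn => [tl|_].
  (* Here [cos (tau * lam) <= 0]. A positive [cos (tau * w)] gives a nonnegative product, and a
     nonpositive one can only increase under a factor between 0 and 1. *)
  rewrite ler_pM2l //; apply: (@le_trans _ _ (Num.min 0 (cos (tau * w)))).
    rewrite le_min (cosw (ltW tl)) andbT.
    rewrite -[tau * lam](subrK (pi / 2)) cosDpihalf oppr_le0.
    by apply: sin_ge0_pi; have := pi_ge0 R; lra.
  by rewrite ge_min; apply/orP; have [h|h] := leP 0 (cos (tau * w)); [left|right]; nra.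
rewrite -[- a]mulrN1 ler_pM2l //; nra.
Qed.

(* [s] and [w] are clamped to the box of [delay_weight_le]. *)
Lemma delay_weight_le_near lam a tau s w d : 0 <= lam -> 0 <= tau -> 0 <= d ->
  0 <= s <= lam + d -> `|w| <= lam + d ->
  delay_weight lam a tau <=
    a * expR (- (tau * s)) * cos (tau * w) + `|a| * tau * (2 * d).
Proof.
move=> lam0 tau0 d0 /andP[s0 sl] wl.
pose s' := Num.min s lam; pose w' := Num.max (- lam) (Num.min w lam).
have s'0 : 0 <= s' <= lam by rewrite le_min s0 lam0 ge_min lexx orbT.
have w'l : `|w'| <= lam.
  by rewrite ler_norml le_max lexx /= ge_max ge_min lexx orbT andbT; lra.
have ss : `|s - s'| <= d.
  by rewrite /s'; case: (leP s lam) => h; [rewrite subrr normr0|rewrite ger0_norm; lra].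
have ww : `|w - w'| <= d.
  move: wl; rewrite ler_norml => /andP[w1 w2]; rewrite /w'.
  rewrite ler_norml; case: (leP w lam) => h; [case: (leP (- lam) w) | case: (leP (- lam) lam)] => h'; lra.
apply: le_trans (delay_weight_le a lam0 tau0 s'0 w'l) _.
have /andP[s'1 _] := s'0.
have e1 := @expRN_lipschitz (tau * s) (tau * s') (mulr_ge0 tau0 s0) (mulr_ge0 tau0 s'1).
have e2 := cos_lipschitz (tau * w) (tau * w').
rewrite -mulrBr normrM (ger0_norm tau0) in e1.
rewrite -mulrBr normrM (ger0_norm tau0) in e2.
have e3 : expR (- (tau * s')) <= 1 by rewrite -expR0 ler_expR oppr_le0 mulr_ge0.
have e4 := expR_ge0 (- (tau * s')).
have e5 := cos_max (tau * w).
move: (expR (- (tau * s))) (expR (- (tau * s'))) (cos (tau * w)) (cos (tau * w')) e1 e2 e3 e4 e5.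
move=> E E' c c' e1 e2 e3 e4 e5.
rewrite -lerBlDl -!mulrA -mulrBr; apply: le_trans (ler_norm _) _; rewrite normrM.
apply: ler_wpM2l => //.
have -> : E' * c' - E * c = - ((E - E') * c + E' * (c - c')) by ring.
rewrite normrN; apply: le_trans (ler_normD _ _) _; rewrite !normrM (ger0_norm e4).
have h1 : tau * `|s - s'| <= tau * d by rewrite ler_wpM2l.
have h2 : tau * `|w - w'| <= tau * d by rewrite ler_wpM2l.
have := normr_ge0 (E - E'); have := normr_ge0 (c - c').
move: `|E - E'| `|c - c'| `|c| e1 e2 e5 => x y z e1 e2 e5 y0 x0.
have : x * z <= x by nra.
have : E' * y <= y by nra.
lra.
Qed.

End Weights.

(** * Uniform lower bound for the symbol on vectors of sum zero *)

Section Frequency.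
Local Open Scope classical_set_scope.
Local Open Scope ring_scope.
Context {R : realType} {n : nat}.
Variables (a tau : 'I_n -> 'I_n -> R) (lam m : R).
Hypothesis a_sym : forall i j, a i j = a j i.
Hypothesis tau_sym : forall i j, tau i j = tau j i.
Hypothesis tau_ge0 : forall i j, 0 <= tau i j.
Hypothesis lam_ge0 : 0 <= lam.
Hypothesis m_gt0 : 0 < m.
Hypothesis lam_max : forall v,
  energy (fun i j => `|a i j|) v <= lam * \sum_i v i ^+ 2.
Hypothesis m_min : forall v, \sum_i v i = 0 ->
  m * \sum_i v i ^+ 2 <= energy (fun i j => delay_weight lam (a i j) (tau i j)) v.

Let bc s w i j := a i j * expR (- (tau i j * s)) * cos (tau i j * w).
Let bs s w i j := a i j * expR (- (tau i j * s)) * sin (tau i j * w).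

(* Real part, and opposite of the imaginary part, of
   [(s + i w) Z_i + sum_j a_ij exp (- (s + i w) tau_ij) (Z_i - Z_j)] for [Z = P - i Q]:
   [P] and [Q] are the cosine and sine transforms of a real signal. *)
Definition symbol_re s w (P Q : 'I_n -> R) i := w * Q i + s * P i +
  \sum_j a i j * expR (- (tau i j * s)) *
    (cos (tau i j * w) * (P i - P j) - sin (tau i j * w) * (Q i - Q j)).

Definition symbol_im s w (P Q : 'I_n -> R) i := - (w * P i) + s * Q i +
  \sum_j a i j * expR (- (tau i j * s)) *
    (cos (tau i j * w) * (Q i - Q j) + sin (tau i j * w) * (P i - P j)).

Lemma energy_le (w w' : 'I_n -> 'I_n -> R) v : (forall i j, w i j <= w' i j) ->
  energy w v <= energy w' v.
Proof.
move=> ww; apply: ler_wpM2l => //; apply: ler_sum => i _; apply: ler_sum => j _.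
by rewrite ler_wpM2r ?sqr_ge0.
Qed.

Lemma energyE (w : 'I_n -> 'I_n -> R) v : (forall i j, w i j = w j i) ->
  \sum_i (\sum_j w i j * (v i - v j)) * v i = energy w v.
Proof. by move=> ws; rewrite sum_mul_diff. Qed.

Lemma energy_swap (w : 'I_n -> 'I_n -> R) P Q : (forall i j, w i j = w j i) ->
  \sum_i (\sum_j w i j * (P i - P j)) * Q i =
  \sum_i (\sum_j w i j * (Q i - Q j)) * P i.
Proof.
move=> ws; rewrite !sum_mul_diff //; congr (_ * _).
by apply: eq_bigr => i _; apply: eq_bigr => j _; congr (_ * _); rewrite mulrC.
Qed.

Let bcC s w i j : bc s w i j = bc s w j i.
Proof. by rewrite /bc a_sym tau_sym. Qed.
Let bsC s w i j : bs s w i j = bs s w j i.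
Proof. by rewrite /bs a_sym tau_sym. Qed.

Let reE s w P Q i : symbol_re s w P Q i = w * Q i + s * P i +
  ((\sum_j bc s w i j * (P i - P j)) - \sum_j bs s w i j * (Q i - Q j)).
Proof.
rewrite /symbol_re -sumrB; congr (_ + _); apply: eq_bigr => j _.
by rewrite /bc /bs; ring.
Qed.

Let imE s w P Q i : symbol_im s w P Q i = - (w * P i) + s * Q i +
  ((\sum_j bc s w i j * (Q i - Q j)) + \sum_j bs s w i j * (P i - P j)).
Proof.
rewrite /symbol_im -big_split; congr (_ + _); apply: eq_bigr => j _ /=.
by rewrite /bc /bs; ring.
Qed.

Let N (P Q : 'I_n -> R) := \sum_i P i ^+ 2 + \sum_i Q i ^+ 2.

(** The weights are symmetric, so by [energy_swap] the mixed terms in [P] and [Q] cancel and the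
    real part contains the cosine weights only. In the same way only the sine weights survive in
    [pairing_im]. *)
Let pairing_re s w P Q :
  \sum_i (symbol_re s w P Q i * P i + symbol_im s w P Q i * Q i) =
  s * N P Q + (energy (bc s w) P + energy (bc s w) Q).
Proof.
rewrite -!(energyE _ (bcC s w)).
have E := energy_swap P Q (bsC s w).
rewrite /N mulrDr !mulr_sumr -!big_split /=.
set S := RHS; transitivity (S + (\sum_i (\sum_j bs s w i j * (P i - P j)) * Q i -
  \sum_i (\sum_j bs s w i j * (Q i - Q j)) * P i)); last by rewrite E subrr addr0.
rewrite -sumrB /S -big_split /=; apply: eq_bigr => i _; rewrite reE imE; ring.
Qed.

Let pairing_im s w P Q :
  \sum_i (symbol_re s w P Q i * Q i - symbol_im s w P Q i * P i) =
  w * N P Q - (energy (bs s w) P + energy (bs s w) Q).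
Proof.
rewrite -!(energyE _ (bsC s w)).
have E := energy_swap P Q (bcC s w).
rewrite /N mulrDr !mulr_sumr -!big_split -sumrB /=.
set S := RHS; transitivity (S + (\sum_i (\sum_j bc s w i j * (P i - P j)) * Q i -
  \sum_i (\sum_j bc s w i j * (Q i - Q j)) * P i)); last by rewrite E subrr addr0.
rewrite -sumrB /S -big_split /=; apply: eq_bigr => i _; rewrite reE imE; ring.
Qed.

Let energy_abs (w : 'I_n -> 'I_n -> R) v : (forall i j, `|w i j| <= `|a i j|) ->
  - (lam * \sum_i v i ^+ 2) <= energy w v <= lam * \sum_i v i ^+ 2.
Proof.
move=> wa; apply/andP; split; last first.
  apply: le_trans (lam_max v); apply: energy_le => i j.
  exact: le_trans (ler_norm _) (wa i j).
rewrite lerNl; apply: le_trans (lam_max v).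
rewrite /energy -mulrN ler_wpM2l // -sumrN; apply: ler_sum => i _.
rewrite -sumrN; apply: ler_sum => j _; rewrite -mulNr ler_wpM2r ?sqr_ge0 //.
by apply: le_trans (wa i j); rewrite -normrN; exact: ler_norm.
Qed.

(** In each region of the half-plane some signed component [X] of the pairing is at least [k N],
    while Young's inequality gives [X <= (k N + F / k) / 2]; together [N <= F / k^2]. Beyond the box
    enlarged by [d], the term in [s] or [w] beats [lam] by [d]; inside it at least half of [m]
    remains. *)
Lemma symbol_bounded_below : exists2 C, 0 < C & forall s w P Q, 0 <= s ->
  \sum_i P i = 0 -> \sum_i Q i = 0 ->
  \sum_i P i ^+ 2 + \sum_i Q i ^+ 2 <=
    C * (\sum_i symbol_re s w P Q i ^+ 2 + \sum_i symbol_im s w P Q i ^+ 2).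
Proof.
(* Lowering every weight by [e] costs [e n |v|^2] on vectors of sum zero, at most half of [m |v|^2];
   [d] is then chosen so that on the enlarged box no cosine weight is more than [e] below
   [delay_weight]. *)
pose e : R := m / (4 * (n%:R + 1)).
have n0 : 0 <= n%:R :> R by exact: ler0n.
have e0 : 0 < e by rewrite divr_gt0 //; lra.
pose T := \sum_i \sum_j `|a i j| * tau i j.
have aT i j : `|a i j| * tau i j <= T.
  have pos i' j' : 0 <= `|a i' j'| * tau i' j' by rewrite mulr_ge0.
  rewrite /T (bigD1 i) //= (bigD1 j) //= -addrA lerDl addr_ge0 //.
    by apply: sumr_ge0 => k _.
  by apply: sumr_ge0 => k _; apply: sumr_ge0.
have T0 : 0 <= T by apply: sumr_ge0 => i _; apply: sumr_ge0 => j _; rewrite mulr_ge0.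
pose d := e / (1 + 2 * T).
have d0 : 0 < d by rewrite divr_gt0 //; lra.
have dT : T * (2 * d) <= e.
  have : d * (1 + 2 * T) = e by rewrite /d divfK // gt_eqF //; lra.
  by nra.
pose k := Num.min d (m / 2).
have k0 : 0 < k by rewrite lt_min d0 divr_gt0.
exists (k ^- 2); first by rewrite invr_gt0 exprn_gt0.
move=> s w P Q s0 P0 Q0.
set F1 := symbol_re s w P Q; set F2 := symbol_im s w P Q.
rewrite -[X in X <= _]/(N P Q).
set F := (X in _ <= _ * X).
have N0 : 0 <= N P Q by apply: addr_ge0; apply: sumr_ge0 => i _; exact: sqr_ge0.
have young X : k * N P Q <= X -> X <= 2^-1 * (k * N P Q + k^-1 * F) -> N P Q <= k ^- 2 * F.
  move=> h1 h2; rewrite -(ler_pM2l k0); apply: le_trans (_ : k^-1 * F <= _); first by lra.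
  by rewrite mulrA; have -> : k * k ^- 2 = k^-1 by field; rewrite gt_eqF.
have sq (x y : R) : x * y <= 2^-1 * (k * y ^+ 2 + k^-1 * x ^+ 2).
  have : 0 <= k * (y - k^-1 * x) ^+ 2 by rewrite mulr_ge0 ?sqr_ge0 // ltW.
  have -> : k * (y - k^-1 * x) ^+ 2 = k * y ^+ 2 - 2 * (x * y) + k^-1 * x ^+ 2.
    by field; rewrite gt_eqF.
  lra.
have sum4 (f1 f2 p1 p2 : 'I_n -> R) : 
  \sum_i p1 i ^+ 2 + \sum_i p2 i ^+ 2 = N P Q -> 
  \sum_i f1 i ^+ 2 + \sum_i f2 i ^+ 2 = F -> 
  \sum_i (f1 i * p1 i + f2 i * p2 i) <= 2^-1 * (k * N P Q + k^-1 * F).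
  move=> <- <-; rewrite !mulrDr !mulr_sumr -!big_split /=; apply: ler_sum => i _.
  by have := sq (f1 i) (p1 i); have := sq (f2 i) (p2 i); lra.
have bcs i j : `|bc s w i j| <= `|a i j| /\ `|bs s w i j| <= `|a i j|.
  have E : `|a i j * expR (- (tau i j * s))| <= `|a i j|.
    rewrite normrM ler_piMr // ger0_norm ?expR_ge0 //.
    by rewrite -expR0 ler_expR oppr_le0 mulr_ge0.
  by rewrite /bc /bs !(normrM (a i j * _)); split; apply: le_trans E; rewrite ler_piMr // ?cos_max ?sin_max.
have /andP[r1 r2] := energy_abs P (fun i j => (bcs i j).1).
have /andP[r3 r4] := energy_abs Q (fun i j => (bcs i j).1).
have /andP[r5 r6] := energy_abs P (fun i j => (bcs i j).2).
have /andP[r7 r8] := energy_abs Q (fun i j => (bcs i j).2).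
have kd : k <= d by rewrite ge_min lexx.
have km : k <= m / 2 by rewrite ge_min lexx orbT.
have QP : \sum_i Q i ^+ 2 + \sum_i P i ^+ 2 = N P Q by rewrite addrC.
have QNP : \sum_i Q i ^+ 2 + \sum_i (- P i) ^+ 2 = N P Q.
  by rewrite -QP; congr (_ + _); apply: eq_bigr => i _; rewrite sqrrN.
have NQP : \sum_i (- Q i) ^+ 2 + \sum_i P i ^+ 2 = N P Q.
  by rewrite -QP; congr (_ + _); apply: eq_bigr => i _; rewrite sqrrN.
have A1 := pairing_re s w P Q; have A2 := pairing_im s w P Q.
have NE : lam * N P Q = lam * \sum_i P i ^+ 2 + lam * \sum_i Q i ^+ 2 by rewrite -mulrDr.
have kN : k * N P Q <= d * N P Q by rewrite ler_wpM2r.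
have [sbig|ssmall] := ltP (lam + d) s.
  apply: (young _ _ (sum4 F1 F2 P Q erefl erefl)); rewrite A1.
  have : (lam + d) * N P Q <= s * N P Q by rewrite ler_wpM2r // ltW.
  by lra.
have [wbig|wsmall] := ltP (lam + d) w.
  apply: (young _ _ (sum4 F1 F2 Q (fun i => - P i) QNP erefl)).
  under eq_bigr do rewrite mulrN.
  rewrite A2; have : (lam + d) * N P Q <= w * N P Q by rewrite ler_wpM2r // ltW.
  by lra.
have [wbig'|wsmall'] := ltP w (- (lam + d)).
  apply: (young _ _ (sum4 F1 F2 (fun i => - Q i) P NQP erefl)).
  rewrite (_ : \sum_i _ = - \sum_i (F1 i * Q i - F2 i * P i)); last first.
    by rewrite -sumrN; apply: eq_bigr => i _; lra.
  rewrite A2; have : w * N P Q <= - (lam + d) * N P Q by rewrite ler_wpM2r // ltW.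
  by lra.
apply: (young _ _ (sum4 F1 F2 P Q erefl erefl)); rewrite A1.
have key v : \sum_i v i = 0 -> m / 2 * \sum_i v i ^+ 2 <= energy (bc s w) v.
  move=> v0; have h1 := m_min v0.
  have h2 : energy (fun i j => delay_weight lam (a i j) (tau i j)) v <=
      energy (fun i j => bc s w i j + e) v.
    apply: energy_le => i j.
    have wd : `|w| <= lam + d by rewrite ler_norml wsmall wsmall'.
    have sd : 0 <= s <= lam + d by rewrite s0 ssmall.
    apply: le_trans (delay_weight_le_near (a i j) lam_ge0 (tau_ge0 i j) (ltW d0) sd wd) _.
    rewrite lerD2l; apply: le_trans dT; rewrite ler_wpM2r //; lra.
  have h3 : energy (fun i j => bc s w i j + e) v = energy (bc s w) v + energy (fun _ _ => e) v.
    rewrite /energy -mulrDr -big_split; congr (_ * _); apply: eq_bigr => i _.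
    by rewrite -big_split; apply: eq_bigr => j _; rewrite mulrDl.
  (* Complete graph with equal weights: its Laplacian is [e n] times the identity on vectors of sum
     zero. *)
  have h4 : energy (fun _ _ => e) v = e * (n%:R * \sum_i v i ^+ 2).
    rewrite -(@energyE (fun _ _ => e) v (fun _ _ => erefl)).
    transitivity (\sum_i e * (n%:R * v i ^+ 2)); last first.
      by rewrite mulr_sumr mulr_sumr; apply: eq_bigr => i _.
    apply: eq_bigr => i _; rewrite -mulr_sumr sumrB v0 subr0 sumr_const card_ord -mulr_natl.
    by ring.
  have h5 : e * (n%:R * \sum_i v i ^+ 2) <= m / 2 * \sum_i v i ^+ 2.
    rewrite mulrA ler_wpM2r //; first by apply: sumr_ge0 => i _; exact: sqr_ge0.
    have : e * (4 * (n%:R + 1)) = m by rewrite /e divfK // gt_eqF //; lra.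
    by nra.
  by lra.
have h1 := key P P0; have h2 := key Q Q0.
have : 0 <= s * N P Q by rewrite mulr_ge0.
have : k * N P Q <= m / 2 * N P Q by rewrite ler_wpM2r.
by rewrite [X in _ <= X]mulrDr; lra.
Qed.

End Frequency.

(** * Fejer's kernel and Parseval's identity *)

Section Fejer.
Local Open Scope classical_set_scope.
Local Open Scope ring_scope.
Context {R : realType}.
Implicit Types (f : R -> R) (P s t w x : R).

Definition cos_transform f P w : R := cintegral (fun t => f t * cos (w * t)) 0 P.
Definition sin_transform f P w : R := cintegral (fun t => f t * sin (w * t)) 0 P.

Lemma continuous_cosw w : continuous (fun t : R => cos (w * t)).
Proof. by apply: continuous_arg_scale; exact: continuous_cos. Qed.

Lemma continuous_sinw w : continuous (fun t : R => sin (w * t)).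
Proof. by apply: continuous_arg_scale; exact: continuous_sin. Qed.

Lemma is_derive_cosw w t : is_derive t 1 (fun t : R => cos (w * t)) (- (w * sin (w * t))).
Proof. by rewrite -mulrN; apply: is_derive_arg_scale. Qed.

Lemma is_derive_sinw w t : is_derive t 1 (fun t : R => sin (w * t)) (w * cos (w * t)).
Proof. by apply: is_derive_arg_scale. Qed.

(* Summing over the differences of two indices below [N] produces Fejer's weights
   [N - |k|] without reindexing. *)
Definition harmonic_freq P (q q' : nat) : R := (q%:R - q'%:R) * (2 * pi / P).

Lemma cos_harmonic P q q' : 0 < P -> cos (harmonic_freq P q q' * P) = 1.
Proof.
move=> P0; have -> : harmonic_freq P q q' * P = (pi *+ 2) *+ q - (pi *+ 2) *+ q'.
  by rewrite /harmonic_freq -[_ *+ q]mulr_natl -[_ *+ q']mulr_natl -[pi *+ 2]mulr_natl; field; rewrite gt_eqF.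
have c k : cos ((pi *+ 2) *+ k) = 1 :> R.
  by rewrite -[_ *+ k]add0r (periodicn (@cosD2pi R)) cos0.
have s k : sin ((pi *+ 2) *+ k) = 0 :> R.
  by rewrite -[_ *+ k]add0r (periodicn (@sinD2pi R)) sin0.
by rewrite cosB !c !s; ring.
Qed.

Lemma sin_harmonic P q q' : 0 < P -> sin (harmonic_freq P q q' * P) = 0.
Proof.
move=> P0; have := cos2Dsin2 (harmonic_freq P q q' * P); rewrite cos_harmonic //.
by move=> h; apply/eqP; rewrite -sqrf_eq0; apply/eqP; lra.
Qed.

Lemma cos_transform_const P q q' : 0 < P ->
  cos_transform (fun=> 1) P (harmonic_freq P q q') = P *+ (q == q').
Proof.
move=> P0; rewrite /cos_transform; set w := harmonic_freq P q q'.
under [X in cintegral X]eq_fun do rewrite mul1r.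
have [E|qq] := eqVneq q q'.
  have -> : w = 0 by rewrite /w /harmonic_freq E subrr mul0r.
  under [X in cintegral X]eq_fun do rewrite mul0r cos0.
  by rewrite cintegral_const ?ltW // mul1r subr0.
have w0 : w != 0.
  rewrite mulf_neq0 //; first by rewrite subr_eq0 eqr_nat.
  by rewrite gt_eqF // divr_gt0 // mulr_gt0 // pi_gt0.
rewrite mulr0n; apply: (mulfI w0); rewrite mulr0 -cintegralZ ?ltW //; last exact: continuous_cosw.
have c : continuous (fun t : R => w * cos (w * t)).
  by apply: continuous_mulf; [exact: continuous_constf|exact: continuous_cosw].
rewrite (cintegralE c (ltW P0) (fun t _ => is_derive_sinw w t)).
by rewrite sin_harmonic // mulr0 sin0 subr0.
Qed.

Lemma sin_transform_const P q q' : 0 < P -> sin_transform (fun=> 1) P (harmonic_freq P q q') = 0.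
Proof.
move=> P0; rewrite /sin_transform; set w := harmonic_freq P q q'.
under [X in cintegral X]eq_fun do rewrite mul1r.
have [E|w0] := eqVneq w 0.
  under [X in cintegral X]eq_fun do rewrite E mul0r sin0.
  by rewrite cintegral_const ?ltW // mul0r.
have c : continuous (fun t : R => - w * sin (w * t)).
  by apply: continuous_mulf; [exact: continuous_constf|exact: continuous_sinw].
have nw0 : - w != 0 by rewrite oppr_eq0.
apply: (mulfI nw0); rewrite mulr0 -cintegralZ ?ltW //; last exact: continuous_sinw.
have d t (_ : 0 <= t <= P) : is_derive t 1 (fun t : R => cos (w * t)) (- w * sin (w * t)).
  by rewrite mulNr; exact: is_derive_cosw.
by rewrite (cintegralE c (ltW P0) d) cos_harmonic // mulr0 cos0 subrr.
Qed.

(** The squared modulus of the geometric sum of the [exp (i q x)], that is, [N] times Fejer's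
    kernel. *)
Definition fejer_sum N x : R := \sum_(q < N) \sum_(q' < N) cos ((q%:R - q'%:R) * x).

Lemma fejer_sumE N x : fejer_sum N x =
  (\sum_(q < N) cos (q%:R * x)) ^+ 2 + (\sum_(q < N) sin (q%:R * x)) ^+ 2.
Proof.
rewrite !expr2 !mulr_suml -big_split; apply: eq_bigr => q _ /=.
rewrite !mulr_sumr -big_split; apply: eq_bigr => q' _ /=.
by rewrite mulrBl cosB.
Qed.

Lemma fejer_sum_ge0 N x : 0 <= fejer_sum N x.
Proof. by rewrite fejer_sumE addr_ge0 ?sqr_ge0. Qed.

(** Multiplied by [exp (i x) - 1], the geometric sum telescopes to [exp (i N x) - 1]; [E1] and [E2]
    are the real and imaginary parts. Taking squared moduli, [2 (1 - cos x)] times the kernel is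
    [2 (1 - cos (N x)) <= 4]. *)
Lemma fejer_sum_le N x : fejer_sum N x * (1 - cos x) <= 2.
Proof.
rewrite fejer_sumE; set A := \sum_(q < N) cos _; set B := \sum_(q < N) sin _.
have E1 : A * (cos x - 1) - B * sin x = cos (N%:R * x) - 1.
  rewrite {}/A {}/B; elim: N => [|N IH].
    by rewrite !big_ord0 !mul0r cos0; ring.
  rewrite !big_ord_recr /= -natr1 (mulrDl _ 1 x) mul1r cosD.
  by move: IH; set a := \sum_(_ < _) _; set b := \sum_(_ < _) _; lra.
have E2 : A * sin x + B * (cos x - 1) = sin (N%:R * x).
  rewrite {E1}/A {}/B; elim: N => [|N IH].
    by rewrite !big_ord0 !mul0r sin0; ring.
  rewrite !big_ord_recr /= -natr1 (mulrDl _ 1 x) mul1r sinD.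
  by move: IH; set a := \sum_(_ < _) _; set b := \sum_(_ < _) _; lra.
have h1 := cos2Dsin2 x; have h2 := cos2Dsin2 (N%:R * x).
have h3 := cos_geN1 (N%:R * x).
have E : (A ^+ 2 + B ^+ 2) * ((cos x - 1) ^+ 2 + sin x ^+ 2) =
   (cos (N%:R * x) - 1) ^+ 2 + sin (N%:R * x) ^+ 2.
  by rewrite -E1 -E2; ring.
have e3 : (cos x - 1) ^+ 2 + sin x ^+ 2 = 2 * (1 - cos x) by lra.
have e4 : (cos (N%:R * x) - 1) ^+ 2 + sin (N%:R * x) ^+ 2 = 2 * (1 - cos (N%:R * x)) by lra.
rewrite e3 e4 in E; move: E; set K := _ + _; lra.
Qed.

(* Both bounds come from the double integral of [(f s - f t)^2 * fejer_sum], which is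
   nonnegative, and bounded independently of [N] when [(f s - f t)^2] is controlled by
   [1 - cos]. *)
Section Parseval.
Variables (f : R -> R) (P : R).
Hypothesis P_gt0 : 0 < P.
Hypothesis cf : continuous f.

Let P0 : 0 <= P. Proof. exact: ltW. Qed.
Let f2 t := f t ^+ 2.
Let cf2 : continuous f2. Proof. exact: continuous_sqrf. Qed.
Let c1 : continuous (fun _ : R => 1 : R). Proof. exact: continuous_constf. Qed.

Let ccos (g : R -> R) w : continuous g -> continuous (fun t => g t * cos (w * t)).
Proof. by move=> cg; apply: continuous_mulf => //; exact: continuous_cosw. Qed.
Let csin (g : R -> R) w : continuous g -> continuous (fun t => g t * sin (w * t)).
Proof. by move=> cg; apply: continuous_mulf => //; exact: continuous_sinw. Qed.
Let cZ c (g : R -> R) : continuous g -> continuous (fun t => c * g t).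
Proof. by move=> cg; apply: continuous_mulf => //; exact: continuous_constf. Qed.

Let part w s := (f2 s * cos_transform (fun=> 1) P w - 2 * f s * cos_transform f P w + cos_transform f2 P w) * cos (w * s)
  + (f2 s * sin_transform (fun=> 1) P w - 2 * f s * sin_transform f P w + sin_transform f2 P w) * sin (w * s).

Let cintegral3 (g1 g2 g3 : R -> R) (a1 a2 a3 : R) : continuous g1 -> continuous g2 -> continuous g3 ->
  cintegral (fun t => a1 * g1 t + a2 * g2 t + a3 * g3 t) 0 P =
  a1 * cintegral g1 0 P + a2 * cintegral g2 0 P + a3 * cintegral g3 0 P.
Proof.
move=> cg1 cg2 cg3; rewrite cintegralD ?cintegralD ?cintegralZ //; try exact: cZ.
by apply: continuous_addf; exact: cZ.
Qed.

Let part_integral w s : cintegral (fun t => (f s - f t) ^+ 2 * cos (w * (s - t))) 0 P = part w s.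
Proof.
pose g1 t := cos (w * s) * (1 * cos (w * t)) + sin (w * s) * (1 * sin (w * t)).
pose g2 t := cos (w * s) * (f t * cos (w * t)) + sin (w * s) * (f t * sin (w * t)).
pose g3 t := cos (w * s) * (f2 t * cos (w * t)) + sin (w * s) * (f2 t * sin (w * t)).
have cg (g : R -> R) : continuous g -> continuous (fun t =>
    cos (w * s) * (g t * cos (w * t)) + sin (w * s) * (g t * sin (w * t))).
  by move=> cg; apply: continuous_addf; apply: cZ; [exact: ccos|exact: csin].
have Jg (g : R -> R) : continuous g -> cintegral (fun t =>
    cos (w * s) * (g t * cos (w * t)) + sin (w * s) * (g t * sin (w * t))) 0 P =
    cos (w * s) * cos_transform g P w + sin (w * s) * sin_transform g P w.
  move=> h; rewrite cintegralD ?cintegralZ //; [exact: csin|exact: ccos|apply: cZ; exact: ccos|apply: cZ; exact: csin].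
rewrite (_ : (fun t => _) = fun t => f2 s * g1 t + (- (2 * f s)) * g2 t + 1 * g3 t).
  rewrite cintegral3 /g1 /g2 /g3 ?(Jg _ c1) ?(Jg _ cf) ?(Jg _ cf2); try exact: cg.
  rewrite /part; ring.
apply/funext => t; rewrite mulrBr cosB /g1 /g2 /g3 /f2; ring.
Qed.

Let part_integral2 w : cintegral (part w) 0 P =
  2 * (cos_transform (fun=> 1) P w * cos_transform f2 P w + sin_transform (fun=> 1) P w * sin_transform f2 P w)
  - 2 * (cos_transform f P w ^+ 2 + sin_transform f P w ^+ 2).
Proof.
pose a1 := cos_transform (fun=> 1) P w; pose b1 := sin_transform (fun=> 1) P w.
pose a2 := cos_transform f P w; pose b2 := sin_transform f P w.
pose a3 := cos_transform f2 P w; pose b3 := sin_transform f2 P w.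
pose h1 t := a1 * (f2 t * cos (w * t)) + (- 2 * a2) * (f t * cos (w * t)) + a3 * (1 * cos (w * t)).
pose h2 t := b1 * (f2 t * sin (w * t)) + (- 2 * b2) * (f t * sin (w * t)) + b3 * (1 * sin (w * t)).
have ch1 : continuous h1.
  by apply: continuous_addf; [apply: continuous_addf|]; apply: cZ; exact: ccos.
have ch2 : continuous h2.
  by apply: continuous_addf; [apply: continuous_addf|]; apply: cZ; exact: csin.
rewrite (_ : part w = fun t => h1 t + h2 t).
  rewrite cintegralD // /h1 /h2 !cintegral3; try exact: ccos; try exact: csin.
  by rewrite -/(cos_transform _ P w) -/(sin_transform _ P w) /a1 /b1 /a2 /b2 /a3 /b3 /cos_transform /sin_transform; ring.
by apply/funext => t; rewrite /part /h1 /h2 /a1 /b1 /a2 /b2 /a3 /b3; ring.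
Qed.

Let inner N s := cintegral (fun t => (f s - f t) ^+ 2 * fejer_sum N (2 * pi / P * (s - t))) 0 P.

Let cpair w s : continuous (fun t => (f s - f t) ^+ 2 * cos (w * (s - t))).
Proof.
apply: continuous_mulf.
  by apply: continuous_sqrf; apply: continuous_subf => //; exact: continuous_constf.
by apply: (@continuous_arg_reflect R (fun u => cos (w * u))); exact: continuous_cosw.
Qed.

Let fejer_pairE N s t : (f s - f t) ^+ 2 * fejer_sum N (2 * pi / P * (s - t)) =
  \sum_(q < N) \sum_(q' < N) (f s - f t) ^+ 2 * cos (harmonic_freq P q q' * (s - t)).
Proof.
rewrite /fejer_sum mulr_sumr; apply: eq_bigr => q _.
by rewrite mulr_sumr; apply: eq_bigr => q' _; rewrite /harmonic_freq mulrA.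
Qed.

Let cinner N s : continuous (fun t => (f s - f t) ^+ 2 * fejer_sum N (2 * pi / P * (s - t))).
Proof.
under eq_fun do rewrite fejer_pairE.
by apply: continuous_sumf => q; apply: continuous_sumf => q'; exact: cpair.
Qed.

Let innerE N s : inner N s = \sum_(q < N) \sum_(q' < N) part (harmonic_freq P q q') s.
Proof.
rewrite /inner; under [X in cintegral X]eq_fun do rewrite fejer_pairE.
rewrite cintegral_sum //; last by move=> q; apply: continuous_sumf => q'; exact: cpair.
apply: eq_bigr => q _; rewrite cintegral_sum //.
by apply: eq_bigr => q' _; rewrite part_integral.
Qed.

Let cpart w : continuous (part w).
Proof.
apply: continuous_addf; apply: continuous_mulf;
  [|exact: continuous_cosw| |exact: continuous_sinw];
  (apply: continuous_addf; [apply: continuous_subf|exact: continuous_constf]);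
  by apply: continuous_mulf; [|exact: continuous_constf]; rewrite //; apply: cZ.
Qed.

Let inner_integral N : cintegral (inner N) 0 P = 2 * (N%:R * P * cintegral f2 0 P -
  \sum_(q < N) \sum_(q' < N) (cos_transform f P (harmonic_freq P q q') ^+ 2 + sin_transform f P (harmonic_freq P q q') ^+ 2)).
Proof.
rewrite (_ : inner N = fun s => \sum_(q < N) \sum_(q' < N) part (harmonic_freq P q q') s); last first.
  by apply/funext => s; exact: innerE.
rewrite cintegral_sum //; last by move=> q; apply: continuous_sumf => q'.
rewrite mulrBr; have -> : N%:R * P * cintegral f2 0 P = \sum_(q < N) P * cintegral f2 0 P.
  by rewrite sumr_const card_ord -mulr_natl; ring.
rewrite !mulr_sumr -sumrB; apply: eq_bigr => q _.
rewrite cintegral_sum // mulr_sumr.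
(* Only the diagonal [q' = q] keeps the terms with the transform of 1; up to the factor 2 it
   contributes [P] times the integral of [f^2] for each of the [N] values of [q]. *)
rewrite (bigD1 q) //= [in RHS](bigD1 q) //= part_integral2.
rewrite cos_transform_const // sin_transform_const // eqxx mul0r addr0 mulr1n.
have -> : cos_transform f2 P (harmonic_freq P q q) = cintegral f2 0 P.
  rewrite /cos_transform /harmonic_freq subrr mul0r.
  by under [X in cintegral X]eq_fun do rewrite mul0r cos0 mulr1.
rewrite opprD addrA; congr (_ + _).
rewrite -sumrN; apply: eq_bigr => q' qq'; rewrite part_integral2.
have qn : (q == q' :> nat) = false by rewrite val_eqE eq_sym (negPf qq').
rewrite cos_transform_const // sin_transform_const // qn.
by rewrite mulr0n !mul0r; ring.
Qed.

Lemma fejer_bessel N :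
  \sum_(q < N) \sum_(q' < N) (cos_transform f P (harmonic_freq P q q') ^+ 2 + sin_transform f P (harmonic_freq P q q') ^+ 2)
  <= N%:R * P * cintegral (fun t => f t ^+ 2) 0 P.
Proof.
rewrite -subr_ge0 -(@pmulr_rge0 _ 2) // -inner_integral; apply: cintegral_ge0 => //.
  rewrite (_ : inner N = fun s => \sum_(q < N) \sum_(q' < N) part (harmonic_freq P q q') s); last first.
    by apply/funext => s; exact: innerE.
  by apply: continuous_sumf => q; apply: continuous_sumf => q'.
by move=> s _; apply: cintegral_ge0 => // t _; rewrite mulr_ge0 ?sqr_ge0 ?fejer_sum_ge0.
Qed.

Lemma fejer_parseval N M : 0 <= M ->
  (forall s t, 0 <= s <= P -> 0 <= t <= P ->
     (f s - f t) ^+ 2 <= M * (1 - cos (2 * pi / P * (s - t)))) ->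
  N%:R * P * cintegral (fun t => f t ^+ 2) 0 P - M * P ^+ 2 <=
  \sum_(q < N) \sum_(q' < N) (cos_transform f P (harmonic_freq P q q') ^+ 2 + sin_transform f P (harmonic_freq P q q') ^+ 2).
Proof.
(* The hypothesis lets [1 - cos] absorb the peak of the kernel: by [fejer_sum_le] the integrand is
   at most [2 M], so the double integral is at most [2 M P^2] whatever [N] is. *)
move=> M0 H; suff : cintegral (inner N) 0 P <= 2 * (M * P ^+ 2) by rewrite inner_integral /f2; lra.
have -> : 2 * (M * P ^+ 2) = cintegral (fun=> 2 * M * P) 0 P by rewrite cintegral_const //; ring.
apply: le_cintegral => //; last first.
- move=> s sP; have -> : 2 * M * P = cintegral (fun=> 2 * M) 0 P by rewrite cintegral_const //; ring.
  apply: le_cintegral => //; first exact: continuous_constf.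
  move=> t tP; have h1 := H s t sP tP; set th := 2 * pi / P * (s - t) in h1 *.
  have h2 := fejer_sum_le N th; have h3 := fejer_sum_ge0 N th.
  apply: le_trans (_ : M * (1 - cos th) * fejer_sum N th <= _); first by rewrite ler_wpM2r.
  by nra.
- exact: continuous_constf.
- rewrite (_ : inner N = fun s => \sum_(q < N) \sum_(q' < N) part (harmonic_freq P q q') s); last first.
    by apply/funext => s; exact: innerE.
  by apply: continuous_sumf => q; apply: continuous_sumf => q'.
Qed.

End Parseval.

(* On [1, 2 pi / 3], [sin x = cos (x - pi / 2)] and [|x - pi / 2| <= 1]. *)
Lemma sin_ge_lin x : 0 <= x <= 2 * pi / 3 -> cos 1 / 3 * x <= sin x.
Proof.
move=> /andP[x0 x1]; have p2 := @pihalf_lt2 R; have p1 := @pihalf_ge1 R.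
have c1 := @cos1_gt0 R; have c2 := @cos_le1 R 1.
have [xl|xl] := leP x 1; last first.
  apply: (@le_trans _ _ (cos 1)); first by nra.
  have -> : sin x = cos (x - pi / 2) by rewrite cosBpihalf.
  rewrite -(cos_norm (x - _)).
  have h : `|x - pi / 2| <= 1 by rewrite ler_norml; lra.
  have h' := normr_ge0 (x - pi / 2).
  by rewrite leNgt ltr_cos ?in_itv /= -?leNgt //; lra.
apply: (@le_trans _ _ (cos 1 * x)); first by nra.
have := @mono_of_derive R (fun t => sin t - cos 1 * t) (fun t => cos t - cos 1) 0 x x0.
rewrite sin0 mulr0 subrr => H; rewrite -subr_ge0; apply: H => t /andP[t0 tx].
  rewrite -[X in _ - X]mulr1; apply: is_derive_subf.
by rewrite subr_ge0 leNgt ltr_cos ?in_itv /= -?leNgt //; lra.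
Qed.

(** [1 - cos] also vanishes when [s - t] is a full period, where the Lipschitz bound is of no help.
    But [f] lives in the middle third, so [f s] and [f t] are both zero once [|s - t|] exceeds two
    thirds of the period; below that, [1 - cos x = 2 sin (x / 2) ^ 2] dominates a multiple of
    [(s - t)^2]. *)
Lemma lipschitz_chord_bound f P k : 0 < P -> 0 <= k ->
  (forall s t, 0 <= s <= P -> 0 <= t <= P -> `|f s - f t| <= k * `|s - t|) ->
  (forall t, t < P / 3 -> f t = 0) -> (forall t, 2 * P / 3 < t -> f t = 0) ->
  exists2 M, 0 <= M & forall s t, 0 <= s <= P -> 0 <= t <= P ->
     (f s - f t) ^+ 2 <= M * (1 - cos (2 * pi / P * (s - t))).
Proof.
move=> P0 k0 lip f1 f2.
have c1 := @cos1_gt0 R; have p0 := @pi_gt0 R.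
pose c := (cos 1 / 3 * (pi / P)) ^+ 2 * 2 : R.
have c0 : 0 < c by rewrite mulr_gt0 // exprn_gt0 // mulr_gt0 // divr_gt0.
exists (k ^+ 2 / c); first by rewrite divr_ge0 ?sqr_ge0 // ltW.
have half x : 1 - cos x = 2 * sin (x / 2) ^+ 2.
  have -> : cos x = cos ((x / 2) *+ 2) by congr cos; rewrite -mulr_natl; field.
  by rewrite cos_mulr2n cos2sin2; ring.
move=> s t; wlog ts : s t / t <= s.
  move=> H sP tP; have [ts|st] := leP t s; first exact: H.
  rewrite -sqrrN opprB -(cosN (_ * _)) -mulrN opprB; apply: H => //; exact: ltW.
move=> sI tI; have [/andP[s0 sP] /andP[t0 tP]] := (sI, tI).
have [big|small] := ltP (2 * P / 3) (s - t).
  have -> : f t = 0 by apply: f1; lra.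
  have -> : f s = 0 by apply: f2; lra.
  by rewrite subrr expr0n mulr_ge0 ?subr_ge0 ?cos_le1 // divr_ge0 ?sqr_ge0 // ltW.
have h := lip s t sI tI; rewrite (@ger0_norm _ (s - t)) ?subr_ge0 // in h.
have h2 : (f s - f t) ^+ 2 <= k ^+ 2 * (s - t) ^+ 2.
  by rewrite -exprMn -real_normK ?num_real // ler_sqr ?nnegrE // mulr_ge0 // subr_ge0.
apply: le_trans h2 _; rewrite -mulrA ler_wpM2l ?sqr_ge0 // half ler_pdivlMl //.
set x := _ / 2; have xE : x = pi / P * (s - t) by rewrite /x; field; rewrite gt_eqF.
have x0 : 0 <= x <= 2 * pi / 3.
  rewrite xE; apply/andP; split.
    by rewrite mulr_ge0 ?subr_ge0 // divr_ge0 // ltW.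
  have -> : 2 * pi / 3 = pi / P * (2 * P / 3) :> R by field; rewrite gt_eqF.
  by apply: ler_wpM2l; [rewrite divr_ge0 // ltW|exact: small].
have h3 := sin_ge_lin x0.
have -> : c * (s - t) ^+ 2 = 2 * (cos 1 / 3 * x) ^+ 2 by rewrite /c xE; ring.
rewrite ler_wpM2l // ler_sqr ?nnegrE //; last by apply: le_trans h3; case/andP: x0 => *; rewrite mulr_ge0 // divr_ge0 // ltW.
by case/andP: x0 => *; rewrite mulr_ge0 // divr_ge0 // ltW.
Qed.

End Fejer.

(** * The resolvent estimate in the time domain *)

Section Transforms.
Local Open Scope classical_set_scope.
Local Open Scope ring_scope.
Context {R : realType}.
Implicit Types (f g df : R -> R) (P w k : R).

Lemma lipschitz_of_derive f df k (a b : R) : (forall t : R, is_derive t 1 f (df t)) ->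
  (forall t, a <= t <= b -> `|df t| <= k) ->
  forall s t, a <= s <= b -> a <= t <= b -> `|f s - f t| <= k * `|s - t|.
Proof.
move=> d dk s t; wlog ts : s t / t <= s.
  move=> H sab tab; have [ts|st] := leP t s; first exact: H.
  by rewrite distrC (distrC s); apply: H => //; exact: ltW.
move=> /andP[as_ sb] /andP[at_ tb].
have dk' x : t <= x <= s -> - k <= df x <= k.
  by move=> /andP[tx xs]; rewrite -ler_norml; apply: dk; rewrite (le_trans at_ tx) (le_trans xs).
rewrite (@ger0_norm _ (s - t)) ?subr_ge0 // ler_norml; apply/andP; split.
  have dd (x : R) : is_derive x 1 (fun x => k * x + f x) (k * 1 + df x).
    by apply: is_derive_addf; apply: is_derive_scalef.
  have := @mono_of_derive R _ _ t s ts (fun x _ => dd x) => H.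
  suff : k * t + f t <= k * s + f s by lra.
  by apply: H => x /dk'; lra.
have dd (x : R) : is_derive x 1 (fun x => k * x - f x) (k * 1 - df x).
  by apply: is_derive_subf; apply: is_derive_scalef.
have := @mono_of_derive R _ _ t s ts (fun x _ => dd x) => H.
suff : k * t - f t <= k * s - f s by lra.
by apply: H => x /dk'; lra.
Qed.

Lemma cos_transform_derive f df P w : 0 <= P -> (forall t : R, is_derive t 1 f (df t)) ->
  continuous df -> f 0 = 0 -> f P = 0 -> cos_transform df P w = w * sin_transform f P w.
Proof.
move=> P0 d cdf f0 fP; rewrite /cos_transform /sin_transform.
have c : continuous (fun t : R => - (w * sin (w * t))).
  rewrite (_ : (fun t => _) = fun t => - w * sin (w * t)); last by apply/funext => t; rewrite mulNr.
  by apply: continuous_mulf; [exact: continuous_constf|exact: continuous_sinw].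
rewrite (cintegral_parts P0 cdf c d (is_derive_cosw w) f0 fP).
have cf : continuous f by move=> x; apply: is_derive_cont.
have cs : continuous (fun t => f t * sin (w * t)).
  by apply: continuous_mulf => //; exact: continuous_sinw.
rewrite (_ : (fun t => f t * _) = fun t => - w * (f t * sin (w * t))); last first.
  by apply/funext => t; ring.
by rewrite cintegralZ // mulNr opprK.
Qed.

Lemma sin_transform_derive f df P w : 0 <= P -> (forall t : R, is_derive t 1 f (df t)) ->
  continuous df -> f 0 = 0 -> f P = 0 -> sin_transform df P w = - (w * cos_transform f P w).
Proof.
move=> P0 d cdf f0 fP; rewrite /cos_transform /sin_transform.
have c : continuous (fun t : R => w * cos (w * t)).
  by apply: continuous_mulf; [exact: continuous_constf|exact: continuous_cosw].
rewrite (cintegral_parts P0 cdf c d (is_derive_sinw w) f0 fP).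
have cf : continuous f by move=> x; apply: is_derive_cont.
have cs : continuous (fun t => f t * cos (w * t)).
  by apply: continuous_mulf => //; exact: continuous_cosw.
rewrite (_ : (fun t => f t * _) = fun t => w * (f t * cos (w * t))); last first.
  by apply/funext => t; ring.
by rewrite cintegralZ.
Qed.

Section Shift.
Variables (f : R -> R) (P tau w : R).
Hypothesis cf : continuous f.
Hypothesis tau_ge0 : 0 <= tau.
Hypothesis P_ge0 : 0 <= P.
Hypothesis f_left : forall t, t <= 0 -> f t = 0.
Hypothesis f_right : forall t, P - tau <= t -> f t = 0.

Let cintegral_shift_supp (g : R -> R) : continuous g ->
  cintegral (fun t => f (t - tau) * g t) 0 P = cintegral (fun t => f t * g (t + tau)) 0 P.
Proof.
move=> cg; pose h t := f t * g (t + tau).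
have ch : continuous h.
  apply: continuous_mulf => //.
  by have := @continuous_arg_shift R g (- tau) cg; under eq_fun do rewrite opprK.
have -> : (fun t => f (t - tau) * g t) = fun t => h (t - tau).
  by apply/funext => t; rewrite /h subrK.
rewrite cintegral_arg_shift // -(cintegral_cat _ (0 - tau) 0) -[RHS](cintegral_cat _ 0 (P - tau)).
have -> : cintegral h (0 - tau) 0 = 0.
  by apply: cintegral_eq0 => //; [by rewrite sub0r oppr_le0|move=> x /andP[_ x0]; rewrite /h f_left // mul0r].
have -> : cintegral h (P - tau) P = 0.
  by apply: cintegral_eq0 => //; [by rewrite gerBl|move=> x /andP[x0 _]; rewrite /h f_right // mul0r].
by rewrite add0r addr0.
Qed.

Let cc : continuous (fun t => f t * cos (w * t)).
Proof. by apply: continuous_mulf => //; exact: continuous_cosw. Qed.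
Let cs : continuous (fun t => f t * sin (w * t)).
Proof. by apply: continuous_mulf => //; exact: continuous_sinw. Qed.
Let cZ c (g : R -> R) : continuous g -> continuous (fun t => c * g t).
Proof. by move=> cg; apply: continuous_mulf => //; exact: continuous_constf. Qed.

Lemma cos_transform_shift : cos_transform (fun t => f (t - tau)) P w =
  cos (tau * w) * cos_transform f P w - sin (tau * w) * sin_transform f P w.
Proof.
rewrite /cos_transform cintegral_shift_supp; last exact: continuous_cosw.
rewrite /sin_transform -!cintegralZ // -cintegralB //; try exact: cZ.
by congr cintegral; apply/funext => t; rewrite mulrDr cosD (mulrC w tau); ring.
Qed.

Lemma sin_transform_shift : sin_transform (fun t => f (t - tau)) P w =
  cos (tau * w) * sin_transform f P w + sin (tau * w) * cos_transform f P w.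
Proof.
rewrite /sin_transform cintegral_shift_supp; last exact: continuous_sinw.
rewrite /cos_transform -!cintegralZ // -cintegralD //; try exact: cZ.
by congr cintegral; apply/funext => t; rewrite mulrDr sinD (mulrC w tau); ring.
Qed.

End Shift.

Lemma trig_integralD (tr : R -> R) f g P w : continuous tr -> continuous f -> continuous g -> 0 <= P ->
  cintegral (fun t => (f t + g t) * tr (w * t)) 0 P =
  cintegral (fun t => f t * tr (w * t)) 0 P + cintegral (fun t => g t * tr (w * t)) 0 P.
Proof.
move=> ct cf cg P0; rewrite -cintegralD //; try by apply: continuous_mulf => //; exact: continuous_arg_scale.
by congr cintegral; apply/funext => t; rewrite mulrDl.
Qed.

Lemma trig_integralZ (tr : R -> R) c f P w : continuous tr -> continuous f -> 0 <= P ->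
  cintegral (fun t => (c * f t) * tr (w * t)) 0 P = c * cintegral (fun t => f t * tr (w * t)) 0 P.
Proof.
move=> ct cf P0; rewrite -cintegralZ //; last by apply: continuous_mulf => //; exact: continuous_arg_scale.
by congr cintegral; apply/funext => t; rewrite mulrA.
Qed.

Lemma trig_integral_sum (tr : R -> R) n (f : 'I_n -> R -> R) P w : continuous tr ->
  (forall i, continuous (f i)) -> 0 <= P ->
  cintegral (fun t => (\sum_i f i t) * tr (w * t)) 0 P = \sum_i cintegral (fun t => f i t * tr (w * t)) 0 P.
Proof.
move=> ct cf P0; rewrite -cintegral_sum //; last first.
  by move=> i; apply: continuous_mulf => //; exact: continuous_arg_scale.
by congr cintegral; apply/funext => t; rewrite mulr_suml.
Qed.

End Transforms.

Section Resolvent.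
Local Open Scope classical_set_scope.
Local Open Scope ring_scope.
Context {R : realType} {n : nat}.
Variables (a tau : 'I_n -> 'I_n -> R) (C : R).
Hypothesis tau_ge0 : forall i j, 0 <= tau i j.
Hypothesis C_gt0 : 0 < C.
Hypothesis symbol_bound : forall s w P Q, 0 <= s ->
  \sum_i P i = 0 -> \sum_i Q i = 0 ->
  \sum_i P i ^+ 2 + \sum_i Q i ^+ 2 <=
    C * (\sum_i symbol_re a tau s w P Q i ^+ 2 + \sum_i symbol_im a tau s w P Q i ^+ 2).

Definition delay_op s (z : 'I_n -> R -> R) i t : R :=
  \sum_j a i j * expR (- (tau i j * s)) * (z i (t - tau i j) - z j (t - tau i j)).

Lemma continuous_delay_op s z i : (forall i, continuous (z i)) -> continuous (delay_op s z i).
Proof.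
move=> cz; apply: continuous_sumf => j; apply: continuous_mulf; first exact: continuous_constf.
by apply: continuous_subf; exact: continuous_arg_shift.
Qed.

Section Centered.
Variables (s P : R) (z dz : 'I_n -> R -> R).
Hypothesis s_ge0 : 0 <= s.
Hypothesis P_gt0 : 0 < P.
Hypothesis tau_le : forall i j, tau i j <= P / 3.
Hypothesis z_derive : forall i (t : R), is_derive t 1 (z i) (dz i t).
Hypothesis dz_cont : forall i, continuous (dz i).
Hypothesis z_sum : forall t, \sum_i z i t = 0.
Hypothesis z_left : forall i t, t <= P / 3 -> z i t = 0.
Hypothesis z_right : forall i t, 2 * P / 3 <= t -> z i t = 0.

Let z_cont i : continuous (z i). Proof. by move=> t; exact: is_derive_cont (z_derive i t). Qed.

Let F i t := dz i t + s * z i t + delay_op s z i t.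

Let P_ge0 : 0 <= P. Proof. exact: ltW. Qed.

Let F_cont i : continuous (F i).
Proof.
apply: continuous_addf; last exact: continuous_delay_op.
by apply: continuous_addf => //; apply: continuous_mulf => //; exact: continuous_constf.
Qed.

(** Derivative and delays become multipliers because [z] leaves a third of the period free on each
    side: no boundary term appears and no delay wraps around. *)
Let cos_transform_F w i : cos_transform (F i) P w =
  symbol_re a tau s w (fun i => cos_transform (z i) P w) (fun i => sin_transform (z i) P w) i.
Proof.
have P0 := P_gt0; have zc j c : continuous (fun t => z j (t - c)) by exact: continuous_arg_shift.
have sz : continuous (fun t => s * z i t).
  by apply: continuous_mulf => //; exact: continuous_constf.
have cc := @continuous_cos R.
rewrite /cos_transform /F !trig_integralD //; last 2 first.
- exact: continuous_addf.
- exact: continuous_delay_op.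
rewrite /symbol_re; congr (_ + _ + _).
- by apply: cos_transform_derive => //; [apply: z_left|apply: z_right]; lra.
- by rewrite trig_integralZ.
rewrite /delay_op trig_integral_sum //; last first.
  move=> j; apply: continuous_mulf; [exact: continuous_constf|exact: continuous_subf].
apply: eq_bigr => j _; rewrite trig_integralZ //; last exact: continuous_subf.
congr (_ * _).
have -> : (fun t => (z i (t - tau i j) - z j (t - tau i j)) * cos (w * t)) =
  fun t => ((z i (t - tau i j)) + (-1) * z j (t - tau i j)) * cos (w * t).
  by apply/funext => t; ring.
rewrite trig_integralD //; last by apply: continuous_mulf => //; exact: continuous_constf.
rewrite trig_integralZ // -![cintegral _ 0 P]/(cos_transform _ P w) !cos_transform_shift //;
  try by move=> t tt; first [apply: z_left; lra|apply: z_right; have := tau_le i j; lra].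
ring.
Qed.

Let sin_transform_F w i : sin_transform (F i) P w =
  symbol_im a tau s w (fun i => cos_transform (z i) P w) (fun i => sin_transform (z i) P w) i.
Proof.
have P0 := P_gt0; have zc j c : continuous (fun t => z j (t - c)) by exact: continuous_arg_shift.
have sz : continuous (fun t => s * z i t).
  by apply: continuous_mulf => //; exact: continuous_constf.
have cc := @continuous_sin R.
rewrite /sin_transform /F !trig_integralD //; last 2 first.
- exact: continuous_addf.
- exact: continuous_delay_op.
rewrite /symbol_im; congr (_ + _ + _).
- by apply: sin_transform_derive => //; [apply: z_left|apply: z_right]; lra.
- by rewrite trig_integralZ.
rewrite /delay_op trig_integral_sum //; last first.
  move=> j; apply: continuous_mulf; [exact: continuous_constf|exact: continuous_subf].
apply: eq_bigr => j _; rewrite trig_integralZ //; last exact: continuous_subf.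
congr (_ * _).
have -> : (fun t => (z i (t - tau i j) - z j (t - tau i j)) * sin (w * t)) =
  fun t => ((z i (t - tau i j)) + (-1) * z j (t - tau i j)) * sin (w * t).
  by apply/funext => t; ring.
rewrite trig_integralD //; last by apply: continuous_mulf => //; exact: continuous_constf.
rewrite trig_integralZ // -![cintegral _ 0 P]/(sin_transform _ P w) !sin_transform_shift //;
  try by move=> t tt; first [apply: z_left; lra|apply: z_right; have := tau_le i j; lra].
ring.
Qed.

Let sum_transform0 (tr : R -> R) w : continuous tr ->
  \sum_i cintegral (fun t => z i t * tr (w * t)) 0 P = 0.
Proof.
move=> ct; rewrite -trig_integral_sum //.
under [X in cintegral X]eq_fun do rewrite z_sum mul0r.
by rewrite cintegral_const // mul0r.
Qed.

Let chord i : exists2 M, 0 <= M & forall s t, 0 <= s <= P -> 0 <= t <= P ->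
     (z i s - z i t) ^+ 2 <= M * (1 - cos (2 * pi / P * (s - t))).
Proof.
have P0 := P_gt0; have cn : continuous (fun t => `|dz i t|).
  by move=> t; apply: cvg_norm; exact: dz_cont.
have [k kP kmax] := EVT_max P_ge0 (continuous_subspaceT cn).
apply: (@lipschitz_chord_bound R (z i) P `|dz i k|) => //.
- apply: (lipschitz_of_derive (z_derive i)) => t tP; apply: kmax.
  by rewrite in_itv.
- by move=> t t1; apply: z_left; lra.
- by move=> t t1; apply: z_right; lra.
Qed.

(** The symbol estimate is summed over all pairs of harmonics below [N]. The chord bound limits the
    loss in Parseval's identity to [K], independent of [N], so comparing the terms linear in [N]
    gives the claim. *)
Lemma resolvent_centered :
  \sum_i cintegral (fun t => z i t ^+ 2) 0 P <=
  C * \sum_i cintegral (fun t => (dz i t + s * z i t + delay_op s z i t) ^+ 2) 0 P.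
Proof.
have [M M0 HM] : exists2 M : 'I_n -> R, (forall i, 0 <= M i) & forall i s t, 0 <= s <= P -> 0 <= t <= P ->
     (z i s - z i t) ^+ 2 <= M i * (1 - cos (2 * pi / P * (s - t))).
  have [M HM] := choice (fun i => let: ex_intro2 M h1 h2 := chord i in ex_intro
    (fun M => 0 <= M /\ forall s t, 0 <= s <= P -> 0 <= t <= P ->
     (z i s - z i t) ^+ 2 <= M * (1 - cos (2 * pi / P * (s - t)))) M (conj h1 h2)).
  by exists M => [i|i]; case: (HM i).
set X := \sum_i cintegral _ 0 P; set Y := \sum_i cintegral (fun t => _ ^+ 2) 0 P.
pose K := (\sum_i M i) * P ^+ 2.
have K0 : 0 <= K by rewrite mulr_ge0 ?sqr_ge0 //; apply: sumr_ge0.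
have main (N : nat) : N%:R * P * X - K <= C * (N%:R * P * Y).
  pose S (f : 'I_n -> R -> R) : R := \sum_(q < N) \sum_(q' < N) \sum_(i < n)
     (cos_transform (f i) P (harmonic_freq P q q') ^+ 2 + sin_transform (f i) P (harmonic_freq P q q') ^+ 2).
  have SE (f : 'I_n -> R -> R) : S f = \sum_(i < n) \sum_(q < N) \sum_(q' < N)
     (cos_transform (f i) P (harmonic_freq P q q') ^+ 2 + sin_transform (f i) P (harmonic_freq P q q') ^+ 2).
    by rewrite /S; under eq_bigr do rewrite exchange_big; rewrite exchange_big.
  have h1 : N%:R * P * X - K <= S z.
    rewrite SE /X /K mulr_sumr mulr_suml -sumrB; apply: ler_sum => i _ /=.
    exact: fejer_parseval (HM i).
  have h2 : S z <= C * S F.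
    rewrite /S mulr_sumr; apply: ler_sum => q _; rewrite mulr_sumr; apply: ler_sum => q' _.
    rewrite !big_split /=; under [X in _ <= _ * (X + _)]eq_bigr do rewrite cos_transform_F.
    under [X in _ <= _ * (_ + X)]eq_bigr do rewrite sin_transform_F.
    apply: symbol_bound => //; apply: sum_transform0.
      exact: continuous_cos.
    exact: continuous_sin.
  apply: (le_trans h1); apply: (le_trans h2); rewrite ler_pM2l // SE /Y mulr_sumr.
  by apply: ler_sum => i _; exact: fejer_bessel.
rewrite leNgt; apply/negP => XY.
have D : 0 < P * (X - C * Y) by rewrite mulr_gt0 // subr_gt0.
have [N] : exists N : nat, K < N%:R * (P * (X - C * Y)).
  exists (Num.truncn (K / (P * (X - C * Y)))).+1.
  by rewrite -ltr_pdivrMr // truncnS_gt.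
by have := main N; lra.
Qed.

End Centered.

(* The signal is moved to the middle third of the period, so that delays do not wrap around. *)
Lemma resolvent_estimate s T (z dz : 'I_n -> R -> R) : 0 <= s -> 0 < T ->
  (forall i j, tau i j <= T) ->
  (forall i (t : R), is_derive t 1 (z i) (dz i t)) ->
  (forall i, continuous (dz i)) ->
  (forall t, \sum_i z i t = 0) ->
  (forall i t, t <= 0 -> z i t = 0) -> (forall i t, T <= t -> z i t = 0) ->
  \sum_i cintegral (fun t => z i t ^+ 2) (- T) (2 * T) <=
  C * \sum_i cintegral (fun t => (dz i t + s * z i t + delay_op s z i t) ^+ 2) (- T) (2 * T).
Proof.
move=> s0 T0 tT d cd zs zl zr; have P0 : 0 < 3 * T by lra.
have cz i : continuous (z i) by move=> t; exact: is_derive_cont (d i t).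
have E1 : 3 * T / 3 = T by field.
have E2 : 2 * (3 * T) / 3 = 2 * T by field.
have := @resolvent_centered s (3 * T) (fun i t => z i (t - T)) (fun i t => dz i (t - T)) s0 P0.
rewrite E1 E2 => /(_ tT) H.
have sh (g : R -> R) : continuous g -> cintegral (fun t => g (t - T)) 0 (3 * T) = cintegral g (- T) (2 * T).
  by move=> cg; rewrite cintegral_arg_shift ?ltW // sub0r; congr cintegral; lra.
have cF i : continuous (fun t => (dz i t + s * z i t + delay_op s z i t) ^+ 2).
  apply: continuous_sqrf; apply: continuous_addf; last exact: continuous_delay_op.
  by apply: continuous_addf => //; apply: continuous_mulf => //; exact: continuous_constf.
have e1 : \sum_i cintegral (fun t => z i t ^+ 2) (- T) (2 * T) =
   \sum_i cintegral (fun t => z i (t - T) ^+ 2) 0 (3 * T).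
  by apply: eq_bigr => i _; rewrite -sh //; exact: continuous_sqrf.
rewrite e1; apply: le_trans (H _ _ _ _ _) _.
- by move=> i t; apply: is_derive_arg_shift.
- by move=> i; exact: continuous_arg_shift.
- by move=> t; exact: zs.
- by move=> i t tT'; apply: zl; lra.
- by move=> i t tT'; apply: zr; lra.
rewrite ler_pM2l // le_eqVlt; apply/orP; left; apply/eqP; apply: eq_bigr => i _.
rewrite -sh //; congr cintegral; apply/funext => t; congr (_ ^+ 2); congr (_ + _).
apply: eq_bigr => j _; congr (_ * (z _ _ - z _ _)); lra.
Qed.

End Resolvent.

(** * Exponential dichotomy *)

Section Tools.
Local Open Scope classical_set_scope.
Local Open Scope ring_scope.
Context {R : realType}.
Implicit Types (t s T : R).

Lemma bernoulli_le (x : R) k : 0 <= x -> 1 + k%:R * x <= (1 + x) ^+ k.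
Proof.
move=> x0; elim: k => [|k IH]; first by rewrite mul0r addr0 expr0.
rewrite exprS -natr1.
have k0 : 0 <= k%:R :> R by exact: ler0n.
apply: le_trans (_ : (1 + x) * (1 + k%:R * x) <= _); last by rewrite ler_wpM2l //; lra.
have : 0 <= k%:R * x * x by rewrite !mulr_ge0.
lra.
Qed.

Lemma sqr_sum_le m (y : 'I_m -> R) : (\sum_i y i) ^+ 2 <= m%:R * \sum_i y i ^+ 2.
Proof.
rewrite expr2 mulr_suml.
apply: (@le_trans _ _ (\sum_i \sum_j 2^-1 * (y i ^+ 2 + y j ^+ 2))).
  apply: ler_sum => i _; rewrite mulr_sumr; apply: ler_sum => j _.
  have := sqr_ge0 (y i - y j); lra.
set S := \sum_i y i ^+ 2.
have h i : \sum_j 2^-1 * (y i ^+ 2 + y j ^+ 2) = 2^-1 * (m%:R * y i ^+ 2 + S).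
  by rewrite -mulr_sumr big_split /= sumr_const card_ord -[_ *+ m]mulr_natl.
under eq_bigr do rewrite h.
rewrite -mulr_sumr big_split /= -mulr_sumr -/S sumr_const card_ord -[S *+ m]mulr_natl; lra.
Qed.

(** If [Phi S] exceeded [C0], each step of length [l] would multiply the excess by at least
    [1 + C1^-1], faster than the allowed factor [q]. *)
Lemma no_slow_growth (Phi : R -> R) (C0 C1 B l q S0 S : R) :
  0 < C1 -> 0 <= l -> 1 <= q -> q < 1 + C1^-1 -> 0 <= S0 -> S0 <= S ->
  (forall T, S0 <= T -> Phi T <= C0 + C1 * (Phi (T + l) - Phi T)) ->
  (forall k : nat, Phi (S + k%:R * l) <= B * q ^+ k) ->
  Phi S <= C0.
Proof.
move=> C10 l0 q1 qr S00 SS step growth; rewrite leNgt; apply/negP => PhiS.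
set r := 1 + C1^-1 in qr; set D := Phi S - C0.
have D0 : 0 < D by rewrite subr_gt0.
have r0 : 0 < r by lra.
have low k : r ^+ k * D <= Phi (S + k%:R * l) - C0.
  elim: k => [|k IH]; first by rewrite expr0 mul1r mul0r addr0.
  have kl : 0 <= k%:R * l by rewrite mulr_ge0.
  have := step (S + k%:R * l) ltac:(lra) => h.
  have -> : S + k.+1%:R * l = S + k%:R * l + l by rewrite -natr1; ring.
  rewrite exprS -mulrA; apply: (@le_trans _ _ (r * (Phi (S + k%:R * l) - C0))).
    by rewrite ler_wpM2l // ltW.
  move: h; set X := Phi _; set Y := Phi _ => h.
  have : C1^-1 * (X - C0) <= Y - X by rewrite ler_pdivrMl //; lra.
  by rewrite /r; lra.
have q0 : 0 < q by lra.
pose x := r / q - 1.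
have x0 : 0 < x by rewrite /x subr_gt0 ltr_pdivlMr // mul1r.
(* Relative to [q ^+ k] the excess still grows like [(r / q)^k], which by Bernoulli's inequality is
   at least linear in [k]. *)
have bd k : (1 + k%:R * x) * D <= B + `|C0|.
  have qk : 1 <= q ^+ k by exact: exprn_ege1.
  have qk0 : 0 < q ^+ k by lra.
  apply: (@le_trans _ _ ((1 + x) ^+ k * D)).
    by rewrite ler_pM2r //; apply: bernoulli_le; exact: ltW.
  have -> : 1 + x = r / q by rewrite /x; ring.
  rewrite expr_div_n mulrAC ler_pdivrMr // mulrDl.
  have h1 := low k; have h2 := growth k.
  have h3 : - C0 <= `|C0| by rewrite -normrN ler_norm.
  have h4 : `|C0| <= `|C0| * q ^+ k by rewrite ler_peMr.
  lra.
pose N := (Num.truncn ((B + `|C0|) / (x * D))).+1.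
have : B + `|C0| < N%:R * (x * D) by rewrite -ltr_pdivrMr ?mulr_gt0 // truncnS_gt.
by have := bd N; lra.
Qed.

(** On [0, 1] this is [3 t^2 - 2 t^3]. Integrating its derivative [6 t (1 - t)], extended by zero,
    yields a C^1 function on the whole line without gluing; [3 / 2] is the maximal slope. *)
Lemma smoothstep : exists chi dchi : R -> R, exists D : R,
  [/\ (forall t : R, is_derive t 1 chi (dchi t)), continuous dchi,
      (forall t, 0 <= chi t <= 1),
      (forall t, t <= 0 -> chi t = 0) & (forall t, 1 <= t -> chi t = 1)] /\
  [/\ 0 <= D, (forall t, t <= 0 -> dchi t = 0), (forall t, 1 <= t -> dchi t = 0) &
      (forall t, `|dchi t| <= D)].
Proof.
pose d t : R := 6 * Num.max 0 (t * (1 - t)).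
have cid : continuous (fun t : R => t) by move=> t; exact: cvg_id.
have cp : continuous (fun t : R => t * (1 - t)).
  apply: continuous_mulf => //; apply: continuous_subf => //; exact: continuous_constf.
have cd : continuous d.
  apply: continuous_mulf; first exact: continuous_constf.
  move=> t; exact: (@continuous_max R R (fun=> 0) (fun t => t * (1 - t)) t (@cvg_cst _ _ _ _ _) (cp t)).
have d0 t : 0 <= d t by rewrite mulr_ge0 // le_max lexx.
have dl t : t <= 0 -> d t = 0.
  move=> t0; rewrite /d max_l ?mulr0 //; nra.
have dr t : 1 <= t -> d t = 0.
  move=> t0; rewrite /d max_l ?mulr0 //; nra.
have d_mass : cintegral d 0 1 = 1.
  pose p (t : R) : R := 3 * (t * t) - 2 * (t * (t * t)).
  have dp (t : R) : is_derive t 1 p (6 * (t * (1 - t))).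
    have i := is_derive_idf t; have i2 := is_derive_mulf i i.
    have i3 := is_derive_mulf i i2.
    have := is_derive_subf (is_derive_scalef 3 i2) (is_derive_scalef 2 i3).
    congr is_derive; ring.
  rewrite (_ : 1 = p 1 - p 0); last by rewrite /p; ring.
  rewrite (_ : cintegral d 0 (p 1 - p 0) = cintegral d 0 1); last by congr cintegral; rewrite /p; ring.
  have dp' t : 0 <= t <= 1 -> is_derive t 1 p (d t).
    by move=> t01; rewrite /d max_r //; nra.
  exact: (cintegralE cd ler01 dp').
have mono a b : a <= b -> cintegral d 0 a <= cintegral d 0 b.
  by move=> ab; rewrite -(cintegral_cat d 0 a b) lerDl cintegral_ge0.
have Jl t : t <= 0 -> cintegral d 0 t = 0.
  move=> t0; have := cintegral_cat d t 0 t; rewrite cintegral_xx => E.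
  have : cintegral d t 0 = 0 by apply: cintegral_eq0 => // x /andP[_ x0]; exact: dl.
  by lra.
have Jr t : 1 <= t -> cintegral d 0 t = 1.
  move=> t1; rewrite -(cintegral_cat d 0 1 t) d_mass cintegral_eq0 ?addr0 // => x /andP[x1 _]; exact: dr.
exists (cintegral d 0), d, (3 / 2); split; split => //.
- by move=> t; exact: cintegral_derive.
- move=> t; apply/andP; split.
    by have [t0|t0] := leP t 0; [rewrite Jl|have := mono 0 t (ltW t0); rewrite cintegral_xx].
  by have [t0|t0] := leP 1 t; [rewrite Jr|have := mono t 1 (ltW t0); rewrite d_mass].
- move=> t; rewrite ger0_norm // /d.
  have : Num.max 0 (t * (1 - t)) <= 1 / 4 by rewrite ge_max; have := sqr_ge0 (t - 1 / 2); lra.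
  lra.
Qed.

(** The derivative of [g^2] is at most [g^2 + dg^2] in modulus. Once the tail of that integral is at
    most [e^2 / 2], [g t ^+ 2] exceeds the mean of [g^2] over [[t, t + 1]] by at most [e^2 / 2], and
    this mean is itself at most [e^2 / 2]. *)
Lemma sqr_integrable_vanish (g dg : R -> R) B : (forall t : R, is_derive t 1 g (dg t)) ->
  continuous dg ->
  (forall T, 0 <= T -> cintegral (fun t => g t ^+ 2 + dg t ^+ 2) 0 T <= B) ->
  forall e, 0 < e -> exists S, forall t, S <= t -> `|g t| <= e.
Proof.
move=> d cd bd e e0.
have cg : continuous g by move=> t; exact: is_derive_cont (d t).
have cg2 := continuous_sqrf cg; have cd2 := continuous_sqrf cd.
set h := (fun t => g t ^+ 2 + dg t ^+ 2) in bd.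
have ch : continuous h by exact: continuous_addf.
have h0 t : 0 <= h t by rewrite addr_ge0 ?sqr_ge0.
have e2 : 0 < e ^+ 2 / 2 by rewrite divr_gt0 // exprn_gt0.
pose A := [set x | exists2 T, 0 <= T & x = cintegral h 0 T].
have A0 : A !=set0 by exists (cintegral h 0 0), 0.
have supA : has_sup A by split => //; exists B => x [T T0 ->]; exact: bd.
have [_ [S S0 ->] Sx] := sup_adherent e2 supA.
exists S => t St.
have tail u v : S <= u -> u <= v -> cintegral h u v <= e ^+ 2 / 2.
  move=> Su uv; have : cintegral h 0 v <= sup A.
    by apply: (ub_le_sup supA.2); exists v => //; lra.
  have := cintegral_cat h 0 u v.
  have : cintegral h 0 S <= cintegral h 0 u by apply: cintegral_itv_le.
  lra.
have pt u : t <= u -> g t ^+ 2 <= g u ^+ 2 + e ^+ 2 / 2.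
  move=> tu.
  have dgu (x : R) : is_derive x 1 (fun x => g x * g x + cintegral h t x) (g x * dg x + g x * dg x + h x).
    exact: (is_derive_addf (is_derive_mulf (d x) (d x)) (@cintegral_derive R h t x ch)).
  have := @mono_of_derive R _ _ t u tu (fun x _ => dgu x) => H.
  have : g t * g t + cintegral h t t <= g u * g u + cintegral h t u.
    apply: H => x _; have := sqr_ge0 (g x + dg x); rewrite /h; lra.
  by rewrite cintegral_xx addr0 -!expr2; have := tail t u St tu; lra.
have t1 : t <= t + 1 by lra.
have : cintegral (fun=> g t ^+ 2) t (t + 1) <= cintegral (fun u => g u ^+ 2 + e ^+ 2 / 2) t (t + 1).
  apply: le_cintegral => //; first exact: continuous_constf.
    by apply: continuous_addf => //; exact: continuous_constf.
  by move=> u /andP[tu _]; exact: pt.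
rewrite cintegralD ?cintegral_const //; last exact: continuous_constf.
have : cintegral (fun t => g t ^+ 2) t (t + 1) <= cintegral h t (t + 1).
  by apply: le_cintegral => // u _; rewrite lerDl sqr_ge0.
have := tail t (t + 1) St t1 => h1 h2 h3.
rewrite -ler_sqr ?nnegrE ?(ltW e0) // real_normK ?num_real //; lra.
Qed.

End Tools.

(** * Cutting off the weighted signal at a finite time *)

Section Decay.
Local Open Scope classical_set_scope.
Local Open Scope ring_scope.
Context {R : realType} {n : nat}.
Variables (a tau : 'I_n -> 'I_n -> R) (C tm : R).
Hypothesis tau_ge0 : forall i j, 0 <= tau i j.
Hypothesis tau_le : forall i j, tau i j <= tm.
Hypothesis tm_ge0 : 0 <= tm.
Hypothesis C_gt0 : 0 < C.
Hypothesis symbol_bound : forall s w P Q, 0 <= s ->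
  \sum_i P i = 0 -> \sum_i Q i = 0 ->
  \sum_i P i ^+ 2 + \sum_i Q i ^+ 2 <=
    C * (\sum_i symbol_re a tau s w P Q i ^+ 2 + \sum_i symbol_im a tau s w P Q i ^+ 2).

Variables (z dz : 'I_n -> R -> R) (T0 : R).
Hypothesis z_derive : forall i (t : R), is_derive t 1 (z i) (dz i t).
Hypothesis dz_cont : forall i, continuous (dz i).
Hypothesis z_sum : forall t, \sum_i z i t = 0.
Hypothesis z_left : forall i t, t <= 0 -> z i t = 0.
Hypothesis dz_left : forall i t, t <= 0 -> dz i t = 0.
Hypothesis T0_ge0 : 0 <= T0.

Let force i t := dz i t + delay_op a tau 0 z i t.
Hypothesis force_right : forall i t, T0 <= t -> force i t = 0.

Let z_cont i : continuous (z i). Proof. by move=> t; exact: is_derive_cont (z_derive i t). Qed.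
Let ex s t : R := expR (- (s * t)).
Let w s i t := ex s t * z i t.
Definition weighted_energy s T : R := \sum_i cintegral (fun t => w s i t ^+ 2) 0 T.

Let ex_derive s (t : R) : is_derive t 1 (ex s) (- s * ex s t).
Proof.
rewrite (_ : ex s = fun t => expR (- s * t)); last first.
  by apply/funext => x; rewrite /ex mulNr.
exact: is_derive_arg_scale (is_derive_expR _).
Qed.

Let ex_cont s : continuous (ex s).
Proof. by move=> t; exact: is_derive_cont (ex_derive s t). Qed.

Let w_cont s i : continuous (w s i).
Proof. exact: continuous_mulf. Qed.

Let cZ c (g : R -> R) : continuous g -> continuous (fun t => c * g t).
Proof. by move=> cg; apply: continuous_mulf => //; exact: continuous_constf. Qed.

Let force_cont i : continuous (force i).
Proof. by apply: continuous_addf => //; exact: continuous_delay_op. Qed.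

Let force_left i t : t <= 0 -> force i t = 0.
Proof.
move=> t0; rewrite /force dz_left // add0r /delay_op big1 // => j _.
have t1 : t - tau i j <= 0 by rewrite subr_le0 (le_trans t0).
by rewrite !z_left // subrr mulr0.
Qed.

Let delay_op_w s i t : delay_op a tau s (w s) i t = ex s t * delay_op a tau 0 z i t.
Proof.
rewrite /delay_op mulr_sumr; apply: eq_bigr => j _; rewrite mulr0 oppr0 expR0 mulr1.
rewrite /w /ex; have -> : - (s * t) = - (tau i j * s) + - (s * (t - tau i j)) by ring.
by rewrite expRD; ring.
Qed.

(* What the equation with rate [s] returns for the signal [z] weighted by [exp (- s t)] and
   multiplied by [chi]: away from the support of [force], only the commutator of [chi] with
   the derivative and with the delays is left. *)
Let cut_op s (chi dchi : R -> R) i t : R :=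
  dchi t * w s i t + chi t * (ex s t * force i t) +
  \sum_j a i j * expR (- (tau i j * s)) *
    ((chi (t - tau i j) - chi t) * (w s i (t - tau i j) - w s j (t - tau i j))).

Let cut_opE s chi dchi i t :
  (dchi t * w s i t + chi t * (- s * w s i t + ex s t * dz i t))
  + s * (chi t * w s i t) + delay_op a tau s (fun i t => chi t * w s i t) i t =
  cut_op s chi dchi i t.
Proof.
rewrite /cut_op.
have -> : \sum_j a i j * expR (- (tau i j * s)) *
    ((chi (t - tau i j) - chi t) * (w s i (t - tau i j) - w s j (t - tau i j))) =
  delay_op a tau s (fun i t => chi t * w s i t) i t - chi t * delay_op a tau s (w s) i t.
  by rewrite /delay_op mulr_sumr -sumrB; apply: eq_bigr => j _; ring.
by rewrite delay_op_w /force /w; ring.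
Qed.

Let alpha := \sum_i \sum_j `|a i j|.
Let a_le i j : `|a i j| <= alpha.
Proof.
rewrite /alpha (bigD1 i) //= (bigD1 j) //= -addrA lerDl addr_ge0 //.
  by apply: sumr_ge0.
by apply: sumr_ge0 => k _; apply: sumr_ge0.
Qed.
Let alpha_ge0 : 0 <= alpha.
Proof. by apply: sumr_ge0 => i _; apply: sumr_ge0. Qed.

Let b_sqr s i j : 0 <= s -> (a i j * expR (- (tau i j * s))) ^+ 2 <= alpha ^+ 2.
Proof.
move=> s0; rewrite -[leLHS]real_normK ?num_real // ler_sqr ?nnegrE //.
rewrite normrM; apply: le_trans (a_le i j); rewrite ler_piMr //.
rewrite ger0_norm ?expR_ge0 // -expR0 ler_expR oppr_le0 mulr_ge0 //.
Qed.

Let delay_sqr s (x y : 'I_n -> 'I_n -> R) i : 0 <= s ->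
  (\sum_j a i j * expR (- (tau i j * s)) * (x i j - y i j)) ^+ 2 <=
  2 * n%:R * alpha ^+ 2 * \sum_j (x i j ^+ 2 + y i j ^+ 2).
Proof.
move=> s0; apply: le_trans (sqr_sum_le _) _.
have n0 : 0 <= n%:R :> R by [].
have -> : 2 * n%:R * alpha ^+ 2 * \sum_j (x i j ^+ 2 + y i j ^+ 2) =
  n%:R * \sum_j alpha ^+ 2 * (2 * (x i j ^+ 2 + y i j ^+ 2)).
  by rewrite -mulr_sumr -mulr_sumr; ring.
rewrite ler_wpM2l //; apply: ler_sum => j _; rewrite exprMn; apply: ler_pM; rewrite ?sqr_ge0 ?b_sqr //.
by have := sqr_ge0 (x i j + y i j); lra.
Qed.

(* [C1] is independent of [s]: by [no_slow_growth], an unbounded weighted energy then grows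
   at an exponential rate that does not depend on [s]. *)
Lemma cutoff_estimate : exists2 C1, 0 < C1 & forall s, 0 <= s -> exists C0,
  forall T, T0 <= T -> weighted_energy s T <=
   C0 + C1 * (weighted_energy s (T + 1) - weighted_energy s (T - tm)).
Proof.
have [chi0 [dchi0 [D [[dch cdch ch01 chl chr] [D0 dl dr dD]]]]] := @smoothstep R.
(* [2 D^2] pays for the slope of the cutoff; the delays cost [4 n alpha^2 (e i + e j)] per ordered
   pair of nodes, in total [8 n^2 alpha^2] times the energy of the window. *)
pose k := 2 * D ^+ 2 + 8 * (n%:R ^+ 2) * alpha ^+ 2 + 1.
have n0 : 0 <= n%:R :> R by [].
have k0 : 0 < k.
  have h1 := sqr_ge0 D; have h2 : 0 <= 8 * n%:R ^+ 2 * alpha ^+ 2 by rewrite !mulr_ge0 // sqr_ge0.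
  by rewrite /k; lra.
exists (C * k); first exact: mulr_gt0.
move=> s s0.
exists (C * \sum_i cintegral (fun t => (ex s t * force i t) ^+ 2) 0 T0) => T T0T.
have T00 := T0_ge0; have tm0 := tm_ge0.
(* One third of the period: it contains the support of the cut signal and is at least as long as
   every delay. *)
pose X := T + 1 + tm; have X0 : 0 < X by rewrite /X; lra.
pose chi t := chi0 (T + 1 - t); pose dchi t := - dchi0 (T + 1 - t).
have chi_derive (t : R) : is_derive t 1 chi (dchi t) by exact: is_derive_arg_reflect (dch _).
have dchi_cont : continuous dchi.
  move=> t; apply: cvgN; exact: (@continuous_arg_reflect R dchi0 (T + 1) cdch t).
have chi_cont : continuous chi by move=> t; exact: is_derive_cont (chi_derive t).
have chi1 t : t <= T -> chi t = 1 by move=> tT; apply: chr; lra.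
have chi0' t : T + 1 <= t -> chi t = 0 by move=> tT; apply: chl; lra.
have dchi1 t : t <= T -> dchi t = 0 by move=> tT; rewrite /dchi dr ?oppr0 //; lra.
have dchi0' t : T + 1 <= t -> dchi t = 0 by move=> tT; rewrite /dchi dl ?oppr0 //; lra.
pose v i t := chi t * w s i t.
pose dv i t := dchi t * w s i t + chi t * (- s * w s i t + ex s t * dz i t).
have v_derive i (t : R) : is_derive t 1 (v i) (dv i t).
  have dw := is_derive_mulf (ex_derive s t) (z_derive i t).
  have := is_derive_mulf (chi_derive t) dw.
  by congr is_derive; rewrite /dv /w; ring.
have dv_cont i : continuous (dv i).
  apply: continuous_addf; apply: continuous_mulf => //.
  by apply: continuous_addf; [exact: cZ|exact: continuous_mulf].
have v_sum t : \sum_i v i t = 0.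
  by rewrite -mulr_sumr -mulr_sumr z_sum !mulr0.
have v_left i t : t <= 0 -> v i t = 0 by move=> t0; rewrite /v /w z_left // !mulr0.
have v_right i t : X <= t -> v i t = 0.
  by move=> t0; rewrite /v chi0' ?mul0r //; move: t0; rewrite /X; lra.
have tX i j : tau i j <= X by apply: le_trans (tau_le i j) _; rewrite /X; lra.
have := resolvent_estimate tau_ge0 C_gt0 symbol_bound s0 X0 tX v_derive dv_cont v_sum v_left v_right.
set Lhs := (X in X <= _) => H.
have w2c i : continuous (fun t => w s i t ^+ 2) by exact: continuous_sqrf.
have v_cont i : continuous (v i) by exact: continuous_mulf.
have h1 : weighted_energy s T <= Lhs.
  apply: ler_sum => i _.
  apply: (@le_trans _ _ (cintegral (fun t => v i t ^+ 2) 0 T)).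
    rewrite le_eqVlt; apply/orP; left; apply/eqP; apply: eq_cintegral => //.
    - exact: continuous_sqrf.
    - lra.
    - by move=> t /andP[_ tT]; rewrite /v chi1 // mul1r.
  apply: cintegral_itv_le.
  - exact: continuous_sqrf.
  - by move=> t; exact: sqr_ge0.
  - lra.
  - lra.
  - by rewrite /X; lra.
apply: (le_trans h1); apply: (le_trans H).
rewrite -mulrA -mulrDr ler_pM2l //.
have -> : \sum_i cintegral (fun t => (dv i t + s * v i t + delay_op a tau s v i t) ^+ 2) (- X) (2 * X) =
  \sum_i cintegral (fun t => cut_op s chi dchi i t ^+ 2) (- X) (2 * X).
  by apply: eq_bigr => i _; congr cintegral; apply/funext => t; rewrite -cut_opE.
have cop i : continuous (fun t => cut_op s chi dchi i t ^+ 2).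
  apply: continuous_sqrf.
  rewrite (_ : cut_op s chi dchi i = fun t => dv i t + s * v i t + delay_op a tau s v i t).
    apply: continuous_addf; last exact: continuous_delay_op.
    by apply: continuous_addf => //; exact: cZ.
  by apply/funext => t; rewrite -cut_opE.
pose e i := cintegral (fun t => w s i t ^+ 2) (T - tm) (T + 1).
have chi01 t : 0 <= chi t <= 1 by exact: ch01.
(* At the delayed time [u = t - tau i j] the two cutoffs both vanish if [u >= T + 1], and [t >= T]
   gives [u >= T - tm]: only the window from [T - tm] to [T + 1] counts. *)
have shift_le i j l : cintegral (fun t => ((chi (t - tau i j) - chi t) * w s l (t - tau i j)) ^+ 2) T (2 * X) <= e l.
  pose g u := ((chi u - chi (u + tau i j)) * w s l u) ^+ 2.
  have cg : continuous g.
    apply: continuous_sqrf; apply: continuous_mulf => //; apply: continuous_subf => //.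
    by have := @continuous_arg_shift R chi (- tau i j) chi_cont; under eq_fun do rewrite opprK.
  have t0 := tau_ge0 i j; have t1 := tau_le i j.
  have -> : (fun t => ((chi (t - tau i j) - chi t) * w s l (t - tau i j)) ^+ 2) = fun t => g (t - tau i j).
    by apply/funext => t; rewrite /g subrK.
  rewrite cintegral_arg_shift //; last by rewrite /X; lra.
  rewrite -(cintegral_cat g _ (T + 1)) [X in _ + X]cintegral_eq0 ?addr0 //; last 2 first.
  - by rewrite /X; lra.
  - move=> u /andP[u1 _]; rewrite /g !chi0' ?subrr ?mul0r ?expr0n //.
    by rewrite (le_trans u1) // lerDl.
  apply: (@le_trans _ _ (cintegral (fun t => w s l t ^+ 2) (T - tau i j) (T + 1))).
    apply: le_cintegral => //; first lra.
    move=> u _; rewrite /g exprMn ler_piMl ?sqr_ge0 //.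
    have /andP[c1 c2] := chi01 u; have /andP[c3 c4] := chi01 (u + tau i j); nra.
  by apply: cintegral_itv_le => //; [move=> u; exact: sqr_ge0|lra..].
have tail i : cintegral (fun t => cut_op s chi dchi i t ^+ 2) T (2 * X) <=
    2 * D ^+ 2 * e i + 4 * n%:R * alpha ^+ 2 * \sum_j (e i + e j).
  have TX : T <= 2 * X by rewrite /X; lra.
  pose g l j t := ((chi (t - tau i j) - chi t) * w s l (t - tau i j)) ^+ 2.
  have cg l j : continuous (g l j).
    apply: continuous_sqrf; apply: continuous_mulf; last exact: continuous_arg_shift.
    by apply: continuous_subf => //; exact: continuous_arg_shift.
  have cdw : continuous (fun t => (dchi t * w s i t) ^+ 2).
    by apply: continuous_sqrf; exact: continuous_mulf.
  have cgs : continuous (fun t => \sum_j (g i j t + g j j t)).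
    by apply: continuous_sumf => j; exact: continuous_addf.
  pose K := 4 * n%:R * alpha ^+ 2.
  have K0 : 0 <= K by rewrite !mulr_ge0 // sqr_ge0.
  apply: (@le_trans _ _ (cintegral (fun t => 2 * (dchi t * w s i t) ^+ 2 + K * \sum_j (g i j t + g j j t)) T (2 * X))).
    apply: le_cintegral => //; first by apply: continuous_addf; exact: cZ.
    move=> t /andP[tT _]; rewrite /cut_op force_right ?(le_trans T0T) // !mulr0 addr0.
    set A := _ * w s i t; set B := \sum_j _.
    have hB : B ^+ 2 <= 2 * n%:R * alpha ^+ 2 * \sum_j (g i j t + g j j t).
      rewrite /B; under eq_bigr do rewrite mulrBr.
      exact: (@delay_sqr s (fun i j => (chi (t - tau i j) - chi t) * w s i (t - tau i j))
        (fun i j => (chi (t - tau i j) - chi t) * w s j (t - tau i j)) i s0).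
    by have := sqr_ge0 (A - B); rewrite /K; lra.
  rewrite cintegralD ?cintegralZ //; try exact: cZ.
  apply: lerD.
    rewrite -mulrA ler_pM2l //.
    rewrite -(cintegral_cat _ T (T + 1)) [X in _ + X]cintegral_eq0 ?addr0 //; last 2 first.
    - by rewrite /X; lra.
    - by move=> u /andP[u1 _]; rewrite dchi0' // mul0r expr0n.
    apply: (@le_trans _ _ (cintegral (fun t => D ^+ 2 * w s i t ^+ 2) T (T + 1))).
      apply: le_cintegral => //; [exact: cZ|lra|].
      move=> u _; rewrite exprMn ler_wpM2r ?sqr_ge0 //.
      by rewrite -[leLHS]real_normK ?num_real // ler_sqr ?nnegrE // normrN.
    rewrite cintegralZ //; last lra.
    rewrite ler_wpM2l ?sqr_ge0 //; apply: cintegral_itv_le => //; [move=> u; exact: sqr_ge0|lra..].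
  rewrite ler_wpM2l // cintegral_sum //; last by move=> j; exact: continuous_addf.
  by apply: ler_sum => j _; rewrite cintegralD //; apply: lerD; exact: shift_le.
have cut_le i t : t <= T -> cut_op s chi dchi i t = ex s t * force i t.
  move=> tT; rewrite /cut_op dchi1 // chi1 // mul0r add0r mul1r big1 ?addr0 // => j _.
  by rewrite chi1 ?subrr ?mul0r ?mulr0 // (le_trans _ tT) // gerBl.
have cef i : continuous (fun t => (ex s t * force i t) ^+ 2).
  by apply: continuous_sqrf; exact: continuous_mulf.
(* Up to time [T] the cutoff is 1 at the current and all delayed times, so only [force] remains, and
   it lives in [0, T0]. *)
have split i : cintegral (fun t => cut_op s chi dchi i t ^+ 2) (- X) (2 * X) =
    cintegral (fun t => (ex s t * force i t) ^+ 2) 0 T0 + cintegral (fun t => cut_op s chi dchi i t ^+ 2) T (2 * X).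
  rewrite -(cintegral_cat _ (- X) 0) -(cintegral_cat _ 0 T0 (2 * X)) -(cintegral_cat _ T0 T (2 * X)).
  rewrite cintegral_eq0 ?add0r //; last 2 first.
  - by rewrite oppr_le0 ltW.
  - by move=> t /andP[_ t0]; rewrite cut_le ?force_left ?mulr0 ?expr0n //; lra.
  rewrite [X in _ + (X + _)]cintegral_eq0 ?add0r //; last first.
    by move=> t /andP[t0 tT]; rewrite cut_le // force_right // mulr0 expr0n.
  congr (_ + _); apply: eq_cintegral => // t /andP[_ tT]; rewrite cut_le //; lra.
have -> : weighted_energy s (T + 1) - weighted_energy s (T - tm) = \sum_i e i.
  by rewrite -sumrB; apply: eq_bigr => i _; rewrite /e -(cintegral_cat _ 0 (T - tm) (T + 1)); ring.
under eq_bigr do rewrite split.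
rewrite big_split lerD2l /=.
apply: (le_trans (ler_sum _ (fun i _ => tail i))).
rewrite big_split /= -!mulr_sumr.
have -> : \sum_i \sum_j (e i + e j) = 2 * n%:R * \sum_i e i.
  under eq_bigr do rewrite big_split /= sumr_const card_ord.
  rewrite big_split /= sumr_const card_ord -[X in _ + X]mulr_natl.
  under eq_bigr do rewrite -[_ *+ n]mulr_natl.
  by rewrite -mulr_sumr; ring.
have E0 : 0 <= \sum_i e i.
  by apply: sumr_ge0 => i _; apply: cintegral_ge0 => //; [lra|move=> t _; exact: sqr_ge0].
by rewrite /k; lra.
Qed.

End Decay.

(** * Lowering the exponential weight to zero *)

Section Bootstrap.
Local Open Scope classical_set_scope.
Local Open Scope ring_scope.
Context {R : realType} {n : nat}.
Variables (z : 'I_n -> R -> R) (C1 tm T0 K kappa : R).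
Hypothesis z_cont : forall i, continuous (z i).
Hypothesis C1_gt0 : 0 < C1.
Hypothesis tm_ge0 : 0 <= tm.
Hypothesis T0_ge0 : 0 <= T0.
Hypothesis cutoff : forall s, 0 <= s -> exists C0,
  forall T, T0 <= T -> weighted_energy z s T <=
   C0 + C1 * (weighted_energy z s (T + 1) - weighted_energy z s (T - tm)).
Hypothesis z_growth : forall i t, 0 <= t -> `|z i t| <= K * expR (kappa * t).

Let w2_cont s i : continuous (fun t : R => (expR (- (s * t)) * z i t) ^+ 2).
Proof.
apply: continuous_sqrf; apply: continuous_mulf => //.
have := @continuous_arg_scale R expR (- s) (@continuous_expR R).
by under eq_fun do rewrite mulNr.
Qed.

Let bounded s := exists B, forall T, 0 <= T -> weighted_energy z s T <= B.

Let mono s T T' : T <= T' -> weighted_energy z s T <= weighted_energy z s T'.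
Proof.
move=> TT; apply: ler_sum => i _; rewrite -(cintegral_cat _ 0 T T') lerDl.
by apply: cintegral_ge0 => // t _; exact: sqr_ge0.
Qed.

Let weight_shift s h T : 0 <= h -> 0 <= T ->
  weighted_energy z s T <= expR (2 * h * T) * weighted_energy z (s + h) T.
Proof.
move=> h0 T0'; rewrite mulr_sumr; apply: ler_sum => i _.
rewrite -cintegralZ //; apply: le_cintegral => //.
  by apply: continuous_mulf => //; exact: continuous_constf.
move=> t /andP[t0 tT]; rewrite !exprMn [leRHS]mulrA ler_wpM2r ?sqr_ge0 //.
rewrite -!expRM_natl -expRD ler_expR.
have : h * t <= h * T by rewrite ler_wpM2l.
lra.
Qed.

(** Lowering the rate by [eta] lets the bound on the energy grow by the factor [1 + 1 / (2 C1)] over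
    a window of length [tm + 1], strictly less than the factor [1 + 1 / C1] that an unbounded energy
    would show. The value does not depend on [s], so finitely many steps reach 0. *)
Let eta := ln (1 + (2 * C1)^-1) / (2 * (tm + 1)).

Let C12 : 0 < (2 * C1)^-1.
Proof. by rewrite invr_gt0 mulr_gt0. Qed.

Let eta_gt0 : 0 < eta.
Proof.
have tm0 := tm_ge0; have c := C12.
apply: divr_gt0; last by lra.
by rewrite ln_gt0 //; lra.
Qed.

Let bounded_step s : 0 <= s -> bounded (s + eta) -> bounded s.
Proof.
move=> s0 [B HB]; have [C0 HC] := cutoff s0.
have tm0 := tm_ge0; have T00 := T0_ge0; have e0 := eta_gt0.
pose q := 1 + (2 * C1)^-1.
have c := C12.
have qE : expR (2 * eta * (tm + 1)) = q.
  have -> : 2 * eta * (tm + 1) = ln q by rewrite /eta /q; field; lra.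
  by rewrite lnK // posrE /q; lra.
exists C0 => T T0'; apply: (le_trans (mono s (_ : T <= Num.max T T0))).
  by rewrite le_max lexx.
set S := Num.max T T0.
have S0 : T0 <= S by rewrite le_max lexx orbT.
apply: (@no_slow_growth R (weighted_energy z s) C0 C1 (expR (2 * eta * S) * B) (tm + 1) q T0 S) => //.
- lra.
- by rewrite /q; lra.
- by rewrite /q ltrD2l ltf_pV2 ?posrE ?mulr_gt0 //; have := C1_gt0; lra.
(* The window of the cutoff estimate is anchored at its left end: with [U + tm] for [T] it becomes
   [[U, U + tm + 1]], of length [tm + 1]. *)
- move=> U T0U; apply: (le_trans (mono s (_ : U <= U + tm))); first by lra.
  have := HC (U + tm) ltac:(lra).
  have -> : U + tm - tm = U by ring.
  by rewrite addrA.
- move=> k; have k0 : 0 <= k%:R * (tm + 1) by rewrite mulr_ge0 //; lra.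
  have U0 : 0 <= S + k%:R * (tm + 1) by lra.
  apply: le_trans (weight_shift s (ltW e0) U0) _.
  have -> : expR (2 * eta * S) * B * q ^+ k = expR (2 * eta * (S + k%:R * (tm + 1))) * B.
    rewrite -qE -expRM_natl mulrAC -expRD; congr (expR _ * _); ring.
  by rewrite ler_wpM2l ?expR_ge0 // HB.
Qed.

(** For such [s] the weighted signal is at most [K exp (- t)] in modulus. *)
Let bounded_large s : kappa + 1 <= s -> bounded s.
Proof.
move=> ks; exists (n%:R * K ^+ 2) => T T0'.
have ce : continuous (fun t : R => K ^+ 2 * expR (- 2 * t)).
  apply: continuous_mulf; first exact: continuous_constf.
  by apply: continuous_arg_scale; exact: continuous_expR.
apply: (@le_trans _ _ (\sum_(i < n) cintegral (fun t : R => K ^+ 2 * expR (- 2 * t)) 0 T)).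
  apply: ler_sum => i _; apply: le_cintegral => // t /andP[t0 tT].
  have h1 := z_growth i t0; have h2 := expR_ge0 (- (s * t)).
  apply: (@le_trans _ _ ((expR (- (s * t)) * (K * expR (kappa * t))) ^+ 2)).
    rewrite -[leLHS]real_normK ?num_real // ler_sqr ?nnegrE //.
      by rewrite normrM (ger0_norm h2) ler_wpM2l.
    by rewrite mulr_ge0 // (le_trans _ h1).
  rewrite mulrCA exprMn ler_wpM2l ?sqr_ge0 // -expRD -expRM_natl ler_expR.
  have : (kappa + 1) * t <= s * t by rewrite ler_wpM2r.
  lra.
rewrite sumr_const card_ord -[leLHS]mulr_natl ler_wpM2l //.
have d (t : R) (_ : 0 <= t <= T) : is_derive t 1 (fun t : R => - (K ^+ 2 / 2) * expR (- 2 * t)) (K ^+ 2 * expR (- 2 * t)).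
  have := is_derive_scalef (- (K ^+ 2 / 2)) (is_derive_arg_scale (is_derive_expR (- 2 * t))).
  by congr is_derive; field.
rewrite (cintegralE ce T0' d) mulr0 expR0.
have := expR_ge0 (- 2 * T); have := sqr_ge0 K; nra.
Qed.

Lemma weighted_energy_bounded : exists B, forall T, 0 <= T -> weighted_energy z 0 T <= B.
Proof.
have e0 := eta_gt0.
have down k : bounded (k%:R * eta) -> bounded 0.
  elim: k => [|k IH]; first by rewrite mul0r.
  rewrite -natr1 mulrDl mul1r => h; apply: IH; apply: bounded_step => //.
  by rewrite mulr_ge0 // ltW.
apply: (down (Num.truncn ((kappa + 1) / eta)).+1); apply: bounded_large.
by rewrite -ler_pdivrMr // ltW // truncnS_gt.
Qed.

End Bootstrap.

(** * From bounded energy to decay *)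

Section Vanish.
Local Open Scope classical_set_scope.
Local Open Scope ring_scope.
Context {R : realType} {n : nat}.
Variables (a tau : 'I_n -> 'I_n -> R) (C tm : R).
Hypothesis tau_ge0 : forall i j, 0 <= tau i j.
Hypothesis tau_le : forall i j, tau i j <= tm.
Hypothesis tm_ge0 : 0 <= tm.
Hypothesis C_gt0 : 0 < C.
Hypothesis symbol_bound : forall s w P Q, 0 <= s ->
  \sum_i P i = 0 -> \sum_i Q i = 0 ->
  \sum_i P i ^+ 2 + \sum_i Q i ^+ 2 <=
    C * (\sum_i symbol_re a tau s w P Q i ^+ 2 + \sum_i symbol_im a tau s w P Q i ^+ 2).

(** The equation turns square integrability of [z] into that of [dz]: the delayed terms have at most
    the energy of [z], and the forcing ends at [T0]. *)
Lemma decay (z dz : 'I_n -> R -> R) (T0 K kappa : R) :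
  (forall i (t : R), is_derive t 1 (z i) (dz i t)) ->
  (forall i, continuous (dz i)) ->
  (forall t, \sum_i z i t = 0) ->
  (forall i t, t <= 0 -> z i t = 0) ->
  (forall i t, t <= 0 -> dz i t = 0) ->
  0 <= T0 ->
  (forall i t, T0 <= t -> dz i t + delay_op a tau 0 z i t = 0) ->
  (forall i t, 0 <= t -> `|z i t| <= K * expR (kappa * t)) ->
  forall i e, 0 < e -> exists S, forall t, S <= t -> `|z i t| <= e.
Proof.
move=> d cd zs zl dzl T00 fr gr i.
have cz j : continuous (z j) by move=> t; exact: is_derive_cont (d j t).
have [C1 C10 cut] := cutoff_estimate tau_ge0 tau_le tm_ge0 C_gt0 symbol_bound d cd zs zl dzl T00 fr.
have [B HB] := weighted_energy_bounded cz C10 tm_ge0 T00 cut gr.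
have HB' j T : 0 <= T -> cintegral (fun t => z j t ^+ 2) 0 T <= B.
  move=> T0'; apply: le_trans (HB T T0'); rewrite /weighted_energy (bigD1 j) //=.
  have E k : cintegral (fun t => (expR (- (0 * t)) * z k t) ^+ 2) 0 T = cintegral (fun t => z k t ^+ 2) 0 T.
    by congr cintegral; apply/funext => t; rewrite mul0r oppr0 expR0 mul1r.
  rewrite E lerDl; apply: sumr_ge0 => k _; rewrite E.
  by apply: cintegral_ge0 => //; [exact: continuous_sqrf|move=> t _; exact: sqr_ge0].
pose f t := dz i t + delay_op a tau 0 z i t.
have cf : continuous f by apply: continuous_addf => //; exact: continuous_delay_op.
have cf2 := continuous_sqrf cf.
pose Bf := cintegral (fun t => f t ^+ 2) 0 T0.
have fB T : 0 <= T -> cintegral (fun t => f t ^+ 2) 0 T <= Bf.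
  move=> T0'; have [TT|TT] := leP T T0.
    by apply: cintegral_itv_le => // t; exact: sqr_ge0.
  rewrite -(cintegral_cat _ 0 T0 T) [X in _ + X]cintegral_eq0 ?addr0 // ?(ltW TT) //.
  by move=> t /andP[t1 _]; rewrite /f fr // expr0n.
have czs j c : continuous (fun t => z j (t - c) ^+ 2).
  by apply: continuous_sqrf; exact: continuous_arg_shift.
have cdz2 := continuous_sqrf (cd i); have cz2 := continuous_sqrf (cz i).
pose A := \sum_j a i j ^+ 2.
have A0 : 0 <= A by apply: sumr_ge0 => j _; exact: sqr_ge0.
have aA j : a i j ^+ 2 <= A.
  by rewrite /A (bigD1 j) //= lerDl; apply: sumr_ge0 => k _; exact: sqr_ge0.
have n0 : 0 <= n%:R :> R by [].
(* Cauchy-Schwarz over the [n] nodes, and a factor 2 for each of two uses of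
   [(x - y)^2 <= 2 x^2 + 2 y^2]. *)
pose K2 := 4 * n%:R * A.
have K20 : 0 <= K2 by rewrite !mulr_ge0.
pose g j t := z i (t - tau i j) ^+ 2 + z j (t - tau i j) ^+ 2.
have cg j : continuous (g j) by exact: continuous_addf.
have pt t : dz i t ^+ 2 <= 2 * f t ^+ 2 + K2 * \sum_j g j t.
  have -> : dz i t = f t - delay_op a tau 0 z i t by rewrite /f; ring.
  have h : delay_op a tau 0 z i t ^+ 2 <= n%:R * \sum_j (2 * A * g j t).
    apply: le_trans (sqr_sum_le _) _; rewrite ler_wpM2l //; apply: ler_sum => j _.
    rewrite mulr0 oppr0 expR0 mulr1 exprMn -mulrA [2 * _]mulrCA.
    apply: ler_pM; rewrite ?sqr_ge0 // /g.
    by have := sqr_ge0 (z i (t - tau i j) + z j (t - tau i j)); lra.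
  rewrite -mulr_sumr in h.
  by have := sqr_ge0 (f t + delay_op a tau 0 z i t); rewrite /K2; lra.
have gB j T : 0 <= T -> cintegral (g j) 0 T <= 2 * B.
  (* Shifting back by a delay can only drop energy, since [z] vanishes at negative times; if [T] is
     shorter than the delay nothing is left. *)
  move=> T0'; have sh k : cintegral (fun t => z k (t - tau i j) ^+ 2) 0 T <= B.
    have t0 := tau_ge0 i j.
    have ck := continuous_sqrf (cz k).
    rewrite (@cintegral_arg_shift R (fun t => z k t ^+ 2)) // -(cintegral_cat _ _ 0) cintegral_eq0 //; last 2 first.
    - lra.
    - by move=> t /andP[_ tl]; rewrite zl // expr0n.
    rewrite add0r; apply: le_trans (HB' k T T0').
    have [Tt|Tt] := leP 0 (T - tau i j).
      by apply: cintegral_itv_le => //; [move=> t; exact: sqr_ge0|lra].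
    have : cintegral (fun t => z k t ^+ 2) (T - tau i j) 0 = 0.
      by apply: cintegral_eq0 => //; [exact: ltW|move=> t /andP[_ tl]; rewrite zl // expr0n].
    have := cintegral_cat (fun t => z k t ^+ 2) 0 (T - tau i j) 0; rewrite cintegral_xx => h1 h2.
    have := @cintegral_ge0 R _ 0 T ck T0' (fun t _ => sqr_ge0 _); lra.
  by rewrite cintegralD //; have := sh i; have := sh j; lra.
apply: (@sqr_integrable_vanish R (z i) (dz i) (B + (2 * Bf + K2 * (n%:R * (2 * B))))) => //.
move=> T T0'; rewrite cintegralD //; apply: lerD; first exact: HB'.
have cs : continuous (fun t => \sum_j g j t) by exact: continuous_sumf.
apply: (@le_trans _ _ (cintegral (fun t => 2 * f t ^+ 2 + K2 * \sum_j g j t) 0 T)).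
  apply: le_cintegral => //; apply: continuous_addf; apply: continuous_mulf => //; exact: continuous_constf.
rewrite cintegralD ?cintegralZ //; try by apply: continuous_mulf => //; exact: continuous_constf.
apply: lerD; first by rewrite ler_pM2l // fB.
rewrite ler_wpM2l // cintegral_sum // -[n in n%:R]card_ord mulr_natl -sumr_const.
by apply: ler_sum => j _; exact: gB.
Qed.

End Vanish.

(** * Solutions of the delay equation *)

Section AbsContinuous.
Local Open Scope classical_set_scope.
Local Open Scope ring_scope.
Context {R : realType}.
Implicit Types (f g : R -> R) (a b : R).

(** Domination by several increments covers both later uses at once: the sum of the coordinates, and
    a coordinate minus an integral. *)
Lemma abs_continuous_le_sum a b f k (g : 'I_k -> R -> R) :
  (forall i, abs_continuous a b (g i)) ->
  (forall u v, a <= u -> u <= v -> v <= b -> `|f v - f u| <= \sum_i `|g i v - g i u|) ->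
  abs_continuous a b f.
Proof.
move=> acg fg e e0.
have k1 : 0 < k.+1%:R :> R by [].
(* With [k + 1] instead of [k] the total stays strictly below [e], and [k = 0] is included. *)
have ek : 0 < e / k.+1%:R by rewrite divr_gt0.
have [d Hd] := choice (fun i => let: ex_intro2 x p q := acg i _ ek in
  ex_intro (fun x => 0 < x /\ _) x (conj p q)).
pose D := \big[Num.min/1]_i d i.
exists D; first by apply/bigmin_gtP; split => // i _; exact: (Hd i).1.
move=> s s1 s2 sD.
apply: (@le_lt_trans _ _ (\sum_(p <- s) \sum_i `|g i p.2 - g i p.1|)).
  rewrite big_seq [leRHS]big_seq; apply: ler_sum => p ps.
  by have /allP/(_ _ ps)/andP[/andP[h1 h2] h3] := s1; exact: fg.
rewrite exchange_big /=.
apply: (@le_lt_trans _ _ (\sum_(i < k) e / k.+1%:R)).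
  apply: ler_sum => i _; apply: ltW; apply: (Hd i).2 => //.
  by apply: lt_le_trans sD _; exact: bigmin_le_cond.
rewrite sumr_const card_ord -[ltLHS]mulr_natl mulrCA gtr_pMr //.
by rewrite ltr_pdivrMr // mul1r ltr_nat.
Qed.

Lemma lipschitz_abs_continuous a b f k : 0 <= k ->
  (forall u v, a <= u <= b -> a <= v <= b -> `|f u - f v| <= k * `|u - v|) ->
  abs_continuous a b f.
Proof.
move=> k0 lip e e0; have k1 : 0 < k + 1 by lra.
exists (e / (k + 1)); first by rewrite divr_gt0.
move=> s s1 _; rewrite ltr_pdivlMr // => sd.
apply: le_lt_trans sd; rewrite mulr_suml big_seq [leRHS]big_seq; apply: ler_sum => p ps.
have /allP/(_ _ ps)/andP[/andP[h1 h2] h3] := s1.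
apply: le_trans (lip _ _ _ _) _; rewrite ?h1 ?h3 ?(le_trans h1) ?(le_trans h2) //.
rewrite ger0_norm ?subr_ge0 // mulrC ler_wpM2l ?subr_ge0 //; lra.
Qed.

Lemma abs_continuous_sub a b c d f : a <= c -> d <= b -> abs_continuous a b f ->
  abs_continuous c d f.
Proof.
move=> ac db acf e e0; have [r r0 H] := acf e e0; exists r => // s s1.
apply: H; apply: sub_all s1 => p /andP[/andP[h1 h2] h3].
by rewrite h2 (le_trans ac) // (le_trans h3).
Qed.

Lemma continuous_clamp (V : topologicalType) (f : R -> V) :
  {within `[0, +oo[, continuous f} -> continuous (fun t : R => f (Num.max 0 t)).
Proof.
move=> /subspace_continuousP cf u.
have A (t : R) : `[0, +oo[%classic (Num.max 0 t) by rewrite /= in_itv /= andbT le_max lexx.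
apply: (@cvg_comp _ _ _ (fun t : R => Num.max 0 t) f _ _ _ _ (cf _ (A u))).
have cm : {for u, continuous (fun t : R => Num.max 0 t)}.
  exact: (@continuous_max R R (fun=> 0) id u (@cvg_cst _ _ _ _ _) (@cvg_id _ _)).
move=> P /= nP; have := cm _ nP.
apply: (@filterS _ (nbhs u)) => t /= h; exact: h (A t).
Qed.

End AbsContinuous.

(** * A priori exponential growth *)

Section Growth.
Local Open Scope classical_set_scope.
Local Open Scope ring_scope.
Context {R : realType} {n : nat}.
Variables (a tau : 'I_n -> 'I_n -> R) (tm : R).
Hypothesis tau_ge0 : forall i j, 0 <= tau i j.
Hypothesis tau_le : forall i j, tau i j <= tm.

(** Let [c] maximise the weighted size [h] on [0, tm]. If the maximum [u] of [h] over [0, T] occurs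
    after [tm], integrating the equation from [tm] gives [u <= h c + u / 2]. Either way
    [u <= 2 * h c], independently of [T]. *)
Lemma delay_growth (y : 'I_n -> R -> R) : 0 <= tm ->
  (forall i, continuous (y i)) ->
  (forall i t, tm <= t -> is_derive t 1 (y i) (- delay_op a tau 0 y i t)) ->
  exists K kappa, 0 <= K /\ forall i t, 0 <= t -> `|y i t| <= K * expR (kappa * t).
Proof.
move=> tm0 cy dy.
pose S t := \sum_i `|y i t|.
have S0 t : 0 <= S t by apply: sumr_ge0.
have yS i t : `|y i t| <= S t.
  by rewrite /S (bigD1 i) //= lerDl; apply: sumr_ge0.
have cS : continuous S.
  by apply: continuous_sumf => i t; apply: cvg_norm; exact: cy.
pose alpha := \sum_i \sum_j `|a i j|.
have alpha0 : 0 <= alpha by apply: sumr_ge0 => i _; apply: sumr_ge0.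
have a_le i : \sum_j `|a i j| <= alpha.
  by rewrite /alpha [leRHS](bigD1 i) //= lerDl; apply: sumr_ge0 => k _; apply: sumr_ge0.
have n0 : 0 <= n%:R :> R by [].
(* Chosen so that [2 n alpha / k <= 1 / 2], which absorbs the integrated delayed terms; the 1 keeps
   [k] positive. *)
pose k := 4 * n%:R * alpha + 1.
have k1 : 0 < k by rewrite /k ltr_wpDl // !mulr_ge0.
pose h t := S t * expR (- k * t).
have ch : continuous h.
  apply: continuous_mulf => //; apply: continuous_arg_scale; exact: continuous_expR.
have [c _ cmax] := EVT_max tm0 (continuous_subspaceT ch).
have h0 t : 0 <= h t by rewrite mulr_ge0 ?expR_ge0.
have hE t : S t = h t * expR (k * t).
  by rewrite /h -mulrA -expRD mulNr addNr expR0 mulr1.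
have main T : 0 <= T -> h T <= 2 * h c.
  move=> T0; have [t tT tmax] := EVT_max T0 (continuous_subspaceT ch).
  have TT : T \in `[0, T] by rewrite in_itv /= lexx T0.
  apply: (le_trans (tmax _ TT)).
  move: tT; rewrite in_itv /= => /andP[t0 tT].
  have [ttm|tmt] := leP t tm.
    by have := cmax t; rewrite in_itv /= t0 ttm => /(_ isT); have := h0 c; lra.
  set u := h t in tmax *.
  have u0 : 0 <= u by exact: h0.
  have ki : 0 <= k^-1 by rewrite invr_ge0 ltW.
  have dbd i s : tm <= s <= t -> `|delay_op a tau 0 y i s| <= 2 * alpha * u * expR (k * s).
    move=> /andP[s1 s2]; apply: le_trans (ler_norm_sum _ _ _) _.
    apply: (@le_trans _ _ (\sum_j `|a i j| * (2 * (u * expR (k * s))))); last first.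
      have -> : 2 * alpha * u * expR (k * s) = alpha * (2 * (u * expR (k * s))) by ring.
      by rewrite -mulr_suml ler_wpM2r // !mulr_ge0 ?expR_ge0 // /u h0.
    apply: ler_sum => j _; rewrite mulr0 oppr0 expR0 mulr1 normrM ler_wpM2l //.
    apply: le_trans (ler_normB _ _) _.
    set r := s - tau i j.
    have t1 := tau_ge0 i j; have t2 := tau_le i j.
    have r0 : 0 <= r <= T by rewrite /r; lra.
    have : S r <= u * expR (k * s).
      rewrite hE; apply: ler_pM; rewrite ?expR_ge0 ?h0 //.
        by apply: tmax; rewrite in_itv.
      by rewrite ler_expR ler_pM2l // /r; lra.
    by have := yS i r; have := yS j r; lra.
  have grow i : `|y i t| <= `|y i tm| + 2 * alpha * u / k * expR (k * t).
    have E (s : R) : is_derive s 1 (fun s => 2 * alpha * u / k * expR (k * s)) (2 * alpha * u * expR (k * s)).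
      have := is_derive_scalef (2 * alpha * u / k) (is_derive_arg_scale (is_derive_expR (k * s))).
      by congr is_derive; field; rewrite gt_eqF.
    have p0 : 0 <= 2 * alpha * u / k * expR (k * tm).
      by rewrite !mulr_ge0 ?expR_ge0.
    have dyi s (hs : tm <= s <= t) : is_derive s 1 (y i) (- delay_op a tau 0 y i s).
      by apply: dy; case/andP: hs.
    have up := @mono_of_derive R _ _ tm t (ltW tmt) (fun s hs => is_derive_subf (E s) (dyi s hs)).
    have lo := @mono_of_derive R _ _ tm t (ltW tmt) (fun s hs => is_derive_addf (E s) (dyi s hs)).
    have b s : tm <= s <= t -> - (2 * alpha * u * expR (k * s)) <= delay_op a tau 0 y i s <= 2 * alpha * u * expR (k * s).
      by rewrite -ler_norml; exact: dbd.
    have {}up := up (fun s hs => ltac:(have := b s hs; lra)).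
    have {}lo := lo (fun s hs => ltac:(have := b s hs; lra)).
    have n1 := ler_norm (y i tm); have n2 := ler_norm (- y i tm).
    by rewrite normrN in n2; rewrite ler_norml; apply/andP; split; lra.
  have : S t <= S tm + n%:R * (2 * alpha * u / k * expR (k * t)).
    rewrite {2}/S -[n in n%:R]card_ord mulr_natl -sumr_const -big_split.
    by apply: ler_sum => i _; exact: grow.
  have htm : h tm <= h c by apply: cmax; rewrite in_itv /= tm0 lexx.
  rewrite (hE t) (hE tm) -/u.
  have ek : expR (k * tm) <= expR (k * t) by rewrite ler_expR ler_pM2l // ltW.
  have e0 : 0 < expR (k * t) := expR_gt0 _.
  have hk : h tm * expR (k * tm) <= h c * expR (k * t) by apply: ler_pM; rewrite ?expR_ge0.
  move=> H; have {H} : u * expR (k * t) <= (h c + n%:R * (2 * alpha * u / k)) * expR (k * t).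
    by apply: (le_trans H); rewrite [leRHS]mulrDl -[X in _ <= _ + X]mulrA lerD2r.
  rewrite ler_pM2r // => H.
  have : n%:R * (2 * alpha * u / k) <= u / 2.
    have -> : n%:R * (2 * alpha * u / k) = n%:R * 2 * alpha * u / k by ring.
    rewrite ler_pdivrMr //.
    have -> : u / 2 * k = n%:R * 2 * alpha * u + u / 2 by rewrite /k; field.
    lra.
  lra.
exists (2 * h c), k; split; first by rewrite mulr_ge0.
move=> i t t0; apply: le_trans (yS i t) _; rewrite hE.
by rewrite ler_wpM2r ?expR_ge0 // main.
Qed.

End Growth.

(** * Conservation of the average and regularity of solutions *)

Section Solution.
Local Open Scope classical_set_scope.
Local Open Scope ring_scope.
Context {R : realType} {n : nat}.
Variables (G : delay_graph R n) (x0 : 'cV[R]_n) (x : R -> 'cV[R]_n).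
Hypothesis x_sol : is_solution G x0 x.

(* A continuous replacement of the solution on the whole line: the jump of [x] at 0 is
   invisible to the equation after time [total_delay]. *)
Definition clamped i t : R := x (Num.max 0 t) i ord0.

Definition total_delay : R := \sum_i \sum_j delay G i j.

Lemma delay_le_total i j : delay G i j <= total_delay.
Proof.
rewrite /total_delay (bigD1 i) //= (bigD1 j) //= -addrA lerDl addr_ge0 //.
  by apply: sumr_ge0 => k _; exact: delay_ge0.
by apply: sumr_ge0 => k _; apply: sumr_ge0 => l _; exact: delay_ge0.
Qed.

Lemma total_delay_ge0 : 0 <= total_delay.
Proof. by apply: sumr_ge0 => k _; apply: sumr_ge0 => l _; exact: delay_ge0. Qed.

Lemma clampedE i t : 0 <= t -> clamped i t = x t i ord0.
Proof. by move=> t0; rewrite /clamped max_r. Qed.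

Lemma clamped_cont i : continuous (clamped i).
Proof.
move=> t.
have c1 : {for t, continuous (fun t : R => x (Num.max 0 t))}.
  exact: (continuous_clamp (sol_cont x_sol)).
have c2 : {for x (Num.max 0 t), continuous (fun M : 'cV[R]_n => M i ord0)}.
  exact: coord_continuous.
exact: (continuous_comp c1 c2).
Qed.

(** The exchange along each edge is antisymmetric, so the sum has derivative zero almost everywhere;
    absolute continuity upgrades this to constancy. *)
Lemma sum_conserved t : 0 <= t -> \sum_i x t i ord0 = \sum_i x0 i ord0.
Proof.
move=> t0; rewrite -(sol_init x_sol).
apply: (@abs_continuous_const R (fun t => \sum_i x t i ord0) 0 t t0).
  apply: (@abs_continuous_le_sum R 0 t _ n (fun i t => x t i ord0)).
    by move=> i; exact: sol_ac x_sol i t t0.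
  by move=> u v _ _ _; rewrite -sumrB; exact: ler_norm_sum.
have := sol_ode x_sol; apply: (@filterS _ _ (ae_filter_ringOfSetsType (@lebesgue_measure R))) => s H /andP[s0 _].
rewrite [X in is_derive _ _ _ X](_ : 0 = \sum_i \sum_j adj G i j *
    (x (s - delay G i j) j ord0 - x (s - delay G i j) i ord0)); last first.
  by rewrite sum_antisym // => i j; rewrite (adj_sym G j i) (delay_sym G j i); ring.
by apply: (@is_derive_sumf R n (fun i t => x t i ord0)) => i; exact: H.
Qed.

Let rhs i t := - delay_op (adj G) (delay G) 0 clamped i t.

Let rhs_cont i : continuous (rhs i).
Proof.
move=> t; apply: cvgN; apply: continuous_delay_op; exact: clamped_cont.
Qed.

Let clamped_near i (t : R) : 0 < t -> \near t, x t i ord0 = clamped i t.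
Proof.
move=> t0; near=> s; rewrite clampedE //.
by apply: ltW; near: s; exact: lt_nbhsr.
Unshelve. all: by end_near. Qed.

(** [clamped] minus the integral of [rhs] is absolutely continuous with derivative zero almost
    everywhere. The resulting integral equation has a continuous integrand, which makes the solution
    continuously differentiable from there on. *)
Lemma clamped_increment i T : total_delay + 1 <= T ->
  clamped i T - clamped i (total_delay + 1) = cintegral (rhs i) (total_delay + 1) T.
Proof.
(* From the total delay on no delayed time is negative, so [x] and [clamped] agree at all of them;
   the extra 1 keeps [t] itself positive, so that they agree in a neighbourhood of [t] too. *)
set t1 := total_delay + 1 => T1; have tm0 := total_delay_ge0.
have t10 : 0 < t1 by rewrite /t1; lra.
have [k [M0 kM]] : exists k : R, 0 <= k /\ forall t, t1 <= t <= T -> `|rhs i t| <= k.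
  have cn : continuous (fun t => `|rhs i t|) by move=> t; apply: cvg_norm; exact: rhs_cont.
  have [c _ cmax] := EVT_max T1 (continuous_subspaceT cn).
  by exists `|rhs i c|; split => // t tT; apply: cmax; rewrite in_itv.
pose f t := clamped i t - cintegral (rhs i) t1 t.
suff : f T = f t1 by rewrite /f cintegral_xx; lra.
apply: abs_continuous_const => //.
  apply: (@abs_continuous_le_sum R t1 T f 2
    (fun b t => if b == ord0 then x t i ord0 else cintegral (rhs i) t1 t)).
    move=> b; case: (b == ord0).
      apply: (@abs_continuous_sub R 0 T) => //; first exact: ltW.
      have T0 : 0 <= T by lra.
      exact: (sol_ac x_sol i T0).
    apply: (lipschitz_abs_continuous M0).
    exact: (lipschitz_of_derive (fun t => cintegral_derive t1 t (@rhs_cont i))).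
  move=> u v u1 uv vT; rewrite !big_ord_recl big_ord0 addr0 /= /f.
  rewrite !clampedE; try lra.
  set p := x v i ord0; set q := x u i ord0; set r := cintegral _ _ v; set s := cintegral _ _ u.
  have -> : p - r - (q - s) = (p - q) - (r - s) by ring.
  exact: ler_normB.
have := sol_ode x_sol; apply: (@filterS _ _ (ae_filter_ringOfSetsType (@lebesgue_measure R))) => t H /andP[tl _].
have t0 : 0 < t by lra.
rewrite -[X in is_derive _ _ _ X](subrr (rhs i t)).
have d1 : is_derive t 1 (clamped i) (rhs i t).
  apply: (near_eq_is_derive (clamped_near i t0)).
  have := H (ltW t0) i; congr is_derive; rewrite /rhs /delay_op -sumrN.
  apply: eq_bigr => j _; rewrite mulr0 oppr0 expR0 mulr1.
  have := delay_le_total i j => h.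
  by rewrite !clampedE; [ring|rewrite /t1 in tl; lra..].
exact: (is_derive_subf d1 (cintegral_derive t1 t (@rhs_cont i))).
Qed.

Lemma clamped_derive i (t : R) : total_delay + 1 < t ->
  is_derive t 1 (clamped i) (- delay_op (adj G) (delay G) 0 clamped i t).
Proof.
move=> tt.
have d : is_derive t 1 (fun t => clamped i (total_delay + 1) + cintegral (rhs i) (total_delay + 1) t) (0 + rhs i t).
  apply: is_derive_addf; exact: cintegral_derive.
rewrite add0r in d; apply: (near_eq_is_derive _ d).
near=> s; rewrite -clamped_increment; first ring.
by apply: ltW; near: s; apply: lt_nbhsr.
Unshelve. all: by end_near. Qed.

End Solution.

(** * Application to the delay graph *)

Section Consensus.
Context {R : realType} {n : nat}.
Variable G : delay_graph R n.
Hypothesis n_gt0 : (0 < n)%N.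
Hypothesis reff_pos : forall Va Vb : {set 'I_n},
  Va != finset.set0 -> Vb != finset.set0 -> [disjoint Va & Vb] ->
  reff_defined (Lhat G) Va Vb /\ 0 < reff (Lhat G) Va Vb.

Lemma lambda_bar_bound v : energy (fun i j => `|adj G i j|) v <= lambda_bar G * \sum_i v i ^+ 2.
Proof.
have ws i j : (\matrix_(i, j) `|adj G i j|) i j = (\matrix_(i, j) `|adj G i j|) j i.
  by rewrite !mxE adj_sym.
have Ls i j : L0abs G i j = L0abs G j i.
  by rewrite !mxE eq_sym; case: eqP => [->//|_]; rewrite ?mxE adj_sym.
have := bform_le_lambda_max v n_gt0 Ls; rewrite bform_laplacian //.
congr (_ <= _); congr (_ * _); apply: eq_bigr => i _; apply: eq_bigr => j _.
by rewrite mxE.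
Qed.

Lemma lambda_bar_ge0 : 0 <= lambda_bar G.
Proof.
pose v (i : 'I_n) : R := (i == Ordinal n_gt0)%:R.
have := lambda_bar_bound v; rewrite [X in _ * X](bigD1 (Ordinal n_gt0)) //=.
rewrite [X in _ + X]big1 => [|i i0]; last by rewrite /v (negPf i0) expr0n.
rewrite /v eqxx expr1n addr0 mulr1; apply: le_trans.
rewrite mulr_ge0 //; apply: sumr_ge0 => i _; apply: sumr_ge0 => j _.
by rewrite mulr_ge0 ?sqr_ge0.
Qed.

Lemma delay_weight_coercive : exists2 m, 0 < m & forall v : 'I_n -> R, \sum_i v i = 0 ->
  m * \sum_i v i ^+ 2 <=
  energy (fun i j => delay_weight (lambda_bar G) (adj G i j) (delay G i j)) v.
Proof.
have wE i j : (if edge G i j then delay_weight (lambda_bar G) (adj G i j) (delay G i j) else 0)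
    = delay_weight (lambda_bar G) (adj G i j) (delay G i j).
  case: ifP => // /negbT e; rewrite (delay_nonedge e).
  have : ~~ (adj G i j != 0) by rewrite adj_edge.
  by rewrite negbK => /eqP ->; rewrite /delay_weight ltxx.
have := @energy_coercive R n (\matrix_(i, j)
    if edge G i j then delay_weight (lambda_bar G) (adj G i j) (delay G i j)
    else 0) n_gt0 _ reff_pos.
case=> [i j|m m0 H]; first by rewrite !mxE !wE adj_sym delay_sym.
exists m => // v v0; apply: (le_trans (H v v0)).
rewrite le_eqVlt; apply/orP; left; apply/eqP.
by congr (_ * _); apply: eq_bigr => i _; apply: eq_bigr => j _; rewrite mxE wE.
Qed.

(** [y] is the deviation from the average, of sum zero by conservation. Switching it on smoothly
    after all delays have elapsed gives a signal [z] without past, at the price of a forcing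
    supported between [t2] and [t3]. *)
Lemma solution_converges x0 x : is_solution G x0 x ->
  forall i e, 0 < e -> exists S, forall t, S <= t ->
    `|x t i ord0 - n%:R^-1 * \sum_i x0 i ord0| <= e.
Proof.
move=> sol i e e0.
have [m m0 mH] := delay_weight_coercive.
have [C C0 CH] := symbol_bounded_below (fun i j => adj_sym G i j) (fun i j => delay_sym G i j)
  (fun i j => delay_ge0 G i j) lambda_bar_ge0 m0 lambda_bar_bound mH.
set tm := total_delay G; have tm0 : 0 <= tm := total_delay_ge0 G.
set c := n%:R^-1 * _.
pose y i t := clamped x i t - c.
have cy j : continuous (y j).
  by apply: continuous_subf; [exact: clamped_cont sol j|exact: continuous_constf].
have dE j t : delay_op (adj G) (delay G) 0 (clamped x) j t = delay_op (adj G) (delay G) 0 y j t.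
  by apply: eq_bigr => k _; rewrite /y; congr (_ * _); ring.
pose rhs j t := - delay_op (adj G) (delay G) 0 y j t.
have crhs j : continuous (rhs j).
  by move=> t; apply: cvgN; exact: continuous_delay_op.
have dy j (t : R) : tm + 1 < t -> is_derive t 1 (y j) (rhs j t).
  move=> tt; have := clamped_derive sol j tt; rewrite dE => d.
  by rewrite -[rhs j t]subr0; exact: (is_derive_subf d (is_derive_constf c t)).
have sy t : \sum_i y i t = 0.
  rewrite sumrB sumr_const card_ord /c -[_ *+ n]mulr_natl mulrA divff ?mul1r.
    have := sum_conserved sol (_ : 0 <= Num.max 0 t); rewrite le_max lexx => /(_ isT).
    by rewrite /clamped => ->; rewrite subrr.
  by rewrite pnatr_eq0 -lt0n.
have [chi [dchi [D [[dch cdch ch01 chl chr] [D0 dl dr dD]]]]] := @smoothstep R.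
(* [dy] is available beyond [tm + 1] only, hence the switch at [tm + 2]; it is complete at [t2 + 1],
   and after [t3] all delayed times are past that. *)
pose t2 := tm + 2; pose t3 := t2 + 1 + tm.
pose z j t := chi (t - t2) * y j t.
pose dz j t := chi (t - t2) * rhs j t + y j t * dchi (t - t2).
have cchi : continuous (fun t => chi (t - t2)).
  by apply: continuous_arg_shift => t; exact: is_derive_cont (dch t).
have z_derive j (t : R) : is_derive t 1 (z j) (dz j t).
  have [tl|tr] := ltP t t2; last first.
    have d1 : is_derive t 1 (y j) (rhs j t) by apply: dy; rewrite /t2 in tr; lra.
    exact: (is_derive_mulf (is_derive_arg_shift (dch (t - t2))) d1).
  have -> : dz j t = 0 by rewrite /dz chl ?dl ?mul0r ?mulr0 ?addr0 //; lra.
  apply: (near_eq_is_derive _ (is_derive_constf 0 t)).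
  near=> s; rewrite /z chl ?mul0r //.
  by rewrite subr_le0 ltW //; near: s; exact: lt_nbhsl.
have dz_cont j : continuous (dz j).
  by apply: continuous_addf; apply: continuous_mulf => //; exact: continuous_arg_shift.
have z_sum t : \sum_j z j t = 0 by rewrite -mulr_sumr sy mulr0.
have z_left j t : t <= 0 -> z j t = 0.
  by move=> t0; rewrite /z chl ?mul0r // /t2; lra.
have dz_left j t : t <= 0 -> dz j t = 0.
  by move=> t0; rewrite /dz chl ?dl ?mul0r ?mulr0 ?addr0 // /t2; lra.
have zy j t : t2 + 1 <= t -> z j t = y j t.
  by move=> tt; rewrite /z chr ?mul1r //; lra.
have t30 : 0 <= t3 by rewrite /t3 /t2; lra.
have forced j t : t3 <= t -> dz j t + delay_op (adj G) (delay G) 0 z j t = 0.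
  move=> tt; rewrite /dz chr ?dr; try (rewrite /t3 in tt; lra).
  rewrite mul1r mulr0 addr0 /rhs -[X in _ + X]opprK -opprD; apply/eqP.
  rewrite oppr_eq0 subr_eq0; apply/eqP; apply: eq_bigr => k _.
  have h := delay_le_total G j k.
  by rewrite !zy //; rewrite /t3 -/tm in tt h *; lra.
(* [delay_growth] wants the equation from the bound on the delays onwards, so the larger bound [t2]
   is supplied. *)
have [K [kappa [K0 grow]]] : exists K kappa, 0 <= K /\ forall i t, 0 <= t -> `|y i t| <= K * expR (kappa * t).
  apply: (@delay_growth R n (adj G) (delay G) t2) => //.
  - by move=> j k; exact: delay_ge0.
  - by move=> j k; have := delay_le_total G j k; rewrite /t2 /tm; lra.
  - by rewrite /t2; lra.
  - by move=> j t tt; apply: dy; rewrite /t2 in tt; lra.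
have zgrow j t : 0 <= t -> `|z j t| <= K * expR (kappa * t).
  move=> t0; rewrite /z normrM; apply: le_trans (grow j t t0); rewrite ler_piMl //.
  by have /andP[c1 c2] := ch01 (t - t2); rewrite ger0_norm.
have [S HS] := decay (fun i j => delay_ge0 G i j) (fun i j => delay_le_total G i j) tm0 C0 CH
  z_derive dz_cont z_sum z_left dz_left t30 forced zgrow i e0.
exists (Num.max S (t2 + 1)) => t; rewrite ge_max => /andP[St tt].
have := HS t St; rewrite zy // /y clampedE //; rewrite /t2 in tt; lra.
Unshelve. all: by end_near. Qed.

End Consensus.

Theorem theorem3 (R : realType) (n : nat) (G : delay_graph R n)
  (L0_psd : possemidef (L0 G))
  (L0_simple : simple_zero_eigenvalue (L0 G))
  (reff_pos : forall Va Vb : {set 'I_n},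
    Va != finset.set0 -> Vb != finset.set0 -> [disjoint Va & Vb] ->
    reff_defined (Lhat G) Va Vb /\ 0 < reff (Lhat G) Va Vb) :
  average_consensus G.
Proof.
move=> x0 x sol; apply/cvgrPdist_le => e e0.
have conv (i : 'I_n) : exists S, forall t, S <= t ->
    `|x t i ord0 - n%:R^-1 * \sum_i x0 i ord0| <= e.
  (* The node [i] itself shows that [n] is positive; for [n = 0] there is no coordinate to bound. *)
  have n0 : (0 < n)%N by case: (n) i => [[]|].
  exact: (solution_converges n0 reff_pos sol i e0).
have [S HS] := choice conv.
near=> t; rewrite /Num.norm /= mx_normrE; apply/bigmax_leP; split; first exact: ltW.
move=> [i j] _ /=; rewrite !mxE (ord1 j) distrC; apply: HS.
apply: (@le_trans _ _ (\sum_i `|S i|)).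
  by apply: le_trans (ler_norm _) _; rewrite (bigD1 i) //= lerDl; apply: sumr_ge0.
by near: t; apply: nbhs_pinfty_ge; rewrite num_real.
Unshelve. all: by end_near. Qed.
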